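(* Assume that $\mathcal T$ is a rooted metric tree without loose ends (no vertices of degree $1$). Then $$\lambda_0(\mathbf H)\ge\frac{\mathrm K_{\mathrm{comb}}(\mathcal T)^2}{4\,\ell^\ast(\mathcal T)^2},\qquad \lambda_0^{\mathrm{ess}}(\mathbf H)\ge\frac{\mathrm K_{\mathrm{comb}}^{\mathrm{ess}}(\mathcal T)^2}{4\,\ell^\ast_{\mathrm{ess}}(\mathcal T)^2}.$$ In particular, $\lambda_0(\mathbf H)>0$ if and only if $\ell^\ast(\mathcal T)<\infty$, and the spectrum of $\mathbf H$ is purely discrete if and only if $\ell^\ast_{\mathrm{ess}}(\mathcal T)=0$.
   Context: Setting. $\mathcal T=(\mathcal V,\mathcal E,|\cdot|)$ is a metric graph whose underlying graph is an infinite, connected, locally finite tree (no cycles) with a distinguished root $o\in\mathcal V$, with edge lengths $|e|\in(0,\infty)$; each edge is identified with $[0,|e|]$ and endpoints at common vertices are glued. $\mathcal E_v$ is the set of edges incident to $v$, $\deg(v)=\#\mathcal E_v$. Standing assumption: $\deg(v)\neq2$ for all $v$. Put $\ell^\ast(\mathcal T)=\sup_{e\in\mathcal E}|e|\in(0,\infty]$ and $\ell^\ast_{\mathrm{ess}}(\mathcal T)=\inf_{\widetilde{\mathcal E}}\sup_{e\in\mathcal E\setminus\widetilde{\mathcal E}}|e|$, the infimum over finite $\widetilde{\mathcal E}\subset\mathcal E$. Conventions: $c/0=+\infty$ for $c>0$, $c/\infty=0$. Orientation and curvature. Each edge is directed away from the root (its initial vertex is the endpoint with smaller combinatorial distance to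 $o$); $\mathcal E_v^+,\mathcal E_v^-$ are the outgoing and incoming edges at $v$. $\mathrm K_{\mathrm{comb}}(v)=1-\#(\mathcal E_v^-)/\#(\mathcal E_v^+)$, so that $\mathrm K_{\mathrm{comb}}(v)=\frac{\deg(v)-2}{\deg(v)-1}$ for $v\ne o$. $\mathrm K_{\mathrm{comb}}(\mathcal T)=\inf_{v\in\mathcal V}\mathrm K_{\mathrm{comb}}(v)$ and $\mathrm K_{\mathrm{comb}}^{\mathrm{ess}}(\mathcal T)=\liminf_{v\in\mathcal V}\mathrm K_{\mathrm{comb}}(v)=\sup_{X\subset\mathcal V\text{ finite}}\inf_{v\in\mathcal V\setminus X}\mathrm K_{\mathrm{comb}}(v)$. Operator. $L^2(\mathcal T)=\bigoplus_eL^2(e)$. $\mathbf H_0$ acts as $-d^2/dx_e^2$ on each edge, on functions $f=(f_e)_e$ with $f_e\in H^2(e)$, nonzero on only finitely many edges, such that at every vertex $v$, $f$ is continuous and $\sum_{e\in\mathcal E_v}f_e'(v)=0$ (derivatives from $v$ into the edge). The Kirchhoff Laplacian $\mathbf H$ is the self-adjoint operator associated with the closure of the form $f\mapsto\int_{\mathcal T}|f'|^2dx$ on $\mathrm{dom}(\mathbf H_0)$. $\lambda_0(\mathbf H)=\inf\sigma(\mathbf H)$, $\lambda_0^{\mathrm{ess}}(\mathbf H)=\inf\sigma_{\mathrm{ess}}(\mathbf H)$ ($=+\infty$ if $\sigma_{\mathrm{ess}}(\mathbf H)=\varnothing$, i.e. if the spectrum is purely discrete). *)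

(* Defs.v *)
From HB Require Import structures.
From mathcomp Require Import all_boot all_order all_algebra finmap complex.
From mathcomp Require Import all_classical all_reals all_analysis.

Set Implicit Arguments.
Unset Strict Implicit.
Unset Printing Implicit Defensive.

Import Order.TTheory GRing.Theory Num.Theory.
Import numFieldNormedType.Exports.

Local Open Scope classical_set_scope.
Local Open Scope ring_scope.
Local Open Scope complex_scope.

(* The tree is a simple graph: [cycle adj] holds trivially for the sequences
   [:: x; y] with x, y adjacent, whence the bound 2 in [tree_acyclic]. *)
Record rooted_tree := RootedTree {
  vertex : choiceType;
  adj : rel vertex;
  root : vertex;
  adj_sym : symmetric adj;
  adj_irr : irreflexive adj;
  tree_connected :
    forall u v, exists p, path adj u p /\ last u p = v;
  tree_acyclic :
    forall c : seq vertex, cycle adj c -> uniq c -> (size c <= 2)%N;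
  tree_locally_finite : forall v, finite_set [set w | adj v w];
  tree_infinite : infinite_set [set: vertex] }.

Section Tree.
Variable T : rooted_tree.

Definition walk (u v : vertex T) (n : nat) : Prop :=
  exists p, [/\ path (@adj T) u p, last u p = v & size p = n].

Lemma walk_exists (u v : vertex T) : exists n, `[< walk u v n >].
Proof.
have [p [pathp lastp]] := tree_connected u v.
by exists (size p); apply/asboolP; exists p.
Qed.

Definition dist (u v : vertex T) : nat := ex_minn (walk_exists u v).

(* An edge is represented by its pair of endpoints (initial, terminal),
   directed away from the root.  In a tree the distances to the root of two
   adjacent vertices differ by one, so every undirected edge is represented
   exactly once. *)
Definition edge : choiceType :=
  {p : vertex T * vertex T |
    adj p.1 p.2 && (dist (root T) p.1 < dist (root T) p.2)%N}.

Definition init (e : edge) : vertex T := (val e).1.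
Definition term (e : edge) : vertex T := (val e).2.

Definition out_edges (v : vertex T) : set edge := [set e | init e = v].
Definition in_edges (v : vertex T) : set edge := [set e | term e = v].
Definition edges_at (v : vertex T) : set edge := out_edges v `|` in_edges v.

Definition deg (v : vertex T) : nat := #|` fset_set (edges_at v)|.

End Tree.

Record metric_tree (R : realType) := MetricTree {
  tree :> rooted_tree;
  len : edge tree -> R;
  len_gt0 : forall e, 0 < len e }.

Section Geometry.
Variables (R : realType) (T : metric_tree R).
Local Open Scope ereal_scope.

Definition max_length : \bar R := ereal_sup [set (len e)%:E | e in [set: edge T]].

Definition ess_max_length : \bar R :=
  ereal_inf [set ereal_sup [set (len e)%:E | e in ~` X] |
              X in [set X : set (edge T) | finite_set X]].

(* Meaningful only if [out_edges v] is nonempty, i.e. if v is not a leaf. *)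
Definition Kcomb (v : vertex T) : R :=
  (1 - #|` fset_set (in_edges v)|%:R / #|` fset_set (out_edges v)|%:R)%R.

Definition inf_Kcomb : \bar R :=
  ereal_inf [set (Kcomb v)%:E | v in [set: vertex T]].

Definition ess_Kcomb : \bar R :=
  ereal_sup [set ereal_inf [set (Kcomb v)%:E | v in ~` X] |
              X in [set X : set (vertex T) | finite_set X]].

End Geometry.

(* Integral of a complex-valued function over [a, b]. *)
Definition cint (R : realType) (a b : R) (f : R -> R[i]) : R[i] :=
  (\int[lebesgue_measure]_(x in `[a, b]) complex.Re (f x)) +i*
  (\int[lebesgue_measure]_(x in `[a, b]) complex.Im (f x)).

(* Sum of an absolutely summable family, by positive and negative parts. *)
Definition rsum (R : realType) (I : choiceType) (F : I -> R) : R :=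
  fine (\esum_(i in [set: I]) (Num.max (F i) 0)%:E) -
  fine (\esum_(i in [set: I]) (Num.max (- F i) 0)%:E).

Definition csum (R : realType) (I : choiceType) (F : I -> R[i]) : R[i] :=
  (rsum (fun i => complex.Re (F i))) +i* (rsum (fun i => complex.Im (F i))).

Definition cmeasurable (R : realType) (l : R) (f : R -> R[i]) : Prop :=
  measurable_fun `[0, l] (fun x => complex.Re (f x)) /\
  measurable_fun `[0, l] (fun x => complex.Im (f x)).

Definition sqnorm_itv (R : realType) (l : R) (f : R -> R[i]) : \bar R :=
  (\int[lebesgue_measure]_(x in `[0%R, l]) ((Normc.normc (f x)) ^+ 2)%:E)%E.

(* f is the C^1 representative of an element of H^2(0, l) and df is its
   derivative: f and df are absolutely continuous on [0, l], and the
   derivative of df is square integrable. *)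
Definition H2 (R : realType) (l : R) (f df : R -> R[i]) : Prop :=
  exists d2f : R -> R[i],
    [/\ cmeasurable l d2f,
        (sqnorm_itv l d2f < +oo)%E,
        forall x, 0 <= x <= l -> df x = df 0 + cint 0 x d2f &
        forall x, 0 <= x <= l -> f x = f 0 + cint 0 x df].

Section Operator.
Variables (R : realType) (T : metric_tree R).

(* A function on the metric tree; f e x is its value at the point of e at
   distance x from the initial vertex of e, and is relevant only for
   0 <= x <= len e.  Elements of L^2 are not quotiented: two functions are
   identified when the norm of their difference is zero. *)
Definition tree_fun := edge T -> R -> R[i].
Implicit Types f g h : tree_fun.

Definition sqnorm f : \bar R :=
  (\esum_(e in [set: edge T]) sqnorm_itv (len e) (f e))%E.

Definition L2 f : Prop :=
  (forall e, cmeasurable (len e) (f e)) /\ (sqnorm f < +oo)%E.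

Definition inner f g : R[i] :=
  csum (fun e => cint 0 (len e) (fun x => f e x * (g e x)^*)).

Definition value_at f (e : edge T) (v : vertex T) : R[i] :=
  if init e == v then f e 0 else f e (len e).

(* Derivative at v in the direction pointing from v into e. *)
Definition inward_deriv (df : tree_fun) (e : edge T) (v : vertex T) : R[i] :=
  if init e == v then df e 0 else - df e (len e).

(* f belongs to dom(H_0), and df is its derivative along the edges. *)
Definition dom_H0 f (df : tree_fun) : Prop :=
  [/\ forall e, H2 (len e) (f e) (df e),
      finite_set [set e | exists x : R, 0 <= x <= len e /\ f e x != 0],
      forall v e e', edges_at v e -> edges_at v e' ->
        value_at f e v = value_at f e' v &
      forall v, \sum_(e \in edges_at v) inward_deriv df e v = 0].

(* Convergence with respect to the form t[f] = ||f'||^2 on dom(H_0):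
   f_n -> f in L^2 and t[f_n - f_m] -> 0. *)
Definition form_cvg (fs dfs : nat -> tree_fun) f : Prop :=
  [/\ forall n, dom_H0 (fs n) (dfs n),
      (fun n => sqnorm (fs n - f)) @ \oo --> (0 : \bar R)%E &
      forall eps : R, 0 < eps -> exists N, forall m n, (N <= m)%N -> (N <= n)%N ->
        (sqnorm (dfs n - dfs m)%R <= eps%:E)%E].

Definition form_dom f : Prop := L2 f /\ exists fs dfs, form_cvg fs dfs f.

(* The closure of t satisfies t[f, h] = z.  The form t is closable, so z does
   not depend on the approximating sequences. *)
Definition closed_form f h (z : R[i]) : Prop :=
  exists fs dfs hs dhs,
    [/\ form_cvg fs dfs f, form_cvg hs dhs h &
        (fun n => Normc.normc (inner (dfs n) (dhs n) - z)) @ \oo --> (0 : R)].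

(* Graph of the self-adjoint operator associated with the closure of t. *)
Definition kirchhoff f g : Prop :=
  [/\ form_dom f, L2 g &
      forall h, form_dom h -> closed_form f h (inner g h)].

Definition scale (lambda : R) f : tree_fun := fun e x => lambda%:C * f e x.

(* H - lambda is onto, and one-to-one with bounded inverse. *)
Definition resolvent_set : set R :=
  [set lambda |
    (forall g, L2 g -> exists f, kirchhoff f (g + scale lambda f)) /\
    (exists C : R, forall f g, kirchhoff f (g + scale lambda f) ->
      (sqnorm f <= C%:E * sqnorm g)%E)].

(* The spectrum of a self-adjoint operator is real, so that only real spectral
   parameters are considered. *)
Definition spectrum : set R := ~` resolvent_set.

Definition eigenfun (lambda : R) f : Prop := kirchhoff f (scale lambda f).

Definition eigenvalue (lambda : R) : Prop :=
  exists f, eigenfun lambda f /\ sqnorm f != 0%E.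

Definition finite_multiplicity (lambda : R) : Prop :=
  exists (n : nat) (b : 'I_n -> tree_fun),
    (forall i, eigenfun lambda (b i)) /\
    forall f, eigenfun lambda f -> exists c : 'I_n -> R[i],
      sqnorm (fun e x => f e x - \sum_(i < n) c i * b i e x) = 0%E.

Definition isolated_in (S : set R) (lambda : R) : Prop :=
  exists2 eps : R, 0 < eps &
    forall mu, S mu -> `|mu - lambda| < eps -> mu = lambda.

Definition discrete_spectrum : set R :=
  [set lambda | [/\ spectrum lambda, isolated_in spectrum lambda,
                    eigenvalue lambda & finite_multiplicity lambda]].

Definition ess_spectrum : set R := spectrum `\` discrete_spectrum.

Definition lambda0 : \bar R := ereal_inf (EFin @` spectrum).
Definition lambda0_ess : \bar R := ereal_inf (EFin @` ess_spectrum).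

End Operator.

(* Main.v *)
(** On an edge e put the linear weight of slope k(e) = Kcomb (init e) whose value
    at the terminal vertex is 1, hence 1 - k(e) at the initial vertex.
    Integrating the derivative of (weight) |f|^2 over all edges, the boundary
    terms cancel at each vertex, because 1 - k is the ratio of the numbers of
    incoming and outgoing edges.  With |weight| <= 1 this gives
    int (k/len) |f|^2 <= 2 int |f| |f'|, so |f'|^2 dominates (c^2/4) |f|^2 as soon
    as k/len >= c.  When k/len >= c holds off finitely many edges only, Poincare's
    inequality on a fine subdivision of the exceptional edges gives the same
    bound up to finitely many L^2-continuous functionals.  A form bounded below
    by c0 modulo a finite-rank form has, below c0, only isolated eigenvalues of
    finite multiplicity: Riesz representation solves the equation for the
    modified form, and undoing the modification is a linear system.

    Conversely, the test functions t^2 (len - t)^2 supported on single edges are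
    orthogonal for both forms and have Rayleigh quotient of order 1/len^2.  Long
    edges thus push lambda0 to 0.  If infinitely many edges are longer than some
    r > 0 while the spectrum is purely discrete, splitting off finitely many
    eigenvectors raises the bottom of the form above any bound (the bottom of the
    form on an invariant subspace is in the spectrum), which contradicts the
    infinite orthogonal family of bounded Rayleigh quotient.

    Elements of L^2 are not quotiented and the spectrum is real, so everything is
    done with positive semidefinite forms on real vector spaces; the complex
    structure enters through the isometry [imul]. *)

Require Import Defs.
From HB Require Import structures.
From mathcomp Require Import all_boot all_order all_algebra finmap complex.
From mathcomp Require Import all_classical all_reals all_analysis.
From mathcomp Require Import measurable_realfun.
From mathcomp Require Import ring lra.

Set Implicit Arguments.
Unset Strict Implicit.
Unset Printing Implicit Defensive.

Import Order.TTheory GRing.Theory Num.Theory.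
Import numFieldNormedType.Exports.

Local Open Scope classical_set_scope.
Local Open Scope ring_scope.
Local Open Scope complex_scope.

(** * Positive semidefinite forms *)

(** The spectrum is accessible only through solvability of [operator f (g + l *: i f)], so spectral
    facts are drawn from resolvents, without a functional calculus. The central one is
    [resolvent_gap]: a symmetric resolvent has norm equal to its spectral radius, hence a gap of
    radius r around c gives |(H - c)f| >= r|f|. This turns a gap above the bottom of the form into a
    better lower bound. The obstacle there is that a vector u of the form domain need not lie in the
    range of H - L; it is approximated by (H - L)(H - L + e)^-1 u, and the remainder tends to an
    eigenvector at L.

    The 4 in both bounds comes from Young's inequality: k|f|^2 <= th|f|^2 + th^-1|f'|^2 gives |f'|^2
    >= th(k - th)|f|^2, which is best for th = k/2.

    The functionals that control the exceptional edges are averages over short intervals, because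
    they must be inner products with vectors of L^2: only then do they enter the equation as a
    finite-rank term.

    Closability relies on the derivatives in the core being absolutely continuous themselves: they
    can serve as test functions for weak convergence. *)

Section RealLemmas.
Variable R : realType.
Implicit Types a b c e x y : R.

Lemma le0_small x K : 0 < K -> (forall e : R, 0 < e -> x <= K * e) -> x <= 0.
Proof.
move=> K0 H; rewrite leNgt; apply/negP => x0.
have := H (x / (2 * K)); rewrite divr_gt0 ?mulr_gt0// => /(_ isT).
rewrite (_ : K * (x / (2 * K)) = x / 2); first by lra.
by field; lra.
Qed.

Lemma sq_le_abs_ge0 a e : 0 <= e -> a ^+ 2 <= e ^+ 2 -> `|a| <= e.
Proof.
by move=> e0; rewrite -[X in X <= _](real_normK (num_real a))
  ler_pXn2r// nnegrE.
Qed.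

Lemma discriminant_le a b c : 0 <= c ->
  (forall t, 0 <= a + 2 * t * b + t ^+ 2 * c) -> b ^+ 2 <= a * c.
Proof.
rewrite le_eqVlt => /orP[/eqP<-|c0] H.
  have [->|b0] := eqVneq b 0; first by rewrite expr0n/= mulr0.
  (* For c = 0 the expression is affine in t, and this t gives it the value -1. *)
  have := H (- (a + 1) / (2 * b)).
  rewrite (_ : _ + _ + _ = -1); first by lra.
  by field.
have := H (- b / c).
rewrite (_ : _ + _ + _ = (a * c - b ^+ 2) / c); last by field; lra.
by rewrite pmulr_lge0 ?invr_gt0// subr_ge0.
Qed.

Lemma inf_approx (S : set R) e : 0 < e -> has_inf S ->
  exists2 x, S x & x < inf S + e.
Proof. by move=> e0 hS; exact: inf_adherent. Qed.

End RealLemmas.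

Record psd_form (R : realType) (V : lmodType R) := PsdForm {
  form :> V -> V -> R;
  formC : forall x y, form x y = form y x;
  form_linear : forall a x y z, form (a *: x + y) z = a * form x z + form y z;
  form_ge0 : forall x, 0 <= form x x }.

Section FormTheory.
Variables (R : realType) (V : lmodType R) (B : psd_form V).
Implicit Types (x y z : V) (a : R).

Lemma formDl x y z : B (x + y) z = B x z + B y z.
Proof. by rewrite -[x in LHS]scale1r form_linear mul1r. Qed.

Lemma form0l z : B 0 z = 0.
Proof. by apply: (addrI (B 0 z)); rewrite -formDl !addr0. Qed.

Lemma formZl a x z : B (a *: x) z = a * B x z.
Proof. by rewrite -[a *: x]addr0 form_linear form0l addr0. Qed.

Lemma formNl x z : B (- x) z = - B x z.
Proof. by rewrite -scaleN1r formZl mulN1r. Qed.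

Lemma formBl x y z : B (x - y) z = B x z - B y z.
Proof. by rewrite formDl formNl. Qed.

Lemma form_suml (I : Type) (r : seq I) (P : pred I) (F : I -> V) z :
  B (\sum_(i <- r | P i) F i) z = \sum_(i <- r | P i) B (F i) z.
Proof. by elim/big_rec2: _ => [|i u v _ <-]; rewrite ?form0l// formDl. Qed.

Lemma formDr x y z : B z (x + y) = B z x + B z y.
Proof. by rewrite formC formDl !(formC B z). Qed.

Lemma form0r z : B z 0 = 0. Proof. by rewrite formC form0l. Qed.

Lemma formZr a x z : B z (a *: x) = a * B z x.
Proof. by rewrite formC formZl formC. Qed.

Lemma formNr x z : B z (- x) = - B z x.
Proof. by rewrite formC formNl formC. Qed.

Lemma formBr x y z : B z (x - y) = B z x - B z y.
Proof. by rewrite formDr formNr. Qed.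

Lemma form_sumr (I : Type) (r : seq I) (P : pred I) (F : I -> V) z :
  B z (\sum_(i <- r | P i) F i) = \sum_(i <- r | P i) B z (F i).
Proof. by rewrite formC form_suml; apply: eq_bigr => i _; rewrite formC. Qed.

Definition formE := (formDl, formDr, formBl, formBr, formZl, formZr,
  formNl, formNr, form0l, form0r).

Lemma sqformD x y : B (x + y) (x + y) = B x x + 2 * B x y + B y y.
Proof. by rewrite !formE (formC B y x); ring. Qed.

Lemma sqformB x y : B (x - y) (x - y) = B x x - 2 * B x y + B y y.
Proof. by rewrite !formE (formC B y x); ring. Qed.

Lemma sqformZ a x : B (a *: x) (a *: x) = a ^+ 2 * B x x.
Proof. by rewrite !formE; ring. Qed.

Lemma sqformBC x y : B (x - y) (x - y) = B (y - x) (y - x).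
Proof. by rewrite -opprB !formE; ring. Qed.

Lemma cauchy_schwarz x y : B x y ^+ 2 <= B x x * B y y.
Proof.
apply: discriminant_le; first exact: form_ge0.
move=> t; have := form_ge0 B (x + t *: y); rewrite sqformD !formE; lra.
Qed.

Lemma sqformD_le x y : B (x + y) (x + y) <= 2 * B x x + 2 * B y y.
Proof. by have := form_ge0 B (x - y); rewrite sqformB sqformD; lra. Qed.

Lemma sqformB_le x y : B (x - y) (x - y) <= 2 * B x x + 2 * B y y.
Proof. by have := sqformD_le x (- y); rewrite !formE; lra. Qed.

Lemma form_null x y : B x x = 0 -> B x y = 0.
Proof.
move=> x0; have := cauchy_schwarz x y; rewrite x0 mul0r => h.
by apply/eqP; rewrite -sqrf_eq0 eq_le h sqr_ge0.
Qed.

Definition form_cauchy (vs : nat -> V) := forall e : R, 0 < e ->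
  exists N, forall m n, (N <= m)%N -> (N <= n)%N ->
    B (vs m - vs n) (vs m - vs n) <= e.

Definition form_lim (vs : nat -> V) v := forall e : R, 0 < e ->
  exists N, forall n, (N <= n)%N -> B (vs n - v) (vs n - v) <= e.

Definition form_complete := forall vs, form_cauchy vs -> exists v, form_lim vs v.

Lemma small_invn (e : R) : 0 < e -> exists N, forall n, (N <= n)%N ->
  n.+1%:R^-1 <= e.
Proof.
move=> e0; exists (Num.truncn e^-1) => n nN.
rewrite -[leRHS]invrK lef_pV2 ?posrE ?invr_gt0//.
apply: ltW; apply: lt_le_trans (truncnS_gt _) _.
by rewrite ler_nat.
Qed.

(** The representing vector minimises B(x,x) - 2F(x). The form may have null vectors, so the
    minimiser is not unique, but existence is all that is claimed and completeness only has to
    provide some limit. *)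
Lemma form_riesz (F : V -> R) (M : R) : form_complete ->
  (forall a x y, F (a *: x + y) = a * F x + F y) ->
  (forall x, F x ^+ 2 <= M * B x x) ->
  exists v, forall h, B v h = F h.
Proof.
move=> cpl Flin Fbd.
have FD x y : F (x + y) = F x + F y by rewrite -[x in LHS]scale1r Flin mul1r.
have F0 : F 0 = 0 by apply: (addrI (F 0)); rewrite -FD !addr0.
have FZ a x : F (a *: x) = a * F x by rewrite -[a *: x]addr0 Flin F0 addr0.
pose J x := B x x - 2 * F x.
have M1 : 0 <= `|M| by [].
have Jlb x : - `|M| <= J x.
  have h : F x ^+ 2 <= `|M| * B x x.
    by apply: le_trans (Fbd x) _; rewrite ler_wpM2r ?form_ge0// ler_norm.
  rewrite /J; have b0 := form_ge0 B x; move: h M1 b0.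
  move: (F x) (B x x) `|M| => f b m h m0 b0; rewrite leNgt; apply/negP => k.
  have : (b + m) ^+ 2 < (2 * f) ^+ 2 by rewrite ltr_pXn2r ?nnegrE //; lra.
  have := sqr_ge0 (b - m); lra.
have hI : has_inf (range J).
  by split; [exists (J 0), 0|exists (- `|M|) => _ [x _ <-]].
pose I := inf (range J).
have IJ x : I <= J x by apply: ge_inf; [case: hI|exists x].
have ex n : exists v, J v <= I + n.+1%:R^-1.
  have [_ [v _ <-] /ltW h] := inf_approx (e := n.+1%:R^-1) (S := range J)
    (ltac:(by rewrite invr_gt0)) hI.
  by exists v.
have [vs vsP] := choice ex.
have vsC : form_cauchy vs.
  move=> e e0; have [N NP] := small_invn (e := e / 4) ltac:(by rewrite divr_gt0).
  exists N => m n Nm Nn.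
  (* Parallelogram law: the value of [J] at the midpoint is the mean of the two values minus a
     quarter of B(vs m - vs n), and it is at least [I]; so a minimising sequence is Cauchy. *)
  have := IJ (2^-1 *: (vs m + vs n)).
  have := vsP m; have := vsP n; have := NP _ Nm; have := NP _ Nn.
  rewrite /J sqformB !formE (formC B (vs n) (vs m)) FZ FD.
  move: (m.+1%:R^-1) (n.+1%:R^-1) => *; lra.
have [v vlim] := cpl _ vsC.
exists v => h; apply/eqP; rewrite -subr_eq0 -sqrf_eq0 eq_le sqr_ge0 andbT.
(* Almost minimality: J(vs n + t h) - J(vs n) >= -1/(n+1) for every t, so a quadratic polynomial in
   t is nonnegative and its discriminant gives the bound. *)
have vh n : (B (vs n) h - F h) ^+ 2 <= n.+1%:R^-1 * B h h.
  apply: discriminant_le; first exact: form_ge0.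
  move=> t; have := IJ (vs n + t *: h); have := vsP n.
  rewrite /J sqformD !formE FD FZ; move: (n.+1%:R^-1) => *.
  lra.
apply: (le0_small (K := 2 * B h h + 2 * B h h + 1)).
  by have := form_ge0 B h; lra.
move=> e e0; have [N NP] := small_invn e0; have [N' N'P] := vlim _ e0.
pose n := maxn N N'.
have h1 := N'P n (leq_maxr _ _); have h2 := NP n (leq_maxl _ _).
have h3 := vh n; have h4 := cauchy_schwarz (vs n - v) h.
have B0 := form_ge0 B h.
have h5 : (B (vs n) h - F h) ^+ 2 <= e * B h h.
  by apply: le_trans h3 _; rewrite ler_wpM2r.
have h6 : B (vs n - v) h ^+ 2 <= e * B h h.
  by apply: le_trans h4 _; rewrite ler_wpM2r.
rewrite formBl in h6.
have : (B v h - F h) ^+ 2 <=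
   2 * (B (vs n) h - F h) ^+ 2 + 2 * (B (vs n) h - B v h) ^+ 2.
  move: (B v h) (B (vs n) h) (F h) => a b c.
  rewrite -subr_ge0 (_ : _ - _ = (2 * b - c - a) ^+ 2); first exact: sqr_ge0.
  by ring.
by lra.
Qed.

End FormTheory.

Section FormConstructions.
Variable R : realType.

(** The constant depends on the vectors only; this uniformity in the coefficients is what a bound on
    a resolvent requires. *)
Lemma form_lincomb_bound (V : lmodType R) (B : psd_form V) (I : Type)
    (r : seq I) (x : I -> V) : exists2 K, 0 <= K &
  forall a : I -> R, B (\sum_(k <- r) a k *: x k) (\sum_(k <- r) a k *: x k)
                     <= K * \sum_(k <- r) a k ^+ 2.
Proof.
elim: r => [|k r [K K0 IH]].
  by exists 0 => // a; rewrite !big_nil form0l mulr0.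
exists (2 * K + 2 * B (x k) (x k)); first by have := form_ge0 B (x k); lra.
move=> a; rewrite !big_cons; apply: le_trans (sqformD_le _ _ _) _.
have := IH a; rewrite !formE.
have := form_ge0 B (x k); set S := \sum_(k <- r) a k ^+ 2.
have S0 : 0 <= S by apply: sumr_ge0 => j _; exact: sqr_ge0.
move: (B _ _) (B _ _) => b u b0 h.
have := mulr_ge0 b0 S0; have := mulr_ge0 K0 (sqr_ge0 (a k)); lra.
Qed.

Lemma form_complete_equiv (V : lmodType R) (B B' : psd_form V) (a K : R) :
  0 < a -> 0 < K -> (forall v, a * B v v <= B' v v) ->
  (forall v, B' v v <= K * B v v) -> form_complete B -> form_complete B'.
Proof.
move=> a0 K0 h1 h2 cB vs vsC.
have [|v vlim] := cB vs.
  move=> e e0; have [N NP] := vsC (a * e) (mulr_gt0 a0 e0).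
  exists N => m n Nm Nn; rewrite -(ler_pM2l a0).
  exact: le_trans (h1 _) (NP _ _ Nm Nn).
exists v => e e0; have [N NP] := vlim (e / K) (divr_gt0 e0 K0).
exists N => n Nn; apply: le_trans (h2 _) _.
by rewrite -ler_pdivlMl// mulrC; exact: NP.
Qed.

Variables (X V : lmodType R).

Lemma form_add_sym (B B' : psd_form V) x y : B x y + B' x y = B y x + B' y x.
Proof. by rewrite (formC B) (formC B'). Qed.

Lemma form_add_linear (B B' : psd_form V) a x y z :
  B (a *: x + y) z + B' (a *: x + y) z = a * (B x z + B' x z) + (B y z + B' y z).
Proof. by rewrite !form_linear; ring. Qed.

Lemma form_add_ge0 (B B' : psd_form V) x : 0 <= B x x + B' x x.
Proof. by rewrite addr_ge0// form_ge0. Qed.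

Definition form_add (B B' : psd_form V) : psd_form V :=
  PsdForm (form_add_sym B B') (@form_add_linear B B') (form_add_ge0 B B').

Lemma form_pullback_linear (B : psd_form X) (i : {linear V -> X}) a x y z :
  B (i (a *: x + y)) (i z) = a * B (i x) (i z) + B (i y) (i z).
Proof. by rewrite linearP form_linear. Qed.

Definition form_pullback (B : psd_form X) (i : {linear V -> X}) : psd_form V :=
  PsdForm (fun x y => formC B (i x) (i y)) (form_pullback_linear B i)
    (fun x => form_ge0 B (i x)).

End FormConstructions.

(** * The operator of a form and its spectrum *)

Section Operator.
Variables (R : realType) (X V : lmodType R).
Variables (ip : psd_form X) (T : psd_form V) (i : {linear V -> X}).

Local Notation mass := (form_pullback ip i).

(** The graph of the operator of [T], kept as a relation: with null vectors around, the image of f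
    is not a single element of [X]. *)
Definition operator f g := forall h, T f h = ip g (i h).

Definition resolvent (l : R) :=
  (forall g, exists f, operator f (g + l *: i f)) /\
  (exists C, forall f g, operator f (g + l *: i f) -> mass f f <= C * ip g g).

Definition eigenvec (l : R) f := operator f (l *: i f).

Hypothesis complete : form_complete (form_add T mass).

Lemma operator_lin a f g f' g' :
  operator f g -> operator f' g' -> operator (a *: f + f') (a *: g + g').
Proof. by move=> fg fg' h; rewrite !form_linear fg fg'. Qed.

Lemma operator_sym f g f' g' : operator f g -> operator f' g' ->
  ip g (i f') = ip (i f) g'.
Proof. by move=> fg fg'; rewrite -fg formC fg' formC. Qed.

Section Perturbation.
Variables (n : nat) (phi : 'I_n -> X) (C c l : R).
Hypothesis C0 : 0 <= C.
Hypothesis bound : forall v,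
  c * mass v v <= T v v + C * \sum_k (ip (i v) (phi k)) ^+ 2.
Hypothesis lc : l < c.

(** The form of H - l plus a finite-rank term, which makes it coercive for l < c. *)
Let a0 v w := T v w - l * mass v w +
  C * \sum_k ip (i v) (phi k) * ip (i w) (phi k).

Let a0_ge v : (c - l) * mass v v <= a0 v v.
Proof.
have -> : a0 v v = T v v - l * mass v v +
  C * \sum_k (ip (i v) (phi k)) ^+ 2 by [].
by have := bound v; lra.
Qed.

Let a0C v w : a0 v w = a0 w v.
Proof.
rewrite /a0 (formC T) (formC mass).
by congr (_ + _ * _); apply: eq_bigr => k _; rewrite mulrC.
Qed.

Let a0_lin b x y z : a0 (b *: x + y) z = b * a0 x z + a0 y z.
Proof.
rewrite /a0 !form_linear.
under eq_bigr do rewrite linearP form_linear mulrDl -mulrA.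
by rewrite big_split -mulr_sumr/=; ring.
Qed.

Let a0_ge0 v : 0 <= a0 v v.
Proof.
by apply: le_trans (a0_ge v); apply: mulr_ge0; [rewrite subr_ge0 ltW|exact: form_ge0].
Qed.

Let a : psd_form V := PsdForm a0C a0_lin a0_ge0.

Let a_complete : form_complete a.
Proof.
pose d := c - l; have d0 : 0 < d by rewrite subr_gt0.
pose S := \sum_k ip (phi k) (phi k).
have S0 : 0 <= S by apply: sumr_ge0 => k _; exact: form_ge0.
have c1 : 0 <= `|c| by [].
(* With t, m, b the values of [T], [mass] and the finite-rank term, al <= 1 gives t + b - l m >= al
   (t + b - c m) + d m, and al (1 + |c|) <= d/2 leaves at least al (t + m). *)
pose al := d / (2 * (1 + `|c| + d)).
have al0 : 0 < al by rewrite divr_gt0 ?mulr_gt0//; lra.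
have ald : al * (2 * (1 + `|c| + d)) = d by rewrite divfK//; lra.
have CS0 : 0 <= C * S by exact: mulr_ge0.
have av v : a v v = T v v - l * ip (i v) (i v) +
    C * \sum_k (ip (i v) (phi k)) ^+ 2 by [].
apply: (form_complete_equiv (B := form_add T mass) (a := al)
  (K := 1 + `|l| + C * S)) => //.
- by have : 0 <= `|l| by []; lra.
- move=> v; rewrite av; have := bound v; rewrite /=.
  have := form_ge0 T v; have := form_ge0 ip (i v).
  have : 0 <= C * \sum_k (ip (i v) (phi k)) ^+ 2.
    by apply: mulr_ge0 => //; apply: sumr_ge0 => k _; exact: sqr_ge0.
  move: (_ * \sum_k _) (T v v) (ip _ _) => b t m b0 m0 t0 h.
  have cc : c <= `|c| by exact: ler_norm.
  have alw := ltW al0; have dw := ltW d0.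
  have al1 : al <= 1 by nra.
  have : al * (t + b - c * m) <= t + b - c * m.
    by rewrite ler_piMl//; lra.
  have : al * c * m <= al * `|c| * m by rewrite ler_wpM2r// ler_wpM2l.
  have : 0 <= al * d * m by do 2 (apply: mulr_ge0 => //).
  have : 0 <= al * b by apply: mulr_ge0.
  have : al * (2 * (1 + `|c| + d)) * m = d * m by rewrite ald.
  have : 0 <= al * `|c| * m by do 2 (apply: mulr_ge0 => //).
  have : 0 <= d * m by apply: mulr_ge0.
  by rewrite /d; lra.
- move=> v; rewrite av /=.
  have : C * \sum_k (ip (i v) (phi k)) ^+ 2 <= C * S * ip (i v) (i v).
    rewrite -mulrA ler_wpM2l// mulr_suml ler_sum// => k _.
    by rewrite mulrC; exact: cauchy_schwarz.
  have := form_ge0 T v; have := form_ge0 ip (i v).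
  move: (_ * \sum_k _) (T v v) (ip _ _) => b t m m0 t0 h.
  have : - l * m <= `|l| * m by rewrite ler_wpM2r// -normrN ler_norm.
  have : 0 <= `|l| * t by exact: mulr_ge0.
  have : 0 <= C * S * t by exact: mulr_ge0.
  lra.
Qed.

Let solve g : exists f, (forall h, a f h = ip g (i h)) /\
  (c - l) ^+ 2 * mass f f <= ip g g.
Proof.
have d0 : 0 < c - l by rewrite subr_gt0.
have [||f fP] := @form_riesz _ _ a (fun h => ip g (i h)) (ip g g / (c - l))
  a_complete.
- by move=> b x y; rewrite linearP !formE.
- move=> x; apply: le_trans (cauchy_schwarz _ _ _) _.
  rewrite -mulrA ler_wpM2l ?form_ge0// ler_pdivlMl//.
  exact: a0_ge.
exists f; split => //.
have h : (c - l) * mass f f <= a f f by exact: a0_ge.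
rewrite fP in h.
have := cauchy_schwarz ip g (i f); have := form_ge0 ip g.
have := form_ge0 ip (i f); move: h; rewrite /=.
move: (ip (i f) (i f)) (ip g (i f)) (ip g g) => m x y h m0 y0 h2.
have [->|mn0] := eqVneq m 0; first by rewrite mulr0.
have mp : 0 < m by rewrite lt0r mn0.
rewrite -(ler_pM2r mp); apply: le_trans h2.
rewrite (_ : _ * m * m = ((c - l) * m) ^+ 2); last by ring.
by rewrite ler_sqr// nnegrE ?mulr_ge0//; [lra|apply: le_trans h; nra].
Qed.

Let a_null f : (forall h, a f h = 0) -> mass f f = 0.
Proof.
move=> h; apply/eqP; rewrite eq_le form_ge0 andbT.
have h1 : (c - l) * mass f f <= a f f by exact: a0_ge.
rewrite h in h1.
by rewrite -(ler_pM2l (x := c - l)) ?mulr0// subr_gt0.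
Qed.

(** A Fredholm alternative. The equation (H - l) f = g says that f solves the coercive problem with
    right-hand side g + C sum_k x_k phi_k, where x_k = (f, phi_k). Hence f = sol g + C sum_k x_k
    r_k, and the condition on x is the linear system x M = y with y_j = (sol g, phi_j). An
    invertible [M] makes l a resolvent point, a kernel vector of [M] produces an eigenvector. *)
Lemma resolvent_or_eigenvec :
  resolvent l \/ exists2 f, eigenvec l f & mass f f != 0.
Proof.
have d0 : 0 < c - l by rewrite subr_gt0.
have [sol solP] := choice solve.
pose r k := sol (phi k).
pose G := \matrix_(k, j) ip (i (r k)) (phi j).
pose M := 1%:M - C *: G.
have op_sol al g f : (forall h, a f h = ip g (i h) + C * \sum_k al k *
    ip (phi k) (i h)) -> (forall j, ip (i f) (phi j) = al j) ->
    operator f (g + l *: i f).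
  move=> fP fal h; have := fP h; rewrite /= /a0/= => e.
  rewrite !formE; move: e.
  under eq_bigr do rewrite fal (formC ip (i h)).
  by move: (\sum_(k < n) _) => s; lra.
have ipf al g j : ip (i (sol g + C *: \sum_k al k *: r k)) (phi j) =
    ip (i (sol g)) (phi j) + C * \sum_k al k * G k j.
  rewrite linearD linearZ linear_sum !formE form_suml; congr (_ + _ * _).
  by apply: eq_bigr => k _; rewrite linearZ !formE mxE.
have af al g h : a (sol g + C *: \sum_k al k *: r k) h =
    ip g (i h) + C * \sum_k al k * ip (phi k) (i h).
  rewrite !formE form_suml (solP g).1; congr (_ + _ * _).
  by apply: eq_bigr => k _; rewrite formZl (solP (phi k)).1.
have alM (al be : 'rV_n) : (al *m M = be) <->
    forall j, al 0 j = be 0 j + C * \sum_k al 0 k * G k j.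
  rewrite mulmxBr mulmx1 -scalemxAr; split=> [<- j|H]; first by rewrite !mxE; ring.
  by apply/rowP => j; rewrite !mxE [al 0 j]H; ring.
have [Mu|Mnu] := boolP (M \in unitmx); last first.
  right.
  have /rowV0Pn[v /sub_kermxP vM v0] : kermx M != 0.
    by rewrite kermx_eq0 row_free_unit.
  have [j vj] : exists j, v 0 j != 0.
    by move/rV0Pn: v0.
  pose al k := v 0 k.
  (* [sol] comes from a choice, so [sol 0] is only known to be a null vector; keeping it lets [ipf]
     and [af] apply as they stand. *)
  exists (sol 0 + C *: \sum_k al k *: r k).
    set f := _ + _; have := op_sol al 0 f; rewrite add0r; apply.
      by move=> h; rewrite af.
    move=> k; rewrite ipf.
    have s0 : mass (sol 0) (sol 0) = 0.
      apply/eqP; rewrite eq_le form_ge0 andbT.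
      have := (solP 0).2; rewrite form0l => h.
      by rewrite -(ler_pM2l (x := (c - l) ^+ 2)) ?mulr0// exprn_gt0.
    rewrite (form_null (phi k) (s0 : ip (i _) (i _) = 0)); have /alM/(_ k) := vM.
    by rewrite mxE => /esym.
  (* A null vector would be orthogonal to phi_j, but its product with phi_j is the nonzero
     coordinate v_j. *)
  apply/negP => /eqP /(@form_null _ _ ip _ (phi j)).
  rewrite ipf => e.
  have s0 : mass (sol 0) (sol 0) = 0.
    apply/eqP; rewrite eq_le form_ge0 andbT.
    have := (solP 0).2; rewrite form0l => h.
    by rewrite -(ler_pM2l (x := (c - l) ^+ 2)) ?mulr0// exprn_gt0.
  move: e; rewrite (form_null (phi j) (s0 : ip (i _) (i _) = 0)); have /alM/(_ j) := vM.
  by rewrite mxE => <- /eqP; rewrite (negbTE vj).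
left; split.
  move=> g; pose be : 'rV_n := \row_j ip (i (sol g)) (phi j).
  pose al := be *m invmx M.
  exists (sol g + C *: \sum_k al 0 k *: r k).
  apply: (op_sol (fun k => al 0 k)); first by move=> h; rewrite af.
  move=> j; rewrite ipf; have : al *m M = be by rewrite mulmxKV.
  by move/alM => ->; rewrite mxE.
have [K K0 KP] := form_lincomb_bound mass (index_enum 'I_n) r.
(* The coordinates of be M^-1 are inner products of [sol g] with these fixed vectors, so
   Cauchy-Schwarz bounds them by |sol g|. *)
pose psi k := \sum_j invmx M j k *: phi j.
pose S := \sum_k ip (psi k) (psi k).
exists ((2 + 2 * C ^+ 2 * K * S) * ((c - l) ^+ 2)^-1) => f g fg.
pose al := \row_j ip (i f) (phi j).
pose f' := sol g + C *: \sum_k al 0 k *: r k.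
(* f is an arbitrary solution; the coercive form vanishes on f - f', so f agrees with the explicit
   solution up to a null vector and inherits its bound. *)
have ff' : mass (f - f') (f - f') = 0.
  apply: a_null => h; rewrite formBl af /= /a0 fg /= !formE.
  rewrite (_ : \sum_k al 0 k * ip (phi k) (i h) =
    \sum_k ip (i f) (phi k) * ip (i h) (phi k)); last first.
    by apply: eq_bigr => k _; rewrite mxE (formC ip (phi _)).
  by move: (\sum_(k < n) _) => s; ring.
have sol_le := (solP g).2.
pose be : 'rV_n := \row_j ip (i (sol g)) (phi j).
have alE : al = be *m invmx M.
  suff <- : al *m M = be by rewrite mulmxK.
  apply/alM => j; rewrite [in LHS]mxE [be 0 j]mxE -ipf -/f'.
  by apply/eqP; rewrite -subr_eq0 -formBl -linearB (form_null _ (ff' : ip (i _) (i _) = 0)).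
have al_le : \sum_k al 0 k ^+ 2 <= mass (sol g) (sol g) * S.
  rewrite mulr_sumr ler_sum// => k _.
  have -> : al 0 k = ip (i (sol g)) (psi k).
    rewrite alE mxE form_sumr; apply: eq_bigr => j _.
    by rewrite formZr mxE mulrC.
  exact: cauchy_schwarz.
have -> : mass f f = mass f' f'.
  have ef : f' + (f - f') = f by rewrite addrC subrK.
  have := sqformD mass f' (f - f').
  by rewrite ef ff' (formC mass f') (form_null _ ff') mulr0 !addr0.
rewrite mulrAC; apply: (@le_trans _ _
   ((2 + 2 * C ^+ 2 * K * S) * mass (sol g) (sol g))); last first.
  rewrite -[leRHS]mulrA ler_wpM2l//; last by rewrite ler_pdivlMr 1?mulrC// exprn_gt0.
  rewrite addr_ge0// !mulr_ge0// ?sqr_ge0//.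
  by apply: sumr_ge0 => k _; exact: form_ge0.
apply: le_trans (sqformD_le _ _ _) _; rewrite [leRHS]mulrDl lerD//.
rewrite !formE.
rewrite (_ : 2 * C ^+ 2 * K * S * _ = 2 * (C * (C * (K *
  (mass (sol g) (sol g) * S))))); last by ring.
rewrite ler_wpM2l//; do 2 rewrite ler_wpM2l//.
by apply: le_trans (KP _) _; rewrite ler_wpM2l.
Qed.

End Perturbation.
End Operator.

Section Spectrum.
Variables (R : realType) (X V : lmodType R).
Variables (ip : psd_form X) (T : psd_form V) (i : {linear V -> X}).

Local Notation mass := (form_pullback ip i).
Local Notation resolvent := (resolvent ip T i).
Local Notation eigenvec := (eigenvec ip T i).

Definition isolated (l : R) := exists2 e : R, 0 < e &
  forall mu, ~ resolvent mu -> `|mu - l| < e -> mu = l.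

(** An eigenvector of nonzero mass already excludes [resolvent l], by [resolvent_eigenvec]. The span
    in the multiplicity clause is real. *)
Definition discrete (l : R) :=
  [/\ isolated l, exists2 f, eigenvec l f & mass f f != 0 &
    exists n (b : 'I_n -> V), (forall k, eigenvec l (b k)) /\
      forall f, eigenvec l f -> exists c : 'I_n -> R,
        mass (f - \sum_k c k *: b k) (f - \sum_k c k *: b k) = 0].

Lemma eigenvec_lin l a f g : eigenvec l f -> eigenvec l g ->
  eigenvec l (a *: f + g).
Proof.
move=> ef eg; rewrite /eigenvec linearP scalerDr scalerA mulrC -scalerA.
exact: operator_lin.
Qed.

Lemma eigenvec0 l : eigenvec l 0.
Proof. by move=> h; rewrite linear0 scaler0 !form0l. Qed.

Lemma eigenvec_sum l (I : Type) (r : seq I) (c : I -> R) (b : I -> V) :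
  (forall k, eigenvec l (b k)) -> eigenvec l (\sum_(k <- r) c k *: b k).
Proof.
move=> eb; elim: r => [|k r IH]; first by rewrite big_nil; exact: eigenvec0.
by rewrite big_cons; exact: eigenvec_lin.
Qed.

Lemma eigenvec_orthogonal l l' f g : eigenvec l f -> eigenvec l' g ->
  l != l' -> mass f g = 0.
Proof.
move=> ef eg ll'; have := operator_sym ef eg; rewrite !formE /= => /eqP.
by rewrite -subr_eq0 -mulrBl mulf_eq0 subr_eq0 (negbTE ll') => /eqP.
Qed.

Lemma resolvent_eigenvec l f : resolvent l -> eigenvec l f -> mass f f = 0.
Proof.
move=> [_ [C CP]] ef; apply/eqP; rewrite eq_le form_ge0 andbT.
by have := CP f 0; rewrite add0r form0l mulr0; apply.
Qed.

Section Orthogonal.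
Variables (m : nat) (f : 'I_m -> V).
Hypothesis orth : forall k k', k != k' -> mass (f k) (f k') = 0.

Lemma orth_mass (x : 'I_m -> R) k :
  mass (f k) (\sum_j x j *: f j) = x k * mass (f k) (f k).
Proof.
rewrite form_sumr (bigD1 k)//= big1 ?addr0 => [|j jk].
  exact: (formZr mass).
by have := formZr mass (x j) (f j) (f k); rewrite /= => ->;
  rewrite [ip _ _]orth ?mulr0// eq_sym.
Qed.

End Orthogonal.

(** Dimension count: a matrix with more rows than columns has a nonzero left kernel. *)
Lemma exists_orthogonal_comb n m (phi : 'I_n -> X) (f : 'I_m -> V) :
  (n < m)%N -> exists2 x : 'I_m -> R, (exists k, x k != 0) &
    forall j, ip (i (\sum_k x k *: f k)) (phi j) = 0.
Proof.
move=> nm; pose A := \matrix_(k < m, j < n) ip (i (f k)) (phi j).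
have /rowV0Pn[x /sub_kermxP xA /rV0Pn x0] : kermx A != 0.
  rewrite kermx_eq0 /row_free neq_ltn.
  by rewrite (leq_ltn_trans (rank_leq_col A)).
exists (x 0) => // j; rewrite linear_sum form_suml.
have /rowP/(_ j) := xA; rewrite !mxE; apply: etrans.
by apply: eq_bigr => k _; rewrite linearZ formZl !mxE.
Qed.

Section Below.
Hypothesis complete : form_complete (form_add T mass).
Variables (n : nat) (phi : 'I_n -> X) (C c : R).
Hypothesis C0 : 0 <= C.
Hypothesis bound : forall v,
  c * mass v v <= T v v + C * \sum_k (ip (i v) (phi k)) ^+ 2.

(** Among more than n eigenvectors some combination is orthogonal to all [phi]. On it the form is at
    least c, while orthogonality makes its Rayleigh quotient a mean of the l_k, all below c. *)
Lemma orthogonal_eigenvec_count m (f : 'I_m -> V) (l : 'I_m -> R) :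
  (forall k, eigenvec (l k) (f k)) -> (forall k, l k < c) ->
  (forall k, mass (f k) (f k) != 0) ->
  (forall k k', k != k' -> mass (f k) (f k') = 0) -> (m <= n)%N.
Proof.
move=> ef lc f0 orth; rewrite leqNgt; apply/negP => nm.
have [x [k xk] xphi] := exists_orthogonal_comb phi f nm.
set u := \sum_k x k *: f k in xphi.
have := bound u; rewrite big1 => [|j _]; last by rewrite xphi expr0n.
rewrite mulr0 addr0.
have mu : mass u u = \sum_k x k ^+ 2 * mass (f k) (f k).
  rewrite {1}/u form_suml; apply: eq_bigr => j _.
  by rewrite formZl orth_mass// expr2 mulrA.
have Tu : T u u = \sum_k l k * (x k ^+ 2 * mass (f k) (f k)).
  rewrite {1}/u form_suml; apply: eq_bigr => j _.
  rewrite formZl ef formZl -[ip _ _]/(mass (f j) u) orth_mass//.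
  by rewrite expr2; ring.
rewrite mu Tu mulr_sumr -subr_le0 -sumrB leNgt => /negP; apply.
rewrite (bigD1 k)//=; apply: ltr_wpDr.
  apply: sumr_ge0 => j _; rewrite -mulrBl; apply: mulr_ge0.
    by rewrite subr_ge0 ltW.
  by rewrite mulr_ge0 ?sqr_ge0 ?form_ge0.
rewrite -mulrBl mulr_gt0 ?subr_gt0// mulr_gt0//.
  by rewrite lt0r sqr_ge0 sqrf_eq0 xk.
by rewrite lt0r f0 form_ge0.
Qed.

(** Every spectral point below c is an eigenvalue, and eigenvectors of distinct eigenvalues are
    orthogonal, so there are at most n such points. *)
Lemma spectrum_below_finite : finite_set [set l | ~ resolvent l /\ l < c].
Proof.
apply: contrapT => /infinite_set_fset - /(_ n.+1)[B BS nB].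
pose l k := nth 0 (enum_fset B) k.
have lS (k : 'I_#|` B|) : ~ resolvent (l k) /\ l k < c.
  by apply: BS; rewrite /= mem_nth.
have /choice[f fP] (k : 'I_#|` B|) :
    exists f, eigenvec (l k) f /\ mass f f != 0.
  have [nres lc] := lS k.
  by have [//|[f ef f0]] := resolvent_or_eigenvec complete C0 bound lc;
    exists f.
suff : (#|` B| <= n)%N by rewrite leqNgt nB.
apply: (@orthogonal_eigenvec_count _ f (fun k => l k)).
- by move=> k; have [] := fP k.
- by move=> k; have [] := lS k.
- by move=> k; have [] := fP k.
- move=> k k' kk'; apply: eigenvec_orthogonal (fP k).1 (fP k').1 _.
  by rewrite nth_uniq// fset_uniq.
Qed.

Lemma finite_isolated (S : set R) (l : R) : finite_set S ->
  exists2 e : R, 0 < e & forall mu, S mu -> `|mu - l| < e -> mu = l.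
Proof.
move=> fS; have fS' : finite_set (S `\ l) by exact: finite_setD.
have : open (~` (S `\ l)).
  by apply: closed_openC; exact: (accessible_finite_set_closed.1
    (@hausdorff_accessible R (@Rhausdorff R))).
rewrite openE => /(_ l)[|e /= e0 eP]; first by move=> [_ /(_ erefl)].
exists e => // mu Smu mul; apply: contrapT => mun.
by apply: (eP mu); rewrite /ball_/= 1?distrC.
Qed.

Lemma resolvent_or_discrete l : l < c -> resolvent l \/ discrete l.
Proof.
move=> lc; have [res|[f0 ef0 f0n]] := resolvent_or_eigenvec complete C0 bound lc.
  by left.
right; split; last 2 first.
- by exists f0.
(* An orthogonal family of l-eigenvectors of maximal size spans the eigenspace up to null vectors:
   the remainder of f after projection would otherwise enlarge it. *)
- pose P m := `[< exists f : 'I_m -> V, [/\ forall k, eigenvec l (f k),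
    forall k, mass (f k) (f k) != 0 &
    forall k k', k != k' -> mass (f k) (f k') = 0] >].
  have P0 : exists m, P m.
    by exists 0; apply/asboolP; exists (fun=> 0); split => -[].
  have Pn m : P m -> (m <= n)%N.
    by move=> /asboolP[f [ef fn orth]];
      exact: (@orthogonal_eigenvec_count _ f (fun=> l)).
  case: (ex_maxnP P0 Pn) => m /asboolP[b [eb bn orth]] maxm.
  exists m, b; split => // f ef.
  exists (fun k => mass f (b k) / mass (b k) (b k)).
  set c' := fun k => _; set g := f - _; apply: contrapT => /eqP gn.
  have eg : eigenvec l g.
    rewrite /g addrC -scaleN1r; apply: eigenvec_lin => //.
    exact: eigenvec_sum.
  have gb k : mass (b k) g = 0.
    rewrite /g formBr orth_mass//; rewrite /c' divfK//.
    by rewrite (formC mass f) subrr.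
  have : P m.+1.
    apply/asboolP; exists (fun k => if unlift ord0 k is Some j then b j else g).
    split => [k|k|k k'].
    - by case: unliftP.
    - by case: unliftP => // _; apply/eqP => /gn.
    - case: (unliftP ord0 k) => [j ->|->]; case: (unliftP ord0 k') => [j' ->|->].
      + by move=> jj'; apply: orth; apply: contra_neq jj' => ->.
      + by move=> _; exact: gb.
      + by move=> _; rewrite formC gb.
      + by rewrite eqxx.
  by move=> /maxm; rewrite ltnn.
have [e e0 eP] := finite_isolated l spectrum_below_finite.
(* The second bound keeps mu below c, where the finiteness of the spectrum is known. *)
exists (Num.min e (c - l)); first by rewrite lt_min e0 subr_gt0.
move=> mu nres; rewrite lt_min => /andP[mue muc]; apply: eP => //; split => //.
by move: muc; rewrite ltr_norml => /andP[_]; rewrite ltrD2r.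
Qed.

End Below.

Lemma resolvent_below (c l : R) : form_complete (form_add T mass) ->
  (forall v, c * mass v v <= T v v) -> l < c -> resolvent l.
Proof.
move=> complete bound lc.
have b0 v : c * mass v v <= T v v + 0 * \sum_(k < 0) (ip (i v) 0) ^+ 2.
  by rewrite mul0r addr0.
have [//|[f ef]] := resolvent_or_eigenvec complete (lexx 0) b0 lc.
have := bound f; rewrite ef formZl -[ip _ _]/(mass f f) => h.
suff -> : mass f f = 0 by rewrite eqxx.
apply/eqP; rewrite eq_le form_ge0 andbT -(@ler_pM2l _ (c - l)) ?subr_gt0//.
by rewrite mulr0 mulrBl subr_le0.
Qed.

End Spectrum.

(** * Spectral gaps and the norm of the resolvent *)

Section Gap.
Variables (R : realType) (X V : lmodType R).
Variables (ip : psd_form X) (T : psd_form V) (i : {linear V -> X}).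

Local Notation mass := (form_pullback ip i).
Local Notation operator := (operator ip T i).
Local Notation resolvent := (resolvent ip T i).

Lemma resolvent_bound l : resolvent l -> exists2 C : R, 0 <= C &
  forall f g, operator f (g + l *: i f) -> mass f f <= C * ip g g.
Proof.
move=> [_ [C CP]]; exists `|C| => // f g /CP /le_trans; apply.
by rewrite ler_wpM2r ?form_ge0 ?ler_norm.
Qed.

(** Let Q be the resolvent at c and s the square of its norm. If s exceeded r^-2, then for q = sqrt
    s both q - Q and q + Q would be boundedly invertible, whereas a nearly maximising g is an
    approximate null vector of their product s - Q^2. *)
Lemma resolvent_gap (c r : R) : 0 < r ->
  (forall mu, `|mu - c| < r -> resolvent mu) ->
  forall f g, operator f (g + c *: i f) -> r ^+ 2 * mass f f <= ip g g.
Proof.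
move=> r0 gap.
have [surj _] : resolvent c by apply: gap; rewrite subrr normr0.
have [C C0 CP] : exists2 C : R, 0 <= C &
  forall f g, operator f (g + c *: i f) -> mass f f <= C * ip g g.
  by apply: resolvent_bound; apply: gap; rewrite subrr normr0.
pose S := [set x | exists f g, [/\ operator f (g + c *: i f), ip g g <= 1 &
   x = mass f f]].
have S0 : S 0.
  exists 0, 0; rewrite !form0l; split => //.
  by move=> h; rewrite linear0 scaler0 addr0 !form0l.
have SC x : S x -> x <= C.
  move=> [f [g [/CP fg g1 ->]]]; apply: le_trans fg _.
  by rewrite -[leRHS]mulr1 ler_wpM2l.
have hS : has_sup S by split; [exists 0|exists C => x /SC].
set s := sup S.
have s0 : 0 <= s by exact: (sup_upper_bound hS).
have scaled f g : operator f (g + c *: i f) -> mass f f <= s * ip g g.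
  move=> fg; have [g0|gn] := eqVneq (ip g g) 0.
    by have := CP _ _ fg; rewrite g0 !mulr0.
  have gp : 0 < ip g g by rewrite lt0r gn form_ge0.
  pose t := (Num.sqrt (ip g g))^-1.
  have t2 : t ^+ 2 = (ip g g)^-1 by rewrite exprVn sqr_sqrtr// ltW.
  have : S (mass (t *: f) (t *: f)).
    exists (t *: f), (t *: g); split => //.
      move=> h; rewrite linearZ scalerA (mulrC c) -scalerA -scalerDr !formZl.
      by rewrite fg.
    by rewrite !formE mulrA -expr2 t2 mulVf.
  move/(sup_upper_bound hS); rewrite !formE mulrA -expr2 t2 -/s.
  by rewrite ler_pdivrMl// mulrC.
suff sr : s * r ^+ 2 <= 1.
  move=> f g /scaled fg; have r2 : 0 <= r ^+ 2 by exact: sqr_ge0.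
  have := ler_wpM2l r2 fg; have := ler_wpM2r (form_ge0 ip g) sr; lra.
rewrite leNgt; apply/negP => sr.
have sp : 0 < s by rewrite lt0r s0 andbT; apply/eqP => s00; move: sr;
  rewrite s00 mul0r ltr10.
pose q := Num.sqrt s.
have q2 : q ^+ 2 = s by rewrite sqr_sqrtr.
have qp : 0 < q by rewrite sqrtr_gt0.
have qr : q^-1 < r.
  rewrite -div1r ltr_pdivrMr// mulrC.
  by rewrite -(@ltr_pXn2r _ 2)// ?nnegrE ?mulr_ge0 ?ltW// expr1n exprMn q2.
(* As 1/q < r, the points c + 1/q and c - 1/q lie in the gap; the resolvents there invert q - Q and
   q + Q respectively. *)
have [C1 C10 C1P] : exists2 C : R, 0 <= C & forall f g,
    operator f (g + (c + q^-1) *: i f) -> mass f f <= C * ip g g.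
  apply: resolvent_bound; apply: gap.
  by rewrite addrAC subrr add0r gtr0_norm ?invr_gt0.
have [C2 C20 C2P] : exists2 C : R, 0 <= C & forall f g,
    operator f (g + (c - q^-1) *: i f) -> mass f f <= C * ip g g.
  apply: resolvent_bound; apply: gap.
  by rewrite addrAC subrr add0r normrN gtr0_norm ?invr_gt0.
have qn : q != 0 by rewrite gt_eqF.
suff : s <= 0 by rewrite leNgt sp.
(* Collects the two successive bounds: |f|^2 is at most (K - 1) e and exceeds s - e, hence s < K e
   for every e > 0. *)
pose K := 1 + C2 * ((2 * s + 2 * C1) / s ^+ 2).
have K0 : 0 < K.
  by rewrite ltr_pwDl// mulr_ge0// divr_ge0 ?sqr_ge0// addr_ge0// mulr_ge0.
apply: (@le0_small _ _ K K0) => e e0.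
have [_ [f [g [fg g1 ->]]] fs] := sup_adherent e0 hS.
rewrite -/s in fs.
have [f2 f2P] := surj (i f).
pose d := s *: g - i f2.
have m1 : mass f2 f2 <= s * mass f f := scaled _ _ f2P.
have gf2 : ip g (i f2) = mass f f.
  by have := operator_sym fg f2P; rewrite /= !formE; lra.
(* the approximate null vector [d] of [(q - Q) (q + Q)], Q the resolvent at c *)
have d_le : ip d d <= s * e.
  rewrite /d sqformB !formE gf2.
  have := ler_wpM2l (sqr_ge0 s) g1.
  have : s * (s - mass f f) <= s * e by rewrite ler_wpM2l//; lra.
  by move: m1; rewrite /=; move: (ip (i f2) (i f2)) (ip (i f) (i f)) (ip g g);
    move=> x y z; lra.
pose y := q *: f + f2.
pose w := q *: g + i f.
have iy : i y = q *: i f + i f2 by rewrite linearD linearZ.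
have yw : operator y (w + c *: i y).
  have h := operator_lin q fg f2P.
  move=> v; rewrite h; congr (ip _ (i v)).
  rewrite iy /w !scalerDr !scalerA (mulrC c q) -!addrA; congr (_ + _).
  by rewrite addrCA.
have wE : w = q^-1 *: (d + i y).
  have -> : d + i y = q *: w.
    rewrite /d iy /w scalerDr scalerA -expr2 q2.
    by rewrite addrACA addNr addr0.
  by rewrite scalerA mulVf// scale1r.
have my : mass y y <= C1 * (s^-1 * (s * e)).
  apply: le_trans (C1P y (q^-1 *: d) _) _.
    move=> h; rewrite yw wE; congr (ip _ _).
    by rewrite scalerDr scalerDl -addrA (addrC (q^-1 *: i y)).
  by rewrite sqformZ exprVn q2 ler_wpM2l// ler_wpM2l ?invr_ge0.
rewrite mulKf ?gt_eqF// in my.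
have mw : ip w w <= s^-1 * (2 * (s * e) + 2 * (C1 * e)).
  rewrite wE sqformZ exprVn q2.
  rewrite ler_wpM2l ?invr_ge0//; apply: le_trans (sqformD_le _ _ _) _.
  by apply: lerD; rewrite ler_wpM2l.
have mf : mass f f <= C2 * (s^-1 * (s^-1 * (2 * (s * e) + 2 * (C1 * e)))).
  apply: le_trans (C2P f (q^-1 *: w) _) _.
    move=> h; rewrite fg; congr (ip _ _).
    rewrite /w scalerDr scalerA mulVf// scale1r scalerBl.
    by rewrite -addrA (addrC (q^-1 *: i f)) subrK.
  rewrite sqformZ exprVn q2 ler_wpM2l//.
  by rewrite ler_wpM2l ?invr_ge0.
have -> : K * e = e + C2 * (s^-1 * (s^-1 * (2 * (s * e) + 2 * (C1 * e)))).
  by rewrite /K; field; rewrite gt_eqF.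
by move: mf fs => /=; lra.
Qed.

End Gap.

(** * Raising the lower bound of the form at an isolated point of the spectrum *)

Section Bottom.
Variables (R : realType) (X V : lmodType R).
Variables (ip : psd_form X) (T : psd_form V) (i : {linear V -> X}).

Local Notation mass := (form_pullback ip i).
Local Notation operator := (operator ip T i).
Local Notation resolvent := (resolvent ip T i).
Local Notation eigenvec := (eigenvec ip T i).

Hypothesis complete : form_complete (form_add T mass).

Definition perp (s : seq V) u := forall b, b \in s -> mass u b = 0.

Lemma perp_lin s a u v : perp s u -> perp s v -> perp s (a *: u + v).
Proof. by move=> pu pv b bs; rewrite form_linear pu// pv// mulr0 addr0. Qed.

Lemma perpB s u v : perp s u -> perp s v -> perp s (u - v).
Proof. by move=> pu pv b bs; rewrite formBl pu// pv// subr0. Qed.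

(** The eigenvalue may vary along the list, so such lists can be concatenated; their orthogonal
    complements replace spectral subspaces. *)
Definition eigenlist (s : seq V) := forall b, b \in s -> exists l, eigenvec l b.

(** Symmetry gives (l - l')(f, b) = 0 for each listed eigenvector b with eigenvalue l'. If l = l',
    then b is itself null, since l is a resolvent point. *)
Lemma resolvent_perp s l a f g : eigenlist s -> resolvent l -> perp s g ->
  operator f (a *: i g + l *: i f) -> perp s f.
Proof.
move=> es res pg fg b bs; have [l' eb] := es _ bs.
have := operator_sym fg eb; rewrite !formE -[ip (i g) _]/(mass g b) (pg _ bs).
rewrite mulr0 add0r => /eqP; rewrite -subr_eq0 -mulrBl mulf_eq0.
have [ll'|ll'] := eqVneq l l'.
  rewrite -ll' in eb => _; rewrite formC form_null//.
  exact: resolvent_eigenvec res eb.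
by rewrite subr_eq0 (negbTE ll') => /eqP.
Qed.

Section AtBottom.
Variables (s : seq V) (L eta : R).
Hypothesis es : eigenlist s.
Hypothesis bottom : forall u, perp s u -> L * mass u u <= T u u.
Hypothesis eta0 : 0 < eta.
Hypothesis punctured : forall mu, mu != L -> `|mu - L| < eta -> resolvent mu.
Hypothesis kernel : forall f, eigenvec L f -> perp s f -> mass f f = 0.

Let b u v := T u v - L * mass u v.

Let bE u v : b (u - v) (u - v) = b u u - 2 * b u v + b v v.
Proof. by rewrite /b !sqformB; ring. Qed.

Let b_ge0 u : perp s u -> 0 <= b u u.
Proof. by move=> pu; rewrite subr_ge0 bottom. Qed.

Let bCS u v : perp s u -> perp s v -> b u v ^+ 2 <= b u u * b v v.
Proof.
move=> pu pv; apply: discriminant_le; first exact: b_ge0.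
move=> t; have := b_ge0 (perp_lin t pv pu).
rewrite (_ : b _ _ = b u u + 2 * t * b u v + t ^+ 2 * b v v)//.
by rewrite /b (addrC (t *: v)) !sqformD !formE; ring.
Qed.

(** The interval (L, L + eta) is the ball of radius k about L + k, the shape in which
    [resolvent_gap] takes a gap. *)
Let k := eta / 2.
Let k0 : 0 < k. Proof. by rewrite divr_gt0. Qed.

Let gap mu : `|mu - (L + k)| < k -> resolvent mu.
Proof.
move=> muk; apply: punctured.
  apply/eqP => mul; move: muk; rewrite mul opprD addrA subrr add0r normrN.
  by rewrite gtr0_norm ?ltxx.
move: muk; rewrite !ltr_norml /k => /andP[h1 h2].
have := eta0; move: h1 h2.
rewrite !(ltrBlDr, ltrBrDl) => h1 h2 h3; apply/andP; split; lra.
Qed.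

(* On vectors of the range of [A = H - L] the gap [(L, L + 2k)] of the spectrum
   forces [A >= 2k]: it gives [|A p|^2 >= 2k (A p, p)], and [|A p|^2 = b(p, A p)]
   when [A p] lies in the form domain. *)
Let range_bound p d : perp s p -> perp s d -> operator p (i d + L *: i p) ->
  2 * k * mass d d <= b d d.
Proof.
move=> pp pd op.
have h1 : 2 * k * mass d p <= mass d d.
  have op' : operator p (i (d - k *: p) + (L + k) *: i p).
    move=> h; rewrite op; congr (ip _ _).
    by rewrite linearB linearZ scalerDl addrACA -addrA addrCA addNr addr0 addrC.
  have := resolvent_gap k0 gap op'.
  rewrite -[ip (i _) _]/(mass (d - k *: p) (d - k *: p)) sqformB !formE /=.
  by lra.
have bp h : b p h = mass d h by rewrite /b op formDl formZl /=; ring.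
have h2 := bCS pp pd; rewrite !bp (formC mass d p) in h2.
have m0 := form_ge0 mass d; have bd0 := b_ge0 pd.
have [->|mn] := eqVneq (mass d d) 0; first by rewrite mulr0.
have mp : 0 < mass d d by rewrite lt0r mn.
rewrite -(ler_pM2r mp); rewrite (formC mass) in h2.
have : 2 * k * (mass d d ^+ 2) <= 2 * k * (mass d p * b d d).
  by rewrite ler_wpM2l//; have := k0; lra.
have := ler_wpM2r bd0 h1; lra.
Qed.

(** Split u = y_n + z_n with y_n = e_n (H - L + e_n)^-1 u. Then z_n = (H - L)(y_n / e_n) lies in the
    range of H - L, where [range_bound] gives 2k |z_n|^2 <= b(z_n, z_n) <= b(u, u). The y_n converge
    to an eigenvector at L inside the complement, which is null by hypothesis, so the bound passes
    to u. *)
Lemma spectral_bottom_gap : exists2 d, 0 < d &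
  forall u, perp s u -> (L + d) * mass u u <= T u u.
Proof.
exists k => // u pu; rewrite mulrDl -lerBrDl -/(b u u).
(* The shift by 2 makes e_n strictly smaller than eta, so that L - e_n is in the punctured
   neighbourhood already for n = 0. *)
pose e n := eta / n.+2%:R.
have e0 n : 0 < e n by rewrite divr_gt0.
have elt n : e n < eta.
  by rewrite ltr_pdivrMr// ltr_pMr// ltr1n.
have res n : resolvent (L - e n).
  apply: punctured; last by rewrite addrAC subrr add0r normrN gtr0_norm.
  by rewrite lt_eqF// gtrBl.
have /choice[y yP] n : exists y, operator y (e n *: i u + (L - e n) *: i y).
  by have [surj _] := res n; exact: surj.
pose z n := u - y n.
have py n : perp s (y n) by exact: resolvent_perp es (res n) pu (yP n).
have pz n : perp s (z n) by exact: perpB.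
have yz n : operator (y n) (e n *: i (z n) + L *: i (y n)).
  move=> h; rewrite yP; congr (ip _ _).
  by rewrite linearB scalerBr scalerBl addrA addrAC.
have rz n : operator ((e n)^-1 *: y n)
    (i (z n) + L *: i ((e n)^-1 *: y n)).
  move=> h; rewrite formZl yz -formZl; congr (ip _ _).
  rewrite scalerDr !scalerA mulVf ?gt_eqF// scale1r linearZ scalerA.
  by rewrite (mulrC L).
have pZ a v : perp s v -> perp s (a *: v).
  by move=> pv w ws; rewrite formZl pv// mulr0.
have mz n := range_bound (pZ _ _ (py n)) (pz n) (rz n).
have byh n h : b (y n) h = e n * mass (z n) h.
  by rewrite /b yz formDl !formZl /=; ring.
have bu n : b u u = b (y n) (y n) + 2 * (e n * mass (z n) (z n)) + b (z n) (z n).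
  rewrite -byh -[u in LHS](subrK (y n)) -/(z n) addrC -[in LHS](opprK (z n)).
  by rewrite bE /b !formE; ring.
have mz0 n : 0 <= mass (z n) (z n) by exact: form_ge0.
have by0 n : 0 <= b (y n) (y n) by exact: b_ge0.
have bz0 n : 0 <= b (z n) (z n) by exact: b_ge0.
have emz n : 0 <= e n * mass (z n) (z n) by rewrite mulr_ge0// ltW.
have bzu n : 2 * k * mass (z n) (z n) <= b u u.
  by apply: le_trans (mz n) _; rewrite (bu n); have := by0 n; have := emz n; lra.
have bu0 : 0 <= b u u by exact: b_ge0.
(* [b(y,y) = e (z,y)] and the gap bounds it by [e^2 |z|^2 / 2k] *)
have byy n : b (y n) (y n) <= (e n) ^+ 2 * (b u u / (2 * k) ^+ 2).
  have k2 : 0 < 2 * k by rewrite mulr_gt0.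
  have e2 : 0 <= e n ^+ 2 by exact: sqr_ge0.
  have mzn := bzu n.
  have gapy : 2 * k * b (y n) (y n) <= e n ^+ 2 * mass (z n) (z n).
    have op' : operator (y n) (i (e n *: z n - k *: y n) + (L + k) *: i (y n)).
      move=> h; rewrite yz; congr (ip _ _).
      rewrite (linearB i (e n *: z n)) !linearZ /= scalerDl.
      by rewrite [RHS]addrACA scalerN addNr addr0.
    have := resolvent_gap k0 gap op'.
    rewrite -[ip (i _) _]/(mass (e n *: z n - k *: y n) (e n *: z n - k *: y n)).
    rewrite byh sqformB !formE /=; lra.
  rewrite -(ler_pM2l k2); apply: le_trans gapy _.
  rewrite mulrCA ler_wpM2l// -(ler_pM2l k2); apply: le_trans mzn _.
  by rewrite le_eqVlt; apply/orP; left; apply/eqP; field; rewrite gt_eqF.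
pose K := b u u / (2 * k) ^+ 2.
have K0 : 0 <= K by rewrite divr_ge0// sqr_ge0.
have elim (d : R) : 0 < d -> exists N, forall n, (N <= n)%N -> e n <= d.
  move=> d0; have [N NP] := small_invn (divr_gt0 d0 eta0).
  exists N => n Nn; have := NP n.+1 (leq_trans Nn (leqnSn _)).
  by rewrite ler_pdivlMr// mulrC.
have e1 (d : R) : 0 < d -> exists N, forall n, (N <= n)%N -> e n ^+ 2 * K <= d.
  move=> d0; have [N NP] := elim (Num.min 1 (d / (K + 1))) ltac:(by
    rewrite lt_min ltr01 divr_gt0// ltr_wpDl).
  exists N => n Nn; have := NP n Nn; rewrite le_min => /andP[en1].
  rewrite ler_pdivlMr ?ltr_wpDl// => h.
  apply: le_trans h; rewrite mulrDr mulr1.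
  have : e n ^+ 2 * K <= e n * K.
    by rewrite ler_wpM2r// expr2 ger_pMl.
  by have := ltW (e0 n); lra.
(* y_m - y_n = z_n - z_m is again in the range of H - L, so [b] controls its mass; the right
   inequality shows that [b] of it tends to 0. *)
have ymy m n : 2 * k * mass (y m - y n) (y m - y n) <=
    b (y m - y n) (y m - y n) <= 2 * (e m ^+ 2 * K) + 2 * (e n ^+ 2 * K).
  apply/andP; split.
    apply: (@range_bound ((e n)^-1 *: y n - (e m)^-1 *: y m)).
    - by apply: perpB; exact: pZ.
    - exact: perpB.
    - move=> h; rewrite formBl rz rz -formBl; congr (ip _ _).
      rewrite (linearB i (y m)) (linearB i (_ *: y n)) scalerBr opprD addrACA.
      congr (_ + _); rewrite !(linearB i u) opprB addrC addrA subrK.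
      by [].
  have := b_ge0 (perp_lin 1 (py m) (py n)).
  have -> : b (1 *: y m + y n) (1 *: y m + y n) =
    b (y m) (y m) + 2 * b (y m) (y n) + b (y n) (y n).
    by rewrite /b scale1r !sqformD; ring.
  by have := byy m; have := byy n; rewrite bE -/K; lra.
have k2 : 0 < 2 * k by rewrite mulr_gt0.
have [|yy ylim] := complete (vs := y).
  move=> d d0.
  (* The full energy is b + (L + 1) mass, and mass <= b / (2k) on these differences, so the energy
     is at most W b. *)
  pose W := 1 + (`|L| + 1) / (2 * k).
  have W0 : 0 < W by rewrite ltr_pwDl// divr_ge0 ?addr_ge0// ltW.
  have [N NP] := e1 (d / W / 4) ltac:(by rewrite !divr_gt0).
  exists N => m n Nm Nn; have /andP[h1 h2] := ymy m n.
  have h3 := NP _ Nm; have h4 := NP _ Nn.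
  set q := y m - y n in h1 h2 *.
  have h5 : b q q <= d / W.
    by apply: le_trans h2 _; move: h3 h4; lra.
  have -> : form_add T mass q q = b q q + (L + 1) * mass q q.
    by rewrite /b /=; ring.
  have h6 : mass q q <= (d / W) / (2 * k).
    by rewrite ler_pdivlMr// mulrC; exact: le_trans h5.
  have L1 : L + 1 <= `|L| + 1 by rewrite lerD2r ler_norm.
  have L0 : 0 <= `|L| + 1 by exact: addr_ge0.
  have h7 : (L + 1) * mass q q <= (`|L| + 1) * ((d / W) / (2 * k)).
    apply: (@le_trans _ _ ((`|L| + 1) * mass q q)).
      by rewrite ler_wpM2r ?form_ge0.
    by rewrite ler_wpM2l.
  apply: le_trans (lerD h5 h7) _.
  rewrite le_eqVlt; apply/orP; left; apply/eqP.
  transitivity (d / W * (1 + (`|L| + 1) / (2 * k))); first by ring.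
  by rewrite -/W divfK// gt_eqF.
have mlim (d : R) : 0 < d -> exists N, forall n, (N <= n)%N ->
    [/\ mass (y n - yy) (y n - yy) <= d, T (y n - yy) (y n - yy) <= d &
        e n ^+ 2 * K <= d].
  move=> d0; have [N NP] := ylim _ d0; have [N' N'P] := e1 _ d0.
  exists (maxn N N') => n; rewrite geq_max => /andP[/NP nN /N'P h2].
  have h1 : T (y n - yy) (y n - yy) + mass (y n - yy) (y n - yy) <= d by [].
  have t0 := form_ge0 T (y n - yy); have m0 := form_ge0 mass (y n - yy).
  by split => //; lra.
have pyy : perp s yy.
  move=> w ws; apply/eqP; rewrite -sqrf_eq0 eq_le sqr_ge0 andbT.
  apply: (@le0_small _ _ (1 + mass w w)).
    by rewrite ltr_pwDl// form_ge0.
  move=> d d0; have [N /(_ N (leqnn _))[h1 _ _]] := mlim _ d0.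
  have := cauchy_schwarz mass (y N - yy) w.
  rewrite formBl (py N w ws) sub0r sqrrN => h2.
  have := ler_wpM2r (form_ge0 mass w) h1; lra.
(* b(y_N, h) = e_N (z_N, h) tends to 0 because the z_N are bounded in mass, so b(yy, h) = 0 for
   every h. *)
have eyy : eigenvec L yy.
  move=> h; rewrite formZl -[ip _ _]/(mass yy h).
  apply/eqP; rewrite -subr_eq0 -/(b yy h) -sqrf_eq0 eq_le sqr_ge0 andbT.
  apply: (@le0_small _ _ (1 + (3 * T h h + 3 * L ^+ 2 * mass h h +
      3 * (2 * k) * mass h h))).
    have := form_ge0 T h; have := mulr_ge0 (sqr_ge0 L) (form_ge0 mass h).
    by have := mulr_ge0 (ltW k2) (form_ge0 mass h); lra.
  move=> d d0; have [N /(_ N (leqnn _))[h1 h2 h3]] := mlim _ d0.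
  have c1 := cauchy_schwarz mass (y N - yy) h.
  have c2 := cauchy_schwarz T (y N - yy) h.
  have c3 := cauchy_schwarz mass (z N) h.
  have mh := form_ge0 mass h; have Th := form_ge0 T h.
  have h4 : (e N * mass (z N) h) ^+ 2 <= 2 * k * d * mass h h.
    rewrite exprMn; apply: (@le_trans _ _ (e N ^+ 2 * (mass (z N) (z N) * mass h h))).
      by rewrite ler_wpM2l ?sqr_ge0.
    rewrite mulrA ler_wpM2r//.
    apply: (@le_trans _ _ (2 * k * (e N ^+ 2 * K))); last by rewrite ler_pM2l.
    rewrite mulrCA ler_wpM2l ?sqr_ge0// /K -(ler_pM2l k2).
    apply: le_trans (bzu N) _.
    by rewrite le_eqVlt; apply/orP; left; apply/eqP; field; rewrite gt_eqF.
  have h5 : (T (y N - yy) h) ^+ 2 <= d * T h h.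
    by apply: le_trans c2 _; rewrite ler_wpM2r.
  have h6 : (mass (y N - yy) h) ^+ 2 <= d * mass h h.
    by apply: le_trans c1 _; rewrite ler_wpM2r.
  have h7 : L ^+ 2 * (mass (y N - yy) h) ^+ 2 <= L ^+ 2 * (d * mass h h).
    by rewrite ler_wpM2l ?sqr_ge0.
  have -> : b yy h = e N * mass (z N) h - T (y N - yy) h + L * mass (y N - yy) h.
    by rewrite -byh /b !formBl; ring.
  move: h4 h5 h7; move: (e N * _) (T (y N - yy) h) (mass (y N - yy) h).
  move=> p q r h4 h5 h7.
  have : (p - q + L * r) ^+ 2 <= 3 * (p ^+ 2 + q ^+ 2 + L ^+ 2 * r ^+ 2).
    have := sqr_ge0 (p + q); have := sqr_ge0 (p - L * r).
    have := sqr_ge0 (q + L * r); lra.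
  lra.
(* Now y_N is small in mass, and |u|^2 <= 2|z_N|^2 + 2|y_N|^2 costs the factor that turns 2k into
   the claimed k. *)
have myy := kernel eyy pyy.
have k00 := k0.
rewrite -subr_le0; apply: (@le0_small _ _ (2 * k)) => // d d0.
have [N /(_ N (leqnn _))[h1 _ _]] := mlim _ d0.
have yN : mass (y N) (y N) <= d.
  by move: h1; rewrite sqformB myy (formC mass (y N)) (form_null _ myy) mulr0 subr0 addr0.
have : mass u u <= 2 * mass (z N) (z N) + 2 * mass (y N) (y N).
  by rewrite -[u in X in X <= _](subrK (y N)) sqformD_le.
move=> /(ler_wpM2l (ltW k00)); have := ler_wpM2l (ltW k00) yN; have := bzu N.
by rewrite -/(z N); lra.
Qed.

End AtBottom.
End Bottom.

(** * Purely discrete spectrum against an infinite orthogonal family *)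

Section Essential.
Variables (R : realType) (X V : lmodType R).
Variables (ip : psd_form X) (T : psd_form V) (i : {linear V -> X}).

Local Notation mass := (form_pullback ip i).
Local Notation resolvent := (resolvent ip T i).
Local Notation eigenvec := (eigenvec ip T i).
Local Notation discrete := (discrete ip T i).
Local Notation perp := (perp ip i).
Local Notation eigenlist := (eigenlist ip T i).

Hypothesis complete : form_complete (form_add T mass).

(** At a discrete point this is isolation. At a resolvent point with constant C, an eigenvalue mu
    would satisfy 1 <= C (mu - L)^2, which is false within distance 1/(C + 1); and under the
    hypothesis every spectral point is an eigenvalue. *)
Lemma punctured_resolvent L : (forall l, resolvent l \/ discrete l) ->
  exists2 eta, 0 < eta &
    forall mu, mu != L -> `|mu - L| < eta -> resolvent mu.
Proof.
move=> all; have [res|[[e e0 eP] _ _]] := all L; last first.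
  exists e => // mu muL mue; have [//|[_ [f ef f0] _]] := all mu.
  apply: contrapT => nres; move/eqP: muL; apply; exact: eP.
have [C C0 CP] := resolvent_bound res.
exists (C + 1)^-1; first by rewrite invr_gt0 ltr_wpDl.
move=> mu muL mue; have [//|[_ [f ef f0] _]] := all mu.
exfalso; move/negP: f0; apply.
have := CP f ((mu - L) *: i f); rewrite sqformZ -[ip _ _]/(mass f f).
rewrite -scalerDl subrK => /(_ ef) h.
rewrite eq_le form_ge0 andbT leNgt; apply/negP => mp.
move: h; rewrite mulrA -[X in X <= _]mul1r ler_pM2r// leNgt => /negP; apply.
have : C + 1 != 0 by rewrite gt_eqF// ltr_wpDl.
have cp : 0 < C + 1 by rewrite ltr_wpDl.
have : (mu - L) ^+ 2 < (C + 1)^-1 ^+ 2.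
  by rewrite -(real_normK (num_real _)) ltr_pXn2r ?nnegrE// invr_ge0 ltW.
rewrite -(ltr_pM2l cp) expr2 mulVKf; last by rewrite gt_eqF.
have : (C + 1)^-1 <= 1 by rewrite invf_le1// lerDr.
have := sqr_ge0 (mu - L); lra.
Qed.

(* A finite-codimensional eigenvector complement on which the form exceeds any
   candidate for the bottom of the essential spectrum contradicts the infinite
   orthogonal family. *)
Lemma exists_not_discrete (M : R) (c : nat -> V) :
  (forall k, 0 < mass (c k) (c k)) ->
  (forall k, T (c k) (c k) <= M * mass (c k) (c k)) ->
  (forall k l, k != l -> mass (c k) (c l) = 0) ->
  (forall k l, k != l -> T (c k) (c l) = 0) ->
  ~ forall l, resolvent l \/ discrete l.
Proof.
move=> c0 cM co cT all.
pose bounded s x := forall u, perp s u -> x * mass u u <= T u u.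
(* Min-max: a combination of size s + 1 members of the family is orthogonal to [s] and has Rayleigh
   quotient at most M. *)
have bounded_le s x : bounded s x -> x <= M.
  move=> sx.
  have [a [k ak] aP] := exists_orthogonal_comb ip i
     (fun j : 'I_(size s) => i (nth 0 s j))
     (fun k : 'I_(size s).+1 => c k) (ltnSn _).
  set u := \sum_k a k *: c k in aP.
  have /sx : perp s u.
    by move=> b /(nthP 0)[j js <-]; exact: (aP (Ordinal js)).
  have mu : mass u u = \sum_k a k ^+ 2 * mass (c k) (c k).
    rewrite {1}/u form_suml; apply: eq_bigr => j _.
    by rewrite formZl (orth_mass (f := fun k : 'I_(size s).+1 => c k))
      ?mulrA ?expr2// => j1 j2 j12; exact: co.
  have Tu : T u u = \sum_k a k ^+ 2 * T (c k) (c k).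
    rewrite {1}/u form_suml; apply: eq_bigr => j _.
    rewrite formZl /u form_sumr (bigD1 j)//= big1 ?addr0 => [|j' j'j].
      by rewrite formZr mulrA expr2.
    by rewrite formZr cT ?mulr0// eq_sym.
  have Tle : T u u <= M * mass u u.
    rewrite mu Tu mulr_sumr ler_sum// => j _.
    by rewrite mulrCA ler_wpM2l ?sqr_ge0.
  have mup : 0 < mass u u.
    rewrite mu (bigD1 k)//=; apply: ltr_wpDr.
      by apply: sumr_ge0 => j _; apply: mulr_ge0; rewrite ?sqr_ge0 ?form_ge0.
    by apply: mulr_gt0; [rewrite lt0r sqr_ge0 sqrf_eq0 ak|exact: c0].
  by move=> /le_trans/(_ Tle); rewrite ler_pM2r.
pose Q := [set x | exists2 s, eigenlist s & bounded s x].
have Q0 : Q 0 by exists [::] => // u _; rewrite mul0r form_ge0.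
have hQ : has_sup Q.
  by split; [exists 0|exists M => x [s _ /bounded_le]].
pose L := sup Q.
have QL x : Q x -> x <= L by exact: (sup_upper_bound hQ).
have [eta eta0 etaP] := punctured_resolvent L all.
have [x [s es sx] xL] := sup_adherent eta0 hQ.
rewrite -/L in xL.
(* For the single list [s] the best lower bound m is attained, and it is within eta of the supremum
   L taken over all lists. *)
have hS : has_sup [set y | bounded s y].
  by split; [exists x|exists M => y; exact: bounded_le].
pose m := sup [set y | bounded s y].
have xm : x <= m by exact: (sup_upper_bound hS).
have sm : bounded s m.
  move=> u pu; rewrite -subr_le0; apply: (@le0_small _ _ (mass u u + 1)).
    by rewrite ltr_wpDl// form_ge0.
  move=> e e0; have [y yS ym] := sup_adherent e0 hS; rewrite -/m in ym.
  have := yS u pu; have := form_ge0 mass u => m0.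
  have : (m - e) * mass u u <= y * mass u u by rewrite ler_wpM2r// ltW.
  lra.
have bottom : bounded s L.
  have := QL m (ex_intro2 _ _ s es sm); rewrite le_eqVlt => /orP[/eqP <-//|mL].
  (* If m < L, then m and its eta'-neighbourhood stay inside (L - eta, L), which contains no
     spectrum; the bound m could then be improved on the same list. *)
  pose eta' := Num.min (m - (L - eta)) (L - m).
  have mp : 0 < m - (L - eta) by move: xL xm; lra.
  have [|||d d0 dP] := spectral_bottom_gap complete (eta := eta') es sm.
  - by rewrite lt_min mp subr_gt0.
  - move=> mu mum; rewrite lt_min => /andP[].
    rewrite !ltr_norml => /andP[h1 _] /andP[_ h2].
    have muL : mu < L by move: h2; lra.
    apply: etaP; first by rewrite lt_eqF.
    by rewrite ltr0_norm ?subr_lt0//; move: h1; lra.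
  - move=> f ef _; apply: resolvent_eigenvec ef; apply: etaP.
      by rewrite lt_eqF.
    by rewrite ltr0_norm ?subr_lt0//; move: mp; lra.
  have : m + d <= m by apply: (sup_upper_bound hS); exact: dP.
  by rewrite gerDl leNgt d0.
(* Adding a finite spanning set of the L-eigenspace removes the kernel on the complement, so the
   bound can be raised beyond L, against its choice as a supremum. *)
have [s' es' ker] : exists2 s', eigenlist s' &
    forall f, eigenvec L f -> perp s' f -> mass f f = 0.
  have [res|[_ _ [n [b [eb bP]]]]] := all L.
    by exists [::] => // f ef _; exact: resolvent_eigenvec ef.
  exists [seq b k | k <- enum 'I_n].
    by move=> _ /mapP[k _ ->]; exists L.
  move=> f ef pf; have [a aP] := bP f ef.
  have := sqformB mass f (\sum_k a k *: b k); rewrite aP.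
  rewrite [mass f (\sum__ _)]form_sumr big1 => [|k _]; last first.
    have -> : mass f (a k *: b k) = a k * mass f (b k) by rewrite formZr.
    by rewrite pf ?mulr0//; apply: map_f; rewrite mem_enum.
  have := form_ge0 mass f; have := form_ge0 mass (\sum_k a k *: b k).
  by move=> h1 h2 h3; apply/eqP; rewrite eq_le h2 andbT; move: h3; lra.
have perp_cat u : perp (s ++ s') u -> perp s u /\ perp s' u.
  by move=> p; split => b bs; apply: p; rewrite mem_cat bs ?orbT.
have ecat : eigenlist (s ++ s').
  by move=> b; rewrite mem_cat => /orP[/es|/es'].
have [||d d0 dP] := spectral_bottom_gap (L := L) complete ecat _ eta0 etaP.
- by move=> u /perp_cat[pu _]; exact: bottom.
- by move=> f ef /perp_cat[_ pf]; exact: ker.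
have := QL (L + d) (ex_intro2 _ _ _ ecat dP).
by rewrite gerDl leNgt d0.
Qed.

End Essential.

(** * Closure of a form given on a core *)

Section FormLimits.
Lemma cvg_ext (R : realType) (f g : nat -> R) (l : R) :
  (forall n, f n = g n) -> g @ \oo --> l -> f @ \oo --> l.
Proof. by move=> /funext ->. Qed.

Lemma cvg_seqD (R : realType) (f g : nat -> R) (a b : R) :
  f @ \oo --> a -> g @ \oo --> b -> (fun n => f n + g n) @ \oo --> a + b.
Proof. exact: cvgD. Qed.

Lemma cvg_seqZ (R : realType) (k : R) (f : nat -> R) (a : R) :
  f @ \oo --> a -> (fun n => k * f n) @ \oo --> k * a.
Proof. by move=> fa; apply: cvgM fa; exact: cvg_cst. Qed.

Variables (R : realType) (X : lmodType R) (B : psd_form X).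
Implicit Types (x y z : nat -> X).

Lemma form_lim_cauchy x v : form_lim B x v -> form_cauchy B x.
Proof.
move=> xv e e0; have [N NP] := xv (e / 4) ltac:(by rewrite divr_gt0).
exists N => m n /NP h1 /NP h2.
rewrite (_ : x m - x n = (x m - v) - (x n - v)); last by rewrite opprB addrA subrK.
by apply: le_trans (sqformB_le _ _ _) _; lra.
Qed.

Lemma form_cauchy_bounded x : form_cauchy B x ->
  exists N, exists2 K, 0 < K & forall n, (N <= n)%N -> B (x n) (x n) <= K.
Proof.
move=> xC; have [N NP] := xC 1 ltr01.
exists N, (2 + 2 * B (x N) (x N)).
  by have := form_ge0 B (x N); lra.
move=> n Nn; have := NP n N Nn (leqnn _).
have := sqformD_le B (x n - x N) (x N); rewrite subrK; lra.
Qed.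

Lemma form_prod_null z y : form_lim B z 0 -> form_cauchy B y ->
  (fun n => B (z n) (y n)) @ \oo --> (0 : R).
Proof.
move=> z0 /form_cauchy_bounded[N [K K0 NP]]; apply/cvgrPdist_le => e e0.
have [M MP] := z0 (e ^+ 2 / K) ltac:(by rewrite divr_gt0// exprn_gt0).
exists (maxn N M) => // n; rewrite /= geq_max => /andP[/NP h1 /MP].
rewrite subr0 => h2; rewrite sub0r normrN; apply: sq_le_abs_ge0; first exact: ltW.
apply: le_trans (cauchy_schwarz _ _ _) _.
have -> : e ^+ 2 = e ^+ 2 / K * K by rewrite divfK// gt_eqF.
by apply: ler_pM => //; rewrite form_ge0.
Qed.

Lemma form_prod_cvg x y : form_cauchy B x -> form_cauchy B y ->
  cvgn (fun n => B (x n) (y n)).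
Proof.
move=> xC yC; have [N1 [K K0 N1P]] := form_cauchy_bounded xC.
have [N2 [K' K'0 N2P]] := form_cauchy_bounded yC.
apply: cauchy_cvg; apply: cauchy_exP => e e0.
pose d := (e / 2) ^+ 2 / (2 * (K + K')).
have KK : 0 < 2 * (K + K') by rewrite mulr_gt0// addr_gt0.
have d0 : 0 < d by rewrite divr_gt0// exprn_gt0// divr_gt0.
have [N3 N3P] := xC _ d0; have [N4 N4P] := yC _ d0.
pose N := maxn (maxn N1 N2) (maxn N3 N4).
have [L1 L2] : (N1 <= N)%N /\ (N2 <= N)%N.
  by split; rewrite /N !leq_max leqnn ?orbT.
have [L3 L4] : (N3 <= N)%N /\ (N4 <= N)%N.
  by split; rewrite /N !leq_max leqnn ?orbT.
exists (B (x N) (y N)); exists N => // n /= Nn.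
rewrite /ball/=.
apply: (@le_lt_trans _ _ (e / 2)); last by rewrite ltr_pdivrMr// ltr_pMr// ltr1n.
apply: sq_le_abs_ge0; first by rewrite divr_ge0// ltW.
have := cauchy_schwarz B (x N - x n) (y n).
have := cauchy_schwarz B (y N - y n) (x N).
have := N1P N L1; have := N2P n (leq_trans L2 Nn).
have := N3P N n L3 (leq_trans L3 Nn); have := N4P N n L4 (leq_trans L4 Nn).
set a := B _ _; set b := B (x N - x n) _; set a' := B (y n) _; set b' := B (x N) _.
move=> h1 h2 h3 h4.
have h5 : a * b' <= d * K by apply: ler_pM => //; exact: form_ge0.
have h6 : b * a' <= d * K' by apply: ler_pM => //; exact: form_ge0.
rewrite formBl (formC B (y N)) (formC B (y n)) formBl.
have -> : (e / 2) ^+ 2 = 2 * (d * K) + 2 * (d * K').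
  by rewrite -mulrDr -mulrDr mulrCA divfK ?gt_eqF//.
move: h5 h6; move: (B (x N) (y N)) (B (x N) (y n)) (B (x n) (y n)).
move=> p q r h5 h6 h7 h8.
have := sqr_ge0 ((p - q) - (q - r)); lra.
Qed.

End FormLimits.

Section Closure.
Variables (R : realType) (X C : lmodType R) (ip : psd_form X).
Variables (j d : {linear C -> X}).

(** [j] reads off the function and [d] its derivative; the form to be closed is [ip (d c) (d c)]. *)
Definition core_cvg (cs : nat -> C) (x : X) :=
  form_lim ip (fun n => j (cs n)) x /\ form_cauchy ip (fun n => d (cs n)).

Definition form_domain : {pred X} := fun x => `[< exists cs, core_cvg cs x >].

Lemma core_cvg_lin a cs cs' x x' : core_cvg cs x -> core_cvg cs' x' ->
  core_cvg (fun n => a *: cs n + cs' n) (a *: x + x').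
Proof.
have lin_le (u v : X) e : 0 < e -> ip u u <= e / (4 * (a ^+ 2 + 1)) ->
    ip v v <= e / 4 -> ip (a *: u + v) (a *: u + v) <= e.
  move=> e0 h1 h2; apply: le_trans (sqformD_le _ _ _) _; rewrite sqformZ.
  have a2 := sqr_ge0 a.
  have a4 : 0 < 4 * (a ^+ 2 + 1) by lra.
  have : a ^+ 2 * ip u u <= e / 4.
    apply: (@le_trans _ _ ((a ^+ 2 + 1) * ip u u)).
      by have := form_ge0 ip u; lra.
    rewrite -ler_pdivlMl; last by lra.
    by apply: le_trans h1 _; rewrite le_eqVlt; apply/orP; left; apply/eqP; field; lra.
  lra.
have e4 (e : R) : 0 < e -> 0 < e / (4 * (a ^+ 2 + 1)) /\ 0 < e / 4.
  by move=> e0; split; rewrite divr_gt0// mulr_gt0// ltr_wpDl// sqr_ge0.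
move=> [jx dx] [jx' dx']; split.
  move=> e e0; have [e1 e2] := e4 _ e0.
  have [N NP] := jx _ e1; have [M MP] := jx' _ e2.
  exists (maxn N M) => n; rewrite geq_max => /andP[/NP h1 /MP h2].
  have -> : j (a *: cs n + cs' n) - (a *: x + x') =
    a *: (j (cs n) - x) + (j (cs' n) - x').
    by rewrite linearP opprD addrACA scalerBr.
  exact: lin_le.
move=> e e0; have [e1 e2] := e4 _ e0.
have [N NP] := dx _ e1; have [M MP] := dx' _ e2.
exists (maxn N M) => m n; rewrite !geq_max => /andP[Nm Mm] /andP[Nn Mn].
have -> : d (a *: cs m + cs' m) - d (a *: cs n + cs' n) =
  a *: (d (cs m) - d (cs n)) + (d (cs' m) - d (cs' n)).
  by rewrite !(linearP d) opprD addrACA scalerBr.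
by apply: lin_le => //; [exact: NP|exact: MP].
Qed.

Lemma core_cvg_cst c : core_cvg (fun=> c) (j c).
Proof.
by split=> e e0; exists 0 => *; rewrite subrr form0l ltW.
Qed.

Lemma form_domain_submod : submod_closed form_domain.
Proof.
split; first by apply/asboolP; exists (fun=> 0); rewrite -(linear0 j);
  exact: core_cvg_cst.
move=> a x y /asboolP[cs csx] /asboolP[cs' csy]; apply/asboolP.
by exists (fun n => a *: cs n + cs' n); exact: core_cvg_lin.
Qed.

HB.instance Definition _ := GRing.isSubmodClosed.Build R X form_domain
  form_domain_submod.

Definition form_space := {x : X | x \in form_domain}.

HB.instance Definition _ := SubChoice.on form_space.
HB.instance Definition _ := [SubChoice_isSubLmodule of form_space by <:].

Lemma form_space_incl_linear : linear (val : form_space -> X).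
Proof. by move=> a x y; rewrite linearP. Qed.

Definition form_incl (v : form_space) : X := val v.

HB.instance Definition _ := GRing.isLinear.Build R form_space X _ form_incl
  form_space_incl_linear.

Lemma form_spaceP (v : form_space) : exists cs, core_cvg cs (form_incl v).
Proof. by have /asboolP := valP v. Qed.

Definition approx (v : form_space) : nat -> C := sval (cid (form_spaceP v)).

Lemma approxP v : core_cvg (approx v) (form_incl v).
Proof. exact: (svalP (cid (form_spaceP v))). Qed.

Hypothesis closable : forall cs, form_lim ip (fun n => j (cs n)) 0 ->
  form_cauchy ip (fun n => d (cs n)) -> form_lim ip (fun n => d (cs n)) 0.
(** Completeness is demanded only of sequences that are Cauchy for the form norm. On the tree such
    sequences converge uniformly on every edge, so their L^2 limit can be constructed pointwise. *)
Hypothesis core_complete : forall cs, form_cauchy ip (fun n => j (cs n)) ->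
  form_cauchy ip (fun n => d (cs n)) -> exists x, form_lim ip (fun n => j (cs n)) x.

Definition closed (v w : form_space) : R :=
  limn (fun n => ip (d (approx v n)) (d (approx w n))).

Lemma core_cvg_unique cs cs' x : core_cvg cs x -> core_cvg cs' x ->
  form_lim ip (fun n => d (cs n) - d (cs' n)) 0.
Proof.
move=> h h'; have := core_cvg_lin (-1) h' h.
rewrite scaleN1r addNr => -[/closable h1 /h1 h2] e e0.
have [N NP] := h2 e e0; exists N => n /NP.
by rewrite linearP scaleN1r (addrC (- _)).
Qed.

(** Independence of the approximating sequences: by closability the derivatives of two sequences
    with the same limit differ by a null sequence, and products with bounded sequences then tend to
    0. *)
Lemma closed_cvg v w cs cs' : core_cvg cs (form_incl v) ->
  core_cvg cs' (form_incl w) ->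
  (fun n => ip (d (cs n)) (d (cs' n))) @ \oo --> closed v w.
Proof.
move=> hv hw; have hv' := approxP v; have hw' := approxP w.
have c1 := form_prod_cvg hv'.2 hw'.2.
have c2 := form_prod_null (core_cvg_unique hv hv') hw.2.
have c3 := form_prod_null (core_cvg_unique hw hw') hv'.2.
have c := cvg_seqD (cvg_seqD c1 c2) c3; rewrite !addr0 in c.
apply: (cvg_ext _ c) => n.
rewrite /= !formBl (formC ip (d (cs' n))) (formC ip (d (approx w n))).
ring.
Qed.

Lemma closed_sym v w : closed v w = closed w v.
Proof.
rewrite /closed; congr (limn _); apply/funext => n; exact: formC.
Qed.

Lemma closed_linear a u v w :
  closed (a *: u + v) w = a * closed u w + closed v w.
Proof.
have h : core_cvg (fun n => a *: approx u n + approx v n)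
    (form_incl (a *: u + v)).
  by rewrite linearP; apply: core_cvg_lin; exact: approxP.
have h0 := closed_cvg h (approxP w).
have h1 := closed_cvg (approxP u) (approxP w).
have h2 := closed_cvg (approxP v) (approxP w).
have h3 := cvg_seqD (cvg_seqZ (k := a) h1) h2.
apply: (cvg_unique (@Rhausdorff R) h0).
by apply: (cvg_ext _ h3) => n; rewrite /= linearP form_linear.
Qed.

Lemma closed_ge0 v : 0 <= closed v v.
Proof.
have h := closed_cvg (approxP v) (approxP v).
have := cvgP _ h => ch; rewrite -(cvg_lim (@Rhausdorff R) h).
by apply: limr_ge => //; near=> n; exact: form_ge0.
Unshelve. all: by end_near.
Qed.

Definition closed_form_space : psd_form form_space :=
  PsdForm closed_sym closed_linear closed_ge0.

Local Notation T := closed_form_space.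
Local Notation mass := (form_pullback ip form_incl).
Local Notation energy := (form_add T mass).

Lemma core_in_domain c : j c \in form_domain.
Proof. by apply/asboolP; exists (fun=> c); exact: core_cvg_cst. Qed.

Definition core_embed (c : C) : form_space := exist _ (j c) (core_in_domain c).

Lemma closed_core c c' : T (core_embed c) (core_embed c') = ip (d c) (d c').
Proof.
have h := closed_cvg (core_cvg_cst c : core_cvg _ (form_incl (core_embed c)))
  (core_cvg_cst c' : core_cvg _ (form_incl (core_embed c'))).
by have := cvg_lim (@Rhausdorff R) h; rewrite lim_cst// => ->.
Qed.

Lemma core_cvg_energy cs v : core_cvg cs (form_incl v) ->
  form_lim energy (fun n => core_embed (cs n)) v.
Proof.
move=> h e e0; have e2 : 0 < e / 2 by rewrite divr_gt0.
have [N NP] := h.1 _ e2; have [M MP] := h.2 _ e2.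
exists (maxn N M) => n; rewrite geq_max => /andP[/NP h1 Mn].
have h2 : T (core_embed (cs n) - v) (core_embed (cs n) - v) <= e / 2.
  have h' : core_cvg (fun m => -1 *: cs m + cs n)
      (form_incl (core_embed (cs n) - v)).
    have := core_cvg_lin (-1) h (core_cvg_cst (cs n)).
    by rewrite scaleN1r addrC linearB.
  have h3 := closed_cvg h' h'.
  rewrite -[leLHS](cvg_lim (@Rhausdorff R) h3).
  apply: limr_le; first exact: cvgP h3.
  near=> m; rewrite linearP scaleN1r (addrC (- _)).
  by apply: MP => //; near: m; exists M.
have := lerD h2 h1; rewrite -splitr; apply: le_trans.
by rewrite /= lerD2l.
Unshelve. all: by end_near.
Qed.

Lemma core_dense v e : 0 < e -> exists c,
  energy (core_embed c - v) (core_embed c - v) <= e.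
Proof.
move=> e0; have [N NP] := core_cvg_energy (approxP v) e0.
by exists (approx v N); exact: NP.
Qed.

(** Replace each vector by a core element within 1/(n+1) in energy; the limit of the core sequence
    exists by [core_complete] and serves the original sequence. *)
Lemma closed_complete : form_complete energy.
Proof.
move=> vs vC.
have /choice[c cP] n : exists c,
  energy (core_embed c - vs n) (core_embed c - vs n) <= n.+1%:R^-1.
  by apply: core_dense; rewrite invr_gt0.
have cC : form_cauchy energy (fun n => core_embed (c n)).
  move=> e e0; have e8 : 0 < e / 12 by rewrite divr_gt0.
  have [N NP] := small_invn e8; have [M MP] := vC _ e8.
  exists (maxn N M) => m n; rewrite !geq_max => /andP[/NP Nm Mm] /andP[/NP Nn Mn].
  have h1 := le_trans (cP m) Nm; have h2 := le_trans (cP n) Nn.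
  have h3 := MP _ _ Mm Mn.
  have -> : core_embed (c m) - core_embed (c n) =
    ((core_embed (c m) - vs m) - (core_embed (c n) - vs n)) + (vs m - vs n).
    by rewrite opprB addrAC !subrKA.
  apply: le_trans (sqformD_le _ _ _) _.
  have := sqformB_le energy (core_embed (c m) - vs m) (core_embed (c n) - vs n).
  lra.
have CE m n : energy (core_embed (c m) - core_embed (c n))
    (core_embed (c m) - core_embed (c n)) =
    ip (d (c m) - d (c n)) (d (c m) - d (c n)) +
    ip (j (c m) - j (c n)) (j (c m) - j (c n)).
  have -> : core_embed (c m) - core_embed (c n) = core_embed (c m - c n).
    by apply: val_inj; rewrite /= linearB.
  have := closed_core (c m - c n) (c m - c n); rewrite (linearB d) => <-.
  by rewrite -linearB.
have jC : form_cauchy ip (fun n => j (c n)).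
  move=> e e0; have [N NP] := cC _ e0; exists N => m n Nm Nn.
  have := NP _ _ Nm Nn; rewrite CE; apply: le_trans.
  by rewrite lerDr form_ge0.
have dC : form_cauchy ip (fun n => d (c n)).
  move=> e e0; have [N NP] := cC _ e0; exists N => m n Nm Nn.
  have := NP _ _ Nm Nn; rewrite CE; apply: le_trans.
  by rewrite lerDl form_ge0.
have [x jx] := core_complete jC dC.
have xD : x \in form_domain by apply/asboolP; exists c.
exists (exist _ x xD) => e e0; have e4 : 0 < e / 4 by rewrite divr_gt0.
have [N NP] := small_invn e4.
have hx : core_cvg c (form_incl (exist _ x xD)) by [].
have [M MP] := core_cvg_energy hx e4.
exists (maxn N M) => n; rewrite geq_max => /andP[/NP Nn /MP h1].
have h2 := le_trans (cP n) Nn.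
rewrite -(subrK (core_embed (c n)) (vs n)) -addrA.
apply: le_trans (sqformD_le _ _ _) _.
rewrite (sqformBC energy (vs n)); lra.
Qed.

(** All terms are continuous along [core_cvg]; for the functionals this is so because they are inner
    products in [X] and do not involve the derivative. *)
Lemma closed_bound (n : nat) (phi : 'I_n -> X) (K c : R) :
  (forall u : C, c * ip (j u) (j u) <=
     ip (d u) (d u) + K * \sum_k (ip (j u) (phi k)) ^+ 2) ->
  forall v, c * mass v v <=
     T v v + K * \sum_k (ip (form_incl v) (phi k)) ^+ 2.
Proof.
move=> H v; have h := approxP v.
pose cs := approx v.
have jC : form_cauchy ip (fun n => j (cs n)) := form_lim_cauchy h.1.
have jv : form_lim ip (fun n => j (cs n) - form_incl v) 0.
  by move=> e /h.1[N NP]; exists N => m /NP; rewrite subr0.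
have vC y : form_cauchy ip (fun=> y).
  by move=> e e0; exists 0 => *; rewrite subrr form0l ltW.
have c1 y : (fun n => ip (j (cs n)) y) @ \oo --> ip (form_incl v) y.
  have k : (fun _ : nat => ip (form_incl v) y) @ \oo --> ip (form_incl v) y.
    exact: cvg_cst.
  have h' := cvg_seqD (form_prod_null jv (vC y)) k; rewrite add0r in h'.
  by apply: (cvg_ext _ h') => m; rewrite /= formBl subrK.
have c2 : (fun n => ip (j (cs n)) (j (cs n))) @ \oo --> mass v v.
  have h' := cvg_seqD (form_prod_null jv jC) (c1 (form_incl v)).
  rewrite add0r in h'; apply: (cvg_ext _ h') => m.
  by rewrite /= formBl (formC ip (form_incl v)) subrK.
have c3 (r : seq 'I_n) : (fun m => \sum_(k <- r) ip (j (cs m)) (phi k) ^+ 2)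
    @ \oo --> \sum_(k <- r) (ip (form_incl v) (phi k)) ^+ 2.
  elim: r => [|k r IH].
    rewrite big_nil (_ : (fun _ => _) = fun=> 0); first exact: cvg_cst.
    by apply/funext => m; rewrite big_nil.
  have e2 : (fun m => ip (j (cs m)) (phi k) * ip (j (cs m)) (phi k))
     @ \oo --> ip (form_incl v) (phi k) * ip (form_incl v) (phi k).
    by apply: cvgM; exact: c1.
  rewrite big_cons.
  by apply: (cvg_ext _ (cvg_seqD e2 IH)) => m; rewrite big_cons.
have c4 := closed_cvg h h.
have c5 := cvg_seqD c4 (cvg_seqZ (k := K) (c3 (index_enum 'I_n))).
have c6 := cvg_seqZ (k := c) c2.
rewrite -[leLHS](cvg_lim (@Rhausdorff R) c6) -[leRHS](cvg_lim (@Rhausdorff R) c5).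
apply: ler_lim; [exact: cvgP c6|exact: cvgP c5|].
by apply: nearW => m; exact: H.
Qed.

End Closure.

(** * Functions on an interval *)

Section Interval.
Variable R : realType.
Notation mu := (@lebesgue_measure R).
Local Notation TR := (measurableTypeR R).
Implicit Types (u v w p : R -> R) (a b l x y : R).

Definition sqint (D : set TR) u :=
  measurable_fun D (u : TR -> R) /\ mu.-integrable D (EFin \o (fun x => u x ^+ 2)).

Lemma Rintegrable_lin (D : set TR) c u v : measurable D ->
  mu.-integrable D (EFin \o u) -> mu.-integrable D (EFin \o v) ->
  mu.-integrable D (EFin \o (fun x => c * u x + v x)).
Proof.
move=> mD iu iv; have := integrableD mD (integrableZl mD c iu) iv.
by apply: eq_integrable.
Qed.

Lemma Rintegral_lin (D : set TR) c u v : measurable D ->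
  mu.-integrable D (EFin \o u) -> mu.-integrable D (EFin \o v) ->
  \int[mu]_(x in D) (c * u x + v x) =
  c * \int[mu]_(x in D) u x + \int[mu]_(x in D) v x.
Proof.
move=> mD iu iv; rewrite RintegralD//; first by rewrite RintegralZl.
by have := integrableZl mD c iu; apply: eq_integrable.
Qed.

Lemma sqintM (D : set TR) u v : measurable D -> sqint D u -> sqint D v ->
  mu.-integrable D (EFin \o (fun x => u x * v x)).
Proof.
move=> mD [mu_ iu] [mv iv].
apply: (@le_integrable _ _ _ mu D mD _
    (EFin \o (fun x => 1 * u x ^+ 2 + v x ^+ 2))); last first.
- exact: Rintegrable_lin.
- move=> x _ /=; rewrite mul1r lee_fin normrM [leRHS]ger0_norm ?addr_ge0 ?sqr_ge0//.
  rewrite -(real_normK (num_real (u x))) -(real_normK (num_real (v x))).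
  have := sqr_ge0 (`|u x| - `|v x|); have := sqr_ge0 (`|u x|).
  by have := sqr_ge0 (`|v x|); lra.
- by apply/measurable_EFinP; exact: measurable_funM.
Qed.

Lemma sqint_subset (D E : set TR) u : measurable D -> measurable E ->
  E `<=` D -> sqint D u -> sqint E u.
Proof.
move=> mD mE ED [mu_ iu]; split; first exact: measurable_funS mu_.
exact: integrableS iu.
Qed.

Lemma within_sqint a b u : {within `[a, b], continuous u} -> sqint `[a, b] u.
Proof.
move=> cu; split; first exact: subspace_continuous_measurable_fun.
apply: continuous_compact_integrable; first exact: segment_compact.
by move=> /= z; apply: continuousM; exact: cu.
Qed.

Lemma sqint_cst a b c : sqint `[a, b] (cst c).
Proof.
by apply: within_sqint; apply: continuous_subspaceT => x; exact: cvg_cst.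
Qed.

Lemma sqint_integrable a b u : sqint `[a, b] u ->
  mu.-integrable `[a, b] (EFin \o u).
Proof.
move=> su; have := sqintM (measurable_itv _) su (sqint_cst a b 1).
by apply: eq_integrable => // x _ /=; rewrite mulr1.
Qed.

Lemma sqint_lin a b c u v : sqint `[a, b] u -> sqint `[a, b] v ->
  sqint `[a, b] (fun x => c * u x + v x).
Proof.
move=> su sv; split.
  apply: measurable_funD sv.1.
  by apply: measurable_funM su.1; exact: measurable_cst.
have mI : measurable (`[a, b]%classic : set TR) by exact: measurable_itv.
have i1 := su.2; have i2 := sv.2; have i3 := sqintM mI su sv.
have := Rintegrable_lin (c ^+ 2) mI i1 (Rintegrable_lin (2 * c) mI i3 i2).
by apply: eq_integrable => // x _ /=; congr (_%:E); ring.
Qed.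

Lemma Rintegral_itv_cst a b c : a <= b -> \int[mu]_(x in `[a, b]) c = c * (b - a).
Proof.
move=> ab; transitivity (c * fine (mu `[a, b]%classic)).
  by apply: Rintegral_cst; exact: measurable_itv.
rewrite lebesgue_measure_itv/= lte_fin; case: ltP => // ba.
by rewrite (le_anti (introT andP (conj ab ba))) subrr.
Qed.

Lemma sqint_cauchy_schwarz a b u v : sqint `[a, b] u -> sqint `[a, b] v ->
  (\int[mu]_(x in `[a, b]) (u x * v x)) ^+ 2 <=
  (\int[mu]_(x in `[a, b]) (u x ^+ 2)) * (\int[mu]_(x in `[a, b]) (v x ^+ 2)).
Proof.
move=> su sv; have mI : measurable (`[a, b]%classic : set TR) by exact: measurable_itv.
apply: discriminant_le; first by apply: Rintegral_ge0 => x _; exact: sqr_ge0.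
move=> t; have iuv := sqintM mI su sv.
have := @Rintegral_ge0 _ _ _ mu `[a, b] (fun x => (2 * t) * (u x * v x) +
  (t ^+ 2 * v x ^+ 2 + u x ^+ 2)).
rewrite Rintegral_lin//; last by apply: Rintegrable_lin => //; [exact: sv.2|exact: su.2].
rewrite Rintegral_lin//; [|exact: sv.2|exact: su.2].
move=> H; have {H} : 0 <= 2 * t * \int[mu]_(x in `[a, b]) (u x * v x) +
    (t ^+ 2 * \int[mu]_(x in `[a, b]) (v x ^+ 2) +
     \int[mu]_(x in `[a, b]) (u x ^+ 2)).
  apply: H => x _.
  rewrite (_ : _ + _ = (u x + t * v x) ^+ 2); first exact: sqr_ge0.
  by ring.
by lra.
Qed.

(** Absolute continuity of p with derivative w, in the integral form used by [H2]; it says nothing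
    about p outside [0, l]. *)
Definition primitive l p w := forall x, 0 <= x <= l ->
  p x = p 0 + \int[mu]_(t in `[0, x]) w t.

Lemma itv_sub a b l : 0 <= a -> b <= l -> `[a, b] `<=` (`[0, l] : set R).
Proof.
move=> a0 bl x /=; rewrite !in_itv/= => /andP[ax xb].
by rewrite (le_trans a0 ax) (le_trans xb bl).
Qed.

Lemma primitiveB l p w x y : mu.-integrable `[0, l] (EFin \o w) ->
  primitive l p w -> 0 <= x -> x <= y -> y <= l ->
  p y - p x = \int[mu]_(t in `[x, y]) w t.
Proof.
move=> iw pw x0 xy yl.
have iwy : mu.-integrable `[0, y] (EFin \o w).
  by apply: integrableS iw => //; exact: itv_sub.
rewrite (pw y) ?(le_trans x0 xy)// (pw x) ?x0 ?(le_trans xy yl)//.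
rewrite opprD addrACA subrr add0r -(@Rintegral_itv_obnd_cbnd _ x); last first.
  apply: integrableS iwy => // t /=; rewrite !in_itv/= => /andP[xt ->].
  by rewrite (le_trans x0 (ltW xt)).
by rewrite -(@Rintegral_itvB _ w (BLeft 0) (BRight y) x iwy) ?bnd_simp.
Qed.

Lemma sqint_sub l u x y : 0 <= x -> y <= l -> sqint `[0, l] u -> sqint `[x, y] u.
Proof. by move=> x0 yl; apply: sqint_subset => //; exact: itv_sub. Qed.

Lemma Rintegral_sq_mono a b u x y : a <= x -> y <= b -> sqint `[a, b] u ->
  \int[mu]_(t in `[x, y]) (u t ^+ 2) <= \int[mu]_(t in `[a, b]) (u t ^+ 2).
Proof.
move=> ax yb su.
have sub : `[x, y] `<=` (`[a, b] : set R).
  move=> t /=; rewrite !in_itv/= => /andP[xt ty].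
  by rewrite (le_trans ax xt) (le_trans ty yb).
have mI c d : measurable (`[c, d]%classic : set TR) by exact: measurable_itv.
rewrite /Rintegral fine_le//.
- by apply: integrable_fin_num => //; exact: (sqint_subset (mI _ _) (mI _ _) sub su).2.
- by apply: integrable_fin_num => //; exact: su.2.
apply: ge0_subset_integral => //=.
- by case: su => m _; apply/measurable_EFinP; exact: measurable_funX.
- by move=> t _; rewrite lee_fin sqr_ge0.
Qed.

Lemma primitive_hoelder l p w x y : sqint `[0, l] w -> primitive l p w ->
  0 <= x -> x <= y -> y <= l ->
  (p y - p x) ^+ 2 <= (y - x) * \int[mu]_(t in `[x, y]) (w t ^+ 2).
Proof.
move=> sw pw x0 xy yl.
rewrite (primitiveB (sqint_integrable sw) pw x0 xy yl).
have sw' := sqint_sub x0 yl sw.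
have := sqint_cauchy_schwarz sw' (sqint_cst x y 1).
rewrite (_ : \int[mu]_(t in `[x, y]) (w t * cst 1 t) =
  \int[mu]_(t in `[x, y]) w t); last first.
  by apply: eq_Rintegral => t _; rewrite mulr1.
rewrite (_ : \int[mu]_(t in `[x, y]) (cst 1 t ^+ 2) = y - x) 1?mulrC//.
rewrite -[RHS]mul1r -Rintegral_itv_cst//.
by apply: eq_Rintegral => t _; rewrite /= expr1n.
Qed.

Lemma primitive_hoelder_abs l p w x y : sqint `[0, l] w -> primitive l p w ->
  0 <= x <= l -> 0 <= y <= l ->
  (p y - p x) ^+ 2 <= `|y - x| * \int[mu]_(t in `[0, l]) (w t ^+ 2).
Proof.
move=> sw pw; wlog xy : x y / x <= y.
  move=> H xl yl; have [/H|/ltW /H] := leP x y; first exact.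
  by rewrite -sqrrN opprB distrC; apply.
move=> /andP[x0 xl] /andP[y0 yl]; apply: le_trans (primitive_hoelder sw pw x0 xy yl) _.
rewrite ger0_norm ?subr_ge0// ler_wpM2l ?subr_ge0//.
exact: Rintegral_sq_mono.
Qed.

Lemma primitive_within l p w : sqint `[0, l] w -> primitive l p w ->
  {within `[0, l], continuous p}.
Proof.
move=> sw pw; apply/subspace_continuousP => x /=; rewrite in_itv/= => xl.
set W := \int[mu]_(t in `[0, l]) (w t ^+ 2).
have W0 : 0 <= W by apply: Rintegral_ge0 => t _; exact: sqr_ge0.
apply/cvgrPdist_le => e e0; near=> y.
apply: sq_le_abs_ge0; first exact: ltW.
have yl : 0 <= y <= l.
  have : (`[0, l]%classic : set R) y by near: y; exact: withinT.
  by rewrite /= in_itv.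
have := primitive_hoelder_abs sw pw yl xl.
rewrite -/W; move=> /le_trans; apply.
have : `|x - y| <= e ^+ 2 / (W + 1).
  near: y; apply: cvg_within.
  have d0 : 0 < e ^+ 2 / (W + 1) by rewrite divr_gt0 ?exprn_gt0// ltr_wpDl.
  exists (e ^+ 2 / (W + 1)) => // z /=; exact: ltW.
rewrite ler_pdivlMr ?ltr_wpDl// => h; apply: le_trans h.
by rewrite ler_wpM2l// lerDl.
Unshelve. all: by end_near.
Qed.

Lemma primitive_sqint l p w : sqint `[0, l] w -> primitive l p w -> sqint `[0, l] p.
Proof. by move=> sw pw; apply: within_sqint; exact: primitive_within sw pw. Qed.

(** Integration by parts of w against its own primitive. Derivatives of core functions are
    continuous, which makes the fundamental theorem of calculus available. *)
Lemma primitive_sq l p w y : 0 <= y <= l -> {within `[0, l], continuous w} ->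
  primitive l p w ->
  p y ^+ 2 - p 0 ^+ 2 = 2 * \int[mu]_(t in `[0, y]) (p t * w t).
Proof.
move=> /andP[]; rewrite le_eqVlt => /predU1P[<- _ _ _|y0 yl cw pw].
  by rewrite subrr set_itv1 Rintegral_set1 mulr0.
have cwy : {within `[0, y], continuous w}.
  by apply: continuous_subspaceW cw; exact: itv_sub.
have swy := within_sqint cwy.
have iwy := sqint_integrable swy.
(* p is prescribed on [0, l] only, so the differentiable function is the integral [F], with p = p(0)
   + F there. *)
pose F x := \int[mu]_(t in `[0, x]) w t.
have cF : {within `[0, y], continuous F}.
  exact: (parameterized_integral_continuous (ltW y0) iwy).
have [/= cin c0 cy] := (continuous_within_itvP _ y0).1 cwy.
have [/= Fin F0 Fy] := (continuous_within_itvP _ y0).1 cF.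
have dF x : x \in `]0, y[ -> derivable F x 1 /\ derive1 F x = w x.
  move=> xin; move: (xin); rewrite in_itv/= => /andP[x0 xy].
  exact: (continuous_FTC1_closed xy iwy x0 (cin x xin)).
have LR : derivable_oo_LRcontinuous F 0 y.
  by split => //; move=> x /dF[].
have Ff : {in `]0, y[, derive1 F =1 w} by move=> x /dF[].
have := @Rintegration_by_parts R F F w w 0 y y0 cwy LR Ff cwy LR Ff.
have F00 : F 0 = 0 by rewrite /F set_itv1 Rintegral_set1.
have pF x : 0 <= x <= y -> p x = p 0 + F x.
  by move=> /andP[x0 xy]; apply: pw; rewrite x0 (le_trans xy yl).
have iFw : mu.-integrable `[0, y] (EFin \o (fun x => F x * w x)).
  exact: (sqintM (measurable_itv _) (within_sqint cF) swy).
rewrite F00 mulr0 subr0 (_ : \int[mu]_(x in `[0, y]) (w x * F x) =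
  \int[mu]_(x in `[0, y]) (F x * w x)); last first.
  by apply: eq_Rintegral => x _; rewrite mulrC.
have -> : \int[mu]_(x in `[0, y]) (p x * w x) =
    \int[mu]_(x in `[0, y]) (p 0 * w x + F x * w x).
  apply: eq_Rintegral => x; rewrite inE/= in_itv/= => xy.
  by rewrite (pF x xy) mulrDl.
rewrite Rintegral_lin//.
by rewrite -/(F y) (pF y) ?lexx ?(ltW y0)//; lra.
Qed.

Lemma primitive_sqB l p w x y : 0 <= x -> x <= y -> y <= l ->
  {within `[0, l], continuous w} -> primitive l p w ->
  p y ^+ 2 - p x ^+ 2 = 2 * \int[mu]_(t in `[x, y]) (p t * w t).
Proof.
move=> x0 xy yl cw pw.
have sw := within_sqint cw; have sp := primitive_sqint sw pw.
have i := sqintM (measurable_itv _) sp sw.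
have y0 := le_trans x0 xy; have xl := le_trans xy yl.
have iy : mu.-integrable `[0, y] (EFin \o (fun t => p t * w t)).
  by apply: integrableS i => //; exact: itv_sub.
rewrite -(@Rintegral_itv_obnd_cbnd _ x); last first.
  apply: integrableS iy => // t /=; rewrite !in_itv/= => /andP[xt ->].
  by rewrite (le_trans x0 (ltW xt)).
rewrite -(@Rintegral_itvB _ _ (BLeft 0) (BRight y) x iy) ?bnd_simp//= mulrBr.
rewrite -(@primitive_sq l p w y) ?y0// -(@primitive_sq l p w x) ?x0//.
ring.
Qed.

Lemma sqint_am_gm a b th u v : 0 < th -> sqint `[a, b] u -> sqint `[a, b] v ->
  `|2 * \int[mu]_(t in `[a, b]) (u t * v t)| <=
  th * \int[mu]_(t in `[a, b]) (u t ^+ 2) +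
  th^-1 * \int[mu]_(t in `[a, b]) (v t ^+ 2).
Proof.
move=> th0 su sv; apply: sq_le_abs_ge0.
  by rewrite addr_ge0// mulr_ge0 ?invr_ge0 ?(ltW th0)//;
    apply: Rintegral_ge0 => t _; exact: sqr_ge0.
rewrite exprMn; have := sqint_cauchy_schwarz su sv.
set A := \int[mu]_(t in _) _; set B := \int[mu]_(t in _) _.
set C := \int[mu]_(t in _) _ => h.
have -> : (th * B + th^-1 * C) ^+ 2 = (th * B - th^-1 * C) ^+ 2 + 4 * (B * C).
  by field; rewrite gt_eqF.
have := sqr_ge0 (th * B - th^-1 * C); lra.
Qed.

End Interval.

(** * Sup, Poincare, flux and weak convergence estimates on one edge *)

Section Estimates.
Variable R : realType.
Notation mu := (@lebesgue_measure R).
Implicit Types (u v w p : R -> R) (a b l x y : R).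

Lemma Rintegral_cat l u x : mu.-integrable `[0, l] (EFin \o u) -> 0 <= x <= l ->
  \int[mu]_(t in `[0, l]) u t =
  \int[mu]_(t in `[0, x]) u t + \int[mu]_(t in `[x, l]) u t.
Proof.
move=> iu /andP[x0 xl].
rewrite -(@Rintegral_itv_obnd_cbnd _ x); last first.
  apply: integrableS iu => // t /=; rewrite !in_itv/= => /andP[xt ->].
  by rewrite (le_trans x0 (ltW xt)).
rewrite -(@Rintegral_itvB _ u (BLeft 0) (BRight l) x iu) ?bnd_simp//.
by rewrite addrC subrK.
Qed.

Lemma Rintegral_split (N : nat) (h : R) u : 0 <= h ->
  mu.-integrable `[0, N%:R * h] (EFin \o u) ->
  \int[mu]_(t in `[0, N%:R * h]) u t =
  \sum_(k < N) \int[mu]_(t in `[k%:R * h, k.+1%:R * h]) u t.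
Proof.
move=> h0; elim: N => [|N IH] iu.
  by rewrite mul0r set_itv1 Rintegral_set1 big_ord0.
have Nh : 0 <= N%:R * h <= N.+1%:R * h.
  by rewrite mulr_ge0//= ler_wpM2r// ler_nat.
rewrite big_ord_recr/= -IH; first exact: Rintegral_cat.
by apply: integrableS iu => //; apply: itv_sub => //; case/andP: Nh.
Qed.

Lemma Rintegral_avg_ge a b u c k m : a <= b ->
  mu.-integrable `[a, b] (EFin \o u) ->
  (forall t, a <= t <= b -> c <= k * u t + m) ->
  c * (b - a) <= k * \int[mu]_(t in `[a, b]) u t + m * (b - a).
Proof.
move=> ab iu H; have ic d := sqint_integrable (sqint_cst a b d).
rewrite -!Rintegral_itv_cst// -Rintegral_lin//; last exact: (ic m).
apply: le_Rintegral => //.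
- exact: (ic c).
- apply: (@Rintegrable_lin R `[a, b] k u (cst m)) => //; exact: (ic m).
Qed.

Lemma Rintegral_avg_le a b u m : a <= b ->
  mu.-integrable `[a, b] (EFin \o u) ->
  (forall t, a <= t <= b -> u t <= m) ->
  \int[mu]_(t in `[a, b]) u t <= m * (b - a).
Proof.
move=> ab iu H; have := @Rintegral_avg_ge a b u (- m) (- 1) 0 ab iu.
rewrite mul0r addr0 !mulNr mul1r lerN2; apply => t /H.
by rewrite mulN1r addr0 lerN2.
Qed.

Lemma primitive_osc l p w a b x y : sqint `[0, l] w -> primitive l p w ->
  0 <= a -> b <= l -> a <= x <= b -> a <= y <= b ->
  (p x - p y) ^+ 2 <= (b - a) * \int[mu]_(t in `[a, b]) (w t ^+ 2).
Proof.
move=> sw pw a0 bl; wlog xy : x y / y <= x.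
  move=> H xl yl; have [/H|/ltW /H] := leP y x; first exact.
  by rewrite -sqrrN opprB; apply.
move=> /andP[ax xb] /andP[ay yb].
apply: le_trans (primitive_hoelder sw pw (le_trans a0 ay) xy (le_trans xb bl)) _.
apply: ler_pM; first by rewrite subr_ge0.
- by apply: Rintegral_ge0 => t _; exact: sqr_ge0.
- by rewrite lerB.
- by apply: Rintegral_sq_mono => //; exact: sqint_sub sw.
Qed.

(** Average p(x)^2 <= 2 p(t)^2 + 2 (p(x) - p(t))^2 over t, the oscillation being controlled by
    Cauchy-Schwarz. *)
Lemma primitive_sup l p w x : sqint `[0, l] w -> primitive l p w ->
  0 <= x <= l ->
  l * p x ^+ 2 <= 2 * \int[mu]_(t in `[0, l]) (p t ^+ 2) +
                  2 * l ^+ 2 * \int[mu]_(t in `[0, l]) (w t ^+ 2).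
Proof.
move=> sw pw xl; have l0 : 0 <= l by case/andP: xl => /le_trans; apply.
set W := \int[mu]_(t in `[0, l]) (w t ^+ 2).
have := @Rintegral_avg_ge 0 l (fun t => p t ^+ 2) (p x ^+ 2) 2 (2 * (l * W)) l0
  (primitive_sqint sw pw).2.
rewrite subr0 => H; have {H} : p x ^+ 2 * l <=
    2 * \int[mu]_(t in `[0, l]) (p t ^+ 2) + 2 * (l * W) * l; last by lra.
apply: H => t tl; have := @primitive_osc l p w 0 l x t sw pw (lexx 0) (lexx l) xl tl.
rewrite subr0 -/W; have := sqr_ge0 (p x - 2 * p t); lra.
Qed.

(** At each x, (b - a) p(x) differs from the integral of p by the integral of p(x) - p(t), which the
    oscillation bound controls; squaring and averaging over x gives the estimate. *)
Lemma primitive_poincare l p w a b : sqint `[0, l] w -> primitive l p w ->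
  0 <= a -> a < b -> b <= l ->
  \int[mu]_(t in `[a, b]) (p t ^+ 2) <=
  2 / (b - a) * (\int[mu]_(t in `[a, b]) p t) ^+ 2 +
  2 * (b - a) ^+ 2 * \int[mu]_(t in `[a, b]) (w t ^+ 2).
Proof.
move=> sw pw a0 ab bl; have abw := ltW ab; have h0 : 0 < b - a by rewrite subr_gt0.
have sp := sqint_sub a0 bl (primitive_sqint sw pw).
set A := \int[mu]_(t in `[a, b]) p t.
set W := \int[mu]_(t in `[a, b]) (w t ^+ 2).
have W0 : 0 <= W by apply: Rintegral_ge0 => t _; exact: sqr_ge0.
have key x : a <= x <= b -> p x ^+ 2 <= 2 / (b - a) ^+ 2 * A ^+ 2 + 2 * (b - a) * W.
  move=> xab.
  have sd : sqint `[a, b] (fun t => -1 * p t + p x).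
    exact: (sqint_lin (-1) sp (sqint_cst a b (p x))).
  have cs := sqint_cauchy_schwarz sd (sqint_cst a b 1).
  have dE : \int[mu]_(t in `[a, b]) ((-1 * p t + p x) * cst 1 t) =
      -1 * A + p x * (b - a).
    rewrite -Rintegral_itv_cst// -Rintegral_lin//; last 2 first.
    - exact: sqint_integrable.
    - exact: (sqint_integrable (sqint_cst a b (p x))).
    by apply: eq_Rintegral => t _; rewrite mulr1.
  have d2 : \int[mu]_(t in `[a, b]) ((-1 * p t + p x) ^+ 2) <=
      (b - a) * W * (b - a).
    apply: Rintegral_avg_le => //; first exact: sd.2.
    move=> t tab; rewrite mulN1r addrC.
    exact: primitive_osc sw pw a0 bl xab tab.
  have e1 : \int[mu]_(t in `[a, b]) (cst 1 t ^+ 2) = b - a.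
    rewrite -[RHS]mul1r -Rintegral_itv_cst//.
    by apply: eq_Rintegral => t _; rewrite /= expr1n.
  rewrite dE e1 in cs.
  have h2 : (-1 * A + p x * (b - a)) ^+ 2 <= (b - a) * W * (b - a) * (b - a).
    by apply: le_trans cs _; rewrite ler_wpM2r// ltW.
  rewrite -(@ler_pM2l _ ((b - a) ^+ 2)) ?exprn_gt0//.
  have -> : (b - a) ^+ 2 * (2 / (b - a) ^+ 2 * A ^+ 2 + 2 * (b - a) * W) =
    2 * A ^+ 2 + 2 * ((b - a) * W * (b - a) * (b - a)).
    by field; rewrite gt_eqF.
  move: h2; move: (b - a) (p x) => h q h2.
  have := sqr_ge0 (2 * A - q * h); lra.
apply: le_trans (Rintegral_avg_le abw sp.2 key) _.
rewrite le_eqVlt; apply/orP; left; apply/eqP.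
by field; rewrite gt_eqF.
Qed.

(** For each x use the step weight equal to c on [0, x] and to 1 on [x, l]: the jump at x leaves (1
    - c) p(x)^2, and the endpoints contribute p(l)^2 - c p(0)^2. Averaging over x amounts to using
    the linear weight. *)
Lemma primitive_flux l p w c th : 0 < l -> 0 < th -> 0 <= c <= 1 ->
  {within `[0, l], continuous w} -> primitive l p w ->
  (1 - c) / l * \int[mu]_(t in `[0, l]) (p t ^+ 2) <=
  p l ^+ 2 - c * p 0 ^+ 2 + th * \int[mu]_(t in `[0, l]) (p t ^+ 2) +
    th^-1 * \int[mu]_(t in `[0, l]) (w t ^+ 2).
Proof.
move=> l0 th0 /andP[c0 c1] cw pw.
have sw := within_sqint cw; have sp := primitive_sqint sw pw.
set P := \int[mu]_(t in `[0, l]) (p t ^+ 2).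
set W := \int[mu]_(t in `[0, l]) (w t ^+ 2).
have c1' : 0 <= 1 - c by rewrite subr_ge0.
have key x : 0 <= x <= l -> (1 - c) * p x ^+ 2 <=
    p l ^+ 2 - c * p 0 ^+ 2 + th * P + th^-1 * W.
  move=> /andP[x0 xl].
  have e1 := primitive_sqB x0 xl (lexx l) cw pw.
  have e2 := primitive_sqB (lexx 0) x0 xl cw pw.
  have b1 := sqint_am_gm th0 (sqint_sub x0 (lexx l) sp) (sqint_sub x0 (lexx l) sw).
  have b2 := sqint_am_gm th0 (sqint_sub (lexx 0) xl sp) (sqint_sub (lexx 0) xl sw).
  rewrite -e1 in b1; rewrite -e2 in b2.
  have x0l : 0 <= x <= l by rewrite x0.
  have s1 := Rintegral_cat sp.2 x0l; have s2 := Rintegral_cat sw.2 x0l.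
  rewrite /= -/P in s1; rewrite /= -/W in s2.
  move: b1 b2; rewrite !ler_norml => /andP[b1 _] /andP[b2 _].
  set E1 := _ + _ in b1; set E2 := _ + _ in b2.
  have E20 : 0 <= E2.
    by rewrite addr_ge0// mulr_ge0 ?invr_ge0 ?(ltW th0)//;
      apply: Rintegral_ge0 => t _; exact: sqr_ge0.
  have h3 : c * E2 <= E2 by rewrite ler_piMl.
  have h4 := ler_wpM2l c0 b2.
  have : th * P + th^-1 * W = E1 + E2 by rewrite s1 s2 /E1 /E2; ring.
  lra.
pose Q := p l ^+ 2 - c * p 0 ^+ 2 + th * P + th^-1 * W.
have H := @Rintegral_avg_ge 0 l (fun t => p t ^+ 2) 0 (- (1 - c)) Q (ltW l0) sp.2.
have : 0 * (l - 0) <= - (1 - c) * P + Q * (l - 0).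
  by apply: H => t /key; rewrite -/Q; lra.
rewrite mul0r subr0 -/Q => {}H.
by rewrite mulrAC ler_pdivrMr//; lra.
Qed.

(* Weak convergence to 0 of derivatives of functions tending uniformly to 0,
   tested against a Hoelder continuous function by Riemann sums. *)
Lemma primitive_weak_null l v d e B : 0 < l -> 0 < e -> 0 <= B ->
  sqint `[0, l] d -> primitive l v d ->
  exists2 del, 0 < del & forall p w, sqint `[0, l] w -> primitive l p w ->
    \int[mu]_(t in `[0, l]) (w t ^+ 2) <= B ->
    (forall t, 0 <= t <= l -> `|p t| <= del) ->
    `|\int[mu]_(t in `[0, l]) (w t * v t)| <= e.
Proof.
move=> l0 e0 B0 sd vd.
set D := \int[mu]_(t in `[0, l]) (d t ^+ 2).
have D0 : 0 <= D by apply: Rintegral_ge0 => t _; exact: sqr_ge0.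
have sv := primitive_sqint sd vd.
pose e1 := e / 2; have e10 : 0 < e1 by rewrite divr_gt0.
pose S := 1 + 2 * v 0 ^+ 2 + 2 * (l * D).
have lD : 0 <= l * D by rewrite mulr_ge0// ltW.
have S1 : 1 <= S by rewrite /S; have := sqr_ge0 (v 0); lra.
have vS x : 0 <= x <= l -> `|v x| <= S.
  move=> xl; apply: sq_le_abs_ge0; first by lra.
  have x0 : 0 <= (0 : R) <= l by rewrite lexx ltW.
  have := @primitive_osc l v d 0 l x 0 sd vd (lexx 0) (lexx l) xl x0.
  rewrite subr0 -/D => h.
  have : v x ^+ 2 <= S by rewrite /S; have := sqr_ge0 (v x - 2 * v 0); lra.
  have : S <= S ^+ 2 by rewrite expr2 ler_peMl//; lra.
  by move=> h2 h1; exact: le_trans h1 h2.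
pose th := e1 / (B + 1).
have th0 : 0 < th by rewrite divr_gt0// ltr_wpDl.
(* Budget: [th] makes th B <= e1, the mesh h = l/N makes the contribution of the oscillation of v at
   most e1, and the final bound on p absorbs the increments of p. In total e1/2 + (e1 + e1)/2 <
   e. *)
pose N := (Num.truncn (th^-1 * l ^+ 2 * D / e1)).+1.
have N0 : 0 < N%:R :> R by rewrite ltr0n.
pose h := l / N%:R.
have h0 : 0 < h by rewrite divr_gt0.
have lN : N%:R * h = l by rewrite mulrC divfK// gt_eqF.
have hD : th^-1 * (h * D * l) <= e1.
  have : th^-1 * l ^+ 2 * D / e1 <= N%:R by apply: ltW; exact: truncnS_gt.
  rewrite ler_pdivrMr// => H.
  rewrite /h (_ : th^-1 * (l / N%:R * D * l) = (th^-1 * l ^+ 2 * D) / N%:R); last first.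
    by field; rewrite !gt_eqF.
  by rewrite ler_pdivrMr// [leRHS]mulrC.
exists (e1 / (4 * N%:R * S)).
  by rewrite divr_gt0// !mulr_gt0//; lra.
move=> p w sw pw wB pdel.
have iwv : mu.-integrable `[0, N%:R * h] (EFin \o (fun t => w t * v t)).
  by rewrite lN; exact: (sqintM (measurable_itv _) sw sv).
rewrite -lN (Rintegral_split (ltW h0) iwv).
have piece (k : 'I_N) : [/\ 0 <= k%:R * h :> R, k%:R * h <= k.+1%:R * h,
    k.+1%:R * h <= l & k.+1%:R * h - k%:R * h = h].
  split; first by rewrite mulr_ge0// ltW.
  - by rewrite ler_wpM2r ?ler_nat// ltW.
  - by rewrite -lN ler_wpM2r ?ler_nat// ltW.
  - by rewrite -mulrBl -natrB// subSnn mul1r.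
pose W k := \int[mu]_(t in `[k%:R * h, k.+1%:R * h]) (w t ^+ 2).
have Wsum : \sum_(k < N) W k <= B.
  apply: le_trans wB; rewrite -[in leRHS]lN Rintegral_split// ?lN//; first exact: ltW.
  exact: sw.2.
have bound (k : 'I_N) : `|\int[mu]_(t in `[k%:R * h, k.+1%:R * h]) (w t * v t)| <=
    e1 / (2 * N%:R) + 2^-1 * (th * W k + th^-1 * (h * D * h)).
  have [k0 k1 k2 kh] := piece k.
  set a := k%:R * h in k0 k1 kh *; set b := k.+1%:R * h in k1 k2 kh *.
  have swk := sqint_sub k0 k2 sw; have svk := sqint_sub k0 k2 sv.
  have sdk : sqint `[a, b] (fun t => -1 * cst (v a) t + v t).
    exact: (sqint_lin (-1) (sqint_cst a b (v a)) svk).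
  (* Freeze v at the left endpoint: the first term is v(a)(p(b) - p(a)), small because p is small;
     in the second, v - v(a) is small by Hoelder continuity. *)
  have -> : \int[mu]_(t in `[a, b]) (w t * v t) =
      v a * \int[mu]_(t in `[a, b]) w t +
      \int[mu]_(t in `[a, b]) (w t * (-1 * cst (v a) t + v t)).
    rewrite -Rintegral_lin//; last 2 first.
    - exact: sqint_integrable.
    - exact: (sqintM (measurable_itv _) swk sdk).
    by apply: eq_Rintegral => t _ /=; ring.
  rewrite -(primitiveB (sqint_integrable sw) pw k0 k1 k2).
  apply: le_trans (ler_normD _ _) _; apply: lerD.
    rewrite normrM.
    have al : 0 <= a <= l by rewrite k0 (le_trans k1 k2).
    have bl : 0 <= b <= l by rewrite (le_trans k0 k1).
    apply: (@le_trans _ _ (S * (e1 / (4 * N%:R * S) + e1 / (4 * N%:R * S)))).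
      apply: ler_pM => //; first exact: vS.
      by apply: le_trans (ler_normB _ _) _; apply: lerD; exact: pdel.
    rewrite le_eqVlt; apply/orP; left; apply/eqP; field.
    by rewrite !gt_eqF//; lra.
  have := sqint_am_gm th0 swk sdk; rewrite normrM ger0_norm// -/(W k).
  have : \int[mu]_(t in `[a, b]) ((-1 * cst (v a) t + v t) ^+ 2) <= h * D * (b - a).
    apply: Rintegral_avg_le => //; first exact: sdk.2.
    move=> t /andP[ta tb] /=; rewrite mulN1r addrC.
    have aab : a <= a <= b by rewrite lexx.
    have tab : a <= t <= b by rewrite ta.
    apply: le_trans (primitive_osc sd vd k0 k2 tab aab) _.
    by rewrite kh ler_wpM2l ?(ltW h0)//; exact: Rintegral_sq_mono.
  rewrite kh => h1 h2.
  have thi : 0 <= th^-1 by rewrite invr_ge0 ltW.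
  have := ler_wpM2l thi h1; lra.
apply: le_trans (ler_norm_sum _ _ _) _.
apply: (@le_trans _ _ (\sum_(k < N) (e1 / (2 * N%:R) +
    2^-1 * (th * W k + th^-1 * (h * D * h))))).  
  by apply: ler_sum => k _; exact: bound.
rewrite big_split/= sumr_const card_ord -mulr_sumr big_split/= -mulr_sumr sumr_const card_ord.
rewrite -(mulr_natl (e1 / _) N) -(mulr_natl (_ * (h * D * h)) N).
have -> : N%:R * (e1 / (2 * N%:R)) = e1 / 2 by field; rewrite gt_eqF.
have -> : N%:R * (th^-1 * (h * D * h)) = th^-1 * (h * D * l).
  by rewrite -lN; ring.
have : th * \sum_(k < N) W k <= e1.
  apply: (@le_trans _ _ (th * B)); first by rewrite ler_wpM2l// ltW.
  rewrite /th mulrAC ler_pdivrMr ?ltr_wpDl//.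
  by rewrite ler_wpM2l ?ltW// ltrDl.
move: hD e0; rewrite /e1; move: (th^-1 * _) (th * _) => X Y.
by clear; lra.
Qed.

End Estimates.

(** * The space L^2 of the tree *)

Section RealSums.
Variables (R : realType) (I : choiceType).
Implicit Types (F G P Q : I -> R) (A : {fset I}).

Definition nnsum P : \bar R := (\esum_(i in [set: I]) (P i)%:E)%E.

Lemma nnsum_ub P (M : R) : (forall A, \sum_(i <- A) P i <= M) ->
  (nnsum P <= M%:E)%E.
Proof.
move=> H; apply: ge_ereal_sup => _ [X [fX _] <-].
by rewrite fsbig_finite//= sumEFin lee_fin.
Qed.

Lemma fsum_le_nnsum P A : (\sum_(i <- A) (P i)%:E <= nnsum P)%E.
Proof.
apply: esum_ge; exists [set` A]; first by split => //; exact: finite_fset.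
by rewrite fsbig_finite//= set_fsetK.
Qed.

Lemma nnsum_ge0 P : (forall i, 0 <= P i) -> (0 <= nnsum P)%E.
Proof. by move=> P0; apply: esum_ge0 => i _; rewrite lee_fin. Qed.

Lemma le_nnsum P Q : (forall i, P i <= Q i) -> (nnsum P <= nnsum Q)%E.
Proof. by move=> PQ; apply: le_esum => i _; rewrite lee_fin. Qed.

Lemma nnsumD P Q : (forall i, 0 <= P i) -> (forall i, 0 <= Q i) ->
  nnsum (fun i => P i + Q i) = (nnsum P + nnsum Q)%E.
Proof.
move=> P0 Q0; rewrite -esumD; last 2 first.
- by move=> i _; rewrite lee_fin.
- by move=> i _; rewrite lee_fin.
by apply: eq_esum => i _; rewrite EFinD.
Qed.

Lemma nnsumZ (k : R) P : 0 <= k -> (forall i, 0 <= P i) -> (nnsum P < +oo)%E ->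
  nnsum (fun i => k * P i) = (k%:E * nnsum P)%E.
Proof.
move=> k0 P0 Poo; have Pf : nnsum P \is a fin_num.
  by rewrite ge0_fin_numE// nnsum_ge0.
move: k0; rewrite le_eqVlt => /predU1P[<-|k0].
  by rewrite mul0e; apply: esum1 => i _; rewrite mul0r.
have le1 (c : R) S : 0 < c -> (forall i, 0 <= S i) -> nnsum S \is a fin_num ->
    (nnsum (fun i => (c * S i)%R) <= c%:E * nnsum S)%E.
  move=> c0 S0 Sf; rewrite -(fineK Sf) -EFinM; apply: nnsum_ub => A.
  rewrite -mulr_sumr ler_pM2l// -lee_fin fineK// -sumEFin.
  exact: fsum_le_nnsum.
apply/eqP; rewrite eq_le le1//=.
have kf : nnsum (fun i => k * P i) \is a fin_num.
  rewrite ge0_fin_numE; last by apply: nnsum_ge0 => i; rewrite mulr_ge0// ltW.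
  apply: le_lt_trans (le1 _ _ k0 P0 Pf) _.
  by rewrite -(fineK Pf) -EFinM ltry.
have kP0 i : 0 <= k * P i by rewrite mulr_ge0// ltW.
have ki : 0 < k^-1 by rewrite invr_gt0.
have := le1 _ _ ki kP0 kf.
rewrite (_ : (fun i => k^-1 * (k * P i)) = P); last first.
  by apply/funext => i; rewrite mulKf// gt_eqF.
rewrite -(fineK Pf) -(fineK kf) -!EFinM !lee_fin.
by rewrite mulrC ler_pdivlMr// mulrC.
Qed.

Definition summ F := (nnsum (fun i => `|F i|%R) < +oo)%E.

Lemma rsum_nonneg P : (forall i, 0 <= P i) -> rsum P = fine (nnsum P).
Proof.
move=> P0; rewrite /rsum [X in _ - fine X]esum1 ?subr0; last first.
  by move=> i _; rewrite max_r// oppr_le0.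
by congr fine; apply: eq_esum => i _; rewrite max_l.
Qed.

Lemma summ_nonneg P Q : (forall i, 0 <= P i) -> (forall i, P i <= Q i) ->
  (nnsum Q < +oo)%E -> nnsum P \is a fin_num.
Proof.
move=> P0 PQ sQ; rewrite ge0_fin_numE; last exact: nnsum_ge0.
exact: le_lt_trans (le_nnsum PQ) sQ.
Qed.

(** Any splitting into summable nonnegative families computes [rsum], since F^+ + Q = P + F^-
    termwise; linearity needs this because sums do not respect positive parts. *)
Lemma rsum_diff F P Q : (forall i, 0 <= P i) -> (forall i, 0 <= Q i) ->
  nnsum P \is a fin_num -> nnsum Q \is a fin_num ->
  (forall i, F i = P i - Q i) -> rsum F = fine (nnsum P) - fine (nnsum Q).
Proof.
move=> P0 Q0 fP fQ FPQ; rewrite /rsum.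
pose Fp i := Num.max (F i) 0; pose Fn i := Num.max (- F i) 0.
rewrite -/(nnsum Fp) -/(nnsum Fn).
have Fp0 i : 0 <= Fp i by rewrite le_max lexx orbT.
have Fn0 i : 0 <= Fn i by rewrite le_max lexx orbT.
have FpP i : Fp i <= P i by rewrite ge_max P0 andbT FPQ lerBlDr lerDl.
have FnQ i : Fn i <= Q i by rewrite ge_max Q0 andbT FPQ opprB lerBlDr lerDl.
have fFp : nnsum Fp \is a fin_num.
  by apply: (summ_nonneg Fp0 FpP); rewrite ltey_eq fP.
have fFn : nnsum Fn \is a fin_num.
  by apply: (summ_nonneg Fn0 FnQ); rewrite ltey_eq fQ.
have : nnsum (fun i => Fp i + Q i) = nnsum (fun i => P i + Fn i).
  congr nnsum; apply/funext => i; have := FPQ i; rewrite /Fp /Fn.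
  by case: (leP (F i) 0) => h; case: (leP (- F i) 0) => h'; lra.
rewrite !nnsumD// => /(congr1 fine); rewrite !fineD//; lra.
Qed.

Lemma rsum_lin (k : R) F G : summ F -> summ G ->
  rsum (fun i => k * F i + G i) = k * rsum F + rsum G.
Proof.
move=> sF sG.
pose pos (H : I -> R) i := Num.max (H i) 0.
pose neg (H : I -> R) i := Num.max (- H i) 0.
have p0 H i : 0 <= pos H i by rewrite le_max lexx orbT.
have n0 H i : 0 <= neg H i by rewrite le_max lexx orbT.
have pn H i : H i = pos H i - neg H i.
  by rewrite /pos /neg; case: (leP (H i) 0) => h; case: (leP (- H i) 0) => h'; lra.
have pf H : summ H -> nnsum (pos H) \is a fin_num.
  by apply: summ_nonneg => // i; rewrite ge_max normr_ge0 ler_norm.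
have nf H : summ H -> nnsum (neg H) \is a fin_num.
  by apply: summ_nonneg => // i; rewrite ge_max normr_ge0 -normrN ler_norm.
have flt (x : \bar R) : x \is a fin_num -> (x < +oo)%E by move=> xf; rewrite ltey_eq xf.
have comb (c : R) P Q : 0 <= c -> (forall i, 0 <= P i) -> (forall i, 0 <= Q i) ->
    nnsum P \is a fin_num -> nnsum Q \is a fin_num ->
    nnsum (fun i => c * P i + Q i) = (c * fine (nnsum P) + fine (nnsum Q))%:E.
  move=> c0 P0 Q0 Pf Qf; rewrite nnsumD//; last by move=> i; exact: mulr_ge0.
  by rewrite nnsumZ ?flt// EFinD EFinM !fineK.
have rE H : rsum H = fine (nnsum (pos H)) - fine (nnsum (neg H)) by [].
have pF := pf F sF; have pG := pf G sG; have nF := nf F sF; have nG := nf G sG.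
rewrite (rE F) (rE G); have [k0|k0] := leP 0 k.
  rewrite (@rsum_diff _ (fun i => k * pos F i + pos G i)
    (fun i => k * neg F i + neg G i)) ?comb//=; first by ring.
  - by move=> i; rewrite addr_ge0// mulr_ge0.
  - by move=> i; rewrite addr_ge0// mulr_ge0.
  - by move=> i; rewrite (pn F) (pn G); ring.
have k0' : 0 <= - k by rewrite oppr_ge0 ltW.
rewrite (@rsum_diff _ (fun i => - k * neg F i + pos G i)
  (fun i => - k * pos F i + neg G i)) ?comb//=; first by ring.
- by move=> i; rewrite addr_ge0// mulr_ge0.
- by move=> i; rewrite addr_ge0// mulr_ge0.
- by move=> i; rewrite (pn F) (pn G); ring.
Qed.

Lemma nnsum_finsupp A P : (forall i, 0 <= P i) ->
  (forall i, i \notin A -> P i = 0) -> nnsum P = (\sum_(i <- A) P i)%:E.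
Proof.
move=> P0 PA; apply/eqP; rewrite eq_le -{2}sumEFin fsum_le_nnsum andbT.
apply: nnsum_ub => B; rewrite (bigID (mem A))/= [X in _ + X]big1 ?addr0.
  rewrite -big_filter [leRHS](bigID (mem B))/= -[X in X <= _]addr0 lerD//.
    rewrite -[leRHS]big_filter; rewrite (perm_big [seq i <- A | i \in B])//.
    apply: uniq_perm; rewrite ?filter_uniq ?fset_uniq// => i.
    by rewrite !mem_filter andbC.
  exact: sumr_ge0.
by move=> i /PA.
Qed.

Lemma rsum_finsupp A F : (forall i, i \notin A -> F i = 0) ->
  rsum F = \sum_(i <- A) F i.
Proof.
move=> FA; rewrite /rsum.
rewrite -/(nnsum (fun i => Num.max (F i) 0)) -/(nnsum (fun i => Num.max (- F i) 0)).
rewrite (@nnsum_finsupp A); last 2 first.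
- by move=> i; rewrite le_max lexx orbT.
- by move=> i /FA ->; rewrite maxxx.
rewrite (@nnsum_finsupp A); last 2 first.
- by move=> i; rewrite le_max lexx orbT.
- by move=> i /FA ->; rewrite oppr0 maxxx.
rewrite /= -sumrB; apply: eq_bigr => i _.
by case: (leP (F i) 0) => h; case: (leP (- F i) 0) => h'; lra.
Qed.

End RealSums.

Section ComplexInterval.
Variable R : realType.
Notation mu := (@lebesgue_measure R).
Local Notation TR := (measurableTypeR R).
Local Notation C := (Rcomplex R).
Implicit Types (f g h : R -> C) (l : R).

Definition repart f : R -> R := fun x => complex.Re (f x).
Definition impart f : R -> R := fun x => complex.Im (f x).

Lemma ReD (z w : C) : complex.Re (z + w) = complex.Re z + complex.Re w.
Proof. by case: z => a b; case: w. Qed.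
Lemma ImD (z w : C) : complex.Im (z + w) = complex.Im z + complex.Im w.
Proof. by case: z => a b; case: w. Qed.
Lemma ReN (z : C) : complex.Re (- z) = - complex.Re z.
Proof. by case: z. Qed.
Lemma ImN (z : C) : complex.Im (- z) = - complex.Im z.
Proof. by case: z. Qed.
Lemma ReZ (a : R) (z : C) : complex.Re (a *: z) = a * complex.Re z.
Proof. by case: z. Qed.
Lemma ImZ (a : R) (z : C) : complex.Im (a *: z) = a * complex.Im z.
Proof. by case: z. Qed.

Definition l2 l f := sqint `[0, l] (repart f) /\ sqint `[0, l] (impart f).

(** The real part of the complex inner product. Its imaginary part is [dot] of f with i g
    ([Im_cintE]), so no information is lost. *)
Definition dot l f g : R :=
  \int[mu]_(x in `[0, l]) (repart f x * repart g x) +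
  \int[mu]_(x in `[0, l]) (impart f x * impart g x).

Definition nrm l f : R := dot l f f.

Lemma nrmE l f : nrm l f = \int[mu]_(x in `[0, l]) (repart f x ^+ 2) +
  \int[mu]_(x in `[0, l]) (impart f x ^+ 2).
Proof. by []. Qed.

Lemma nrm_ge0 l f : 0 <= nrm l f.
Proof. by rewrite nrmE addr_ge0//; apply: Rintegral_ge0 => x _; exact: sqr_ge0. Qed.

Lemma l2_lin l (a : R) f g : l2 l f -> l2 l g -> l2 l (fun x => a *: f x + g x).
Proof.
have re : repart (fun x => a *: f x + g x) = fun x => a * repart f x + repart g x.
  by apply/funext => x; rewrite /repart ReD ReZ.
have im : impart (fun x => a *: f x + g x) = fun x => a * impart f x + impart g x.
  by apply/funext => x; rewrite /impart ImD ImZ.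
by move=> [fr fi] [gr gi]; split; rewrite ?re ?im; exact: sqint_lin.
Qed.

Lemma dot_lin l (a : R) f g h : l2 l f -> l2 l g -> l2 l h ->
  dot l (fun x => a *: f x + g x) h = a * dot l f h + dot l g h.
Proof.
move=> [fr fi] [gr gi] [hr hi].
have mI : measurable (`[0, l]%classic : set TR) by exact: measurable_itv.
have e1 : \int[mu]_(x in `[0, l])
    (repart (fun x => a *: f x + g x) x * repart h x) =
    a * \int[mu]_(x in `[0, l]) (repart f x * repart h x) +
    \int[mu]_(x in `[0, l]) (repart g x * repart h x).
  rewrite -Rintegral_lin//; [|exact: sqintM|exact: sqintM].
  by apply: eq_Rintegral => x _; rewrite /repart ReD ReZ; ring.
have e2 : \int[mu]_(x in `[0, l])
    (impart (fun x => a *: f x + g x) x * impart h x) =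
    a * \int[mu]_(x in `[0, l]) (impart f x * impart h x) +
    \int[mu]_(x in `[0, l]) (impart g x * impart h x).
  rewrite -Rintegral_lin//; [|exact: sqintM|exact: sqintM].
  by apply: eq_Rintegral => x _; rewrite /impart ImD ImZ; ring.
by rewrite /dot e1 e2; ring.
Qed.

Lemma dotC l f g : dot l f g = dot l g f.
Proof. by rewrite /dot; congr (_ + _); apply: eq_Rintegral => x _; rewrite mulrC. Qed.

Lemma l2_const0 l : l2 l (fun=> 0).
Proof. by split; exact: sqint_cst. Qed.

Lemma nrm0 l : nrm l (fun=> 0) = 0.
Proof.
have z (u : R -> R) : (forall x, u x = 0) ->
    \int[mu]_(x in `[0, l]) (u x ^+ 2) = 0.
  move=> u0; rewrite /Rintegral (_ : (fun x => _) = cst 0%E) ?integral0//.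
  by apply/funext => x; rewrite u0 expr0n.
by rewrite nrmE !z ?addr0.
Qed.

Lemma nrm_lin l (a : R) f g : l2 l f -> l2 l g ->
  nrm l (fun x => a *: f x + g x) =
  a ^+ 2 * nrm l f + 2 * a * dot l f g + nrm l g.
Proof.
move=> lf lg; have lh := l2_lin a lf lg.
rewrite /nrm dot_lin// (dotC l f) (dotC l g) !dot_lin// (dotC l g f); ring.
Qed.

Lemma dot_le l f g : l2 l f -> l2 l g -> 2 * `|dot l f g| <= nrm l f + nrm l g.
Proof.
move=> lf lg; have := nrm_lin 1 lf lg; have := nrm_lin (-1) lf lg.
have := nrm_ge0 l (fun x => 1 *: f x + g x).
have := nrm_ge0 l (fun x => -1 *: f x + g x).
by case: (ler0P (dot l f g)) => h; lra.
Qed.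

Lemma nrmD_le l f g : l2 l f -> l2 l g ->
  nrm l (fun x => f x + g x) <= 2 * nrm l f + 2 * nrm l g.
Proof.
move=> lf lg; have := nrm_lin 1 lf lg; have := dot_le lf lg.
rewrite (_ : (fun x => 1 *: f x + g x) = (fun x => f x + g x)); last first.
  by apply/funext => x; rewrite scale1r.
by move=> h ->; have := ler_norm (dot l f g); lra.
Qed.

Lemma normc_sq (z : C) : Normc.normc z ^+ 2 = complex.Re z ^+ 2 + complex.Im z ^+ 2.
Proof. by case: z => a b /=; rewrite sqr_sqrtr// addr_ge0// sqr_ge0. Qed.

Lemma l2P l f : (cmeasurable l f /\ (sqnorm_itv l f < +oo)%E) <-> l2 l f.
Proof.
have mI : measurable (`[0, l]%classic : set TR) by exact: measurable_itv.
split=> [[[mr mi] fin]|[[mr ir] [mi ii]]].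
  have key u : measurable_fun (`[0, l] : set TR) (u : TR -> R) ->
      (forall x, u x ^+ 2 <= Normc.normc (f x) ^+ 2) -> sqint `[0, l] u.
    move=> mu_ uf; split => //; apply/integrableP; split.
      by apply/measurable_EFinP; exact: measurable_funX.
    apply: le_lt_trans fin; apply: ge0_le_integral => //=.
    - by apply/measurable_EFinP; apply: measurableT_comp => //; exact: measurable_funX.
    - apply/measurable_EFinP.
      rewrite (_ : (fun x => _) = fun x => repart f x ^+ 2 + impart f x ^+ 2).
        by apply: measurable_funD; exact: measurable_funX.
      by apply/funext => x; rewrite normc_sq.
    - by move=> x _; rewrite lee_fin ger0_norm ?sqr_ge0.
  split; apply: key => // x; rewrite normc_sq /repart /impart.
    by rewrite lerDl sqr_ge0.
  by rewrite lerDr sqr_ge0.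
split; first by split.
have := Rintegrable_lin 1 mI ir ii => /integrableP[_]; apply: le_lt_trans.
apply: ge0_le_integral => //=.
- by move=> x _; rewrite lee_fin sqr_ge0.
- apply/measurable_EFinP.
  rewrite (_ : (fun x => _) = fun x => repart f x ^+ 2 + impart f x ^+ 2).
    by apply: measurable_funD; exact: measurable_funX.
  by apply/funext => x; rewrite normc_sq.
- apply/measurable_EFinP; apply: measurableT_comp => //.
  apply: measurable_funD; last exact: measurable_funX.
  by apply: measurable_funM; [exact: measurable_cst|exact: measurable_funX].
- by move=> x _; rewrite lee_fin normc_sq mul1r ler_norm.
Qed.

Lemma sqnorm_itvE l f : l2 l f -> sqnorm_itv l f = (nrm l f)%:E.
Proof.
move=> lf; have [[mr ir] [mi ii]] := lf.
have mI : measurable (`[0, l]%classic : set TR) by exact: measurable_itv.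
have e : \int[mu]_(x in `[0, l]) (Normc.normc (f x) ^+ 2) = nrm l f.
  rewrite nrmE -[X in X + _]mul1r -Rintegral_lin//.
  by apply: eq_Rintegral => x _; rewrite normc_sq mul1r.
rewrite -e /Rintegral fineK//.
rewrite ge0_fin_numE; last by apply: integral_ge0 => x _; rewrite lee_fin sqr_ge0.
by have [] := (l2P l f).2 lf.
Qed.

Lemma cintE f g l :
  cint 0 l (fun x => (f x : R[i]) * (g x)^*) =
  (\int[mu]_(x in `[0, l]) (repart f x * repart g x + impart f x * impart g x)) +i*
  (\int[mu]_(x in `[0, l]) (impart f x * repart g x - repart f x * impart g x)).
Proof.
rewrite /cint; congr (_ +i* _); apply: eq_Rintegral => x _;
  rewrite /repart /impart; case: (f x) => a b; case: (g x) => c d /=; ring.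
Qed.

Lemma Re_cintE f g l : l2 l f -> l2 l g ->
  complex.Re (cint 0 l (fun x => (f x : R[i]) * (g x)^*)) = dot l f g.
Proof.
move=> [fr fi] [gr gi]; rewrite cintE/= /dot -[X in _ = X + _]mul1r.
have mI : measurable (`[0, l]%classic : set TR) by exact: measurable_itv.
rewrite -Rintegral_lin//; [|exact: sqintM|exact: sqintM].
by apply: eq_Rintegral => x _; rewrite mul1r.
Qed.

Definition mul_i (z : C) : C := ('i : R[i]) * z.

Lemma Re_mul_i z : complex.Re (mul_i z) = - complex.Im z.
Proof. by case: z => a b; rewrite /mul_i /=; ring. Qed.

Lemma Im_mul_i z : complex.Im (mul_i z) = complex.Re z.
Proof. by case: z => a b; rewrite /mul_i /=; ring. Qed.

Lemma l2_mul_i l f : l2 l f -> l2 l (fun x => mul_i (f x)).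
Proof.
have re : repart (fun x => mul_i (f x)) = fun x => -1 * impart f x + cst 0 x.
  by apply/funext => x; rewrite /repart Re_mul_i addr0 mulN1r.
have im : impart (fun x => mul_i (f x)) = repart f.
  by apply/funext => x; rewrite /impart Im_mul_i.
move=> [fr fi]; split; rewrite ?re ?im//; apply: sqint_lin => //.
exact: sqint_cst.
Qed.

Lemma Im_cintE f g l : l2 l f -> l2 l g ->
  complex.Im (cint 0 l (fun x => (f x : R[i]) * (g x)^*)) =
  dot l f (fun x => mul_i (g x)).
Proof.
move=> lf lg; rewrite -Re_cintE//; last exact: l2_mul_i.
rewrite !cintE/=; apply: eq_Rintegral => x _.
by rewrite /repart /impart Re_mul_i Im_mul_i; ring.
Qed.

End ComplexInterval.

Section L2Space.
Variables (R : realType) (T : metric_tree R).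
Local Notation C := (Rcomplex R).
Definition tfun := edge T -> R -> C.
HB.instance Definition _ := GRing.Lmodule.on tfun.
Implicit Types f g h : tfun.

Lemma tfun_linE (a : R) f g e x : (a *: f + g) e x = a *: f e x + g e x.
Proof. by []. Qed.

Lemma L2P f : L2 (f : tree_fun T) <->
  (forall e, l2 (len e) (f e)) /\ (nnsum (fun e => nrm (len e) (f e)) < +oo)%E.
Proof.
have E : (forall e, l2 (len e) (f e)) ->
    sqnorm (f : tree_fun T) = nnsum (fun e => nrm (len e) (f e)).
  by move=> H; apply: eq_esum => e _; rewrite sqnorm_itvE.
split=> [[mf fin]|[lf fin]].
  have lf e : l2 (len e) (f e).
    apply/l2P; split; first exact: mf.
    apply: le_lt_trans fin; apply: esum_ge; exists [set e].
      by split => //; exact: finite_set1.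
    by rewrite fsbig_set1.
  by split => //; rewrite -E.
split; last by rewrite E.
by move=> e; have [] := (l2P (len e) (f e)).2 (lf e).
Qed.

Definition L2pred : {pred tfun} := fun f => `[< L2 (f : tree_fun T) >].

Lemma L2predP f : reflect (L2 (f : tree_fun T)) (f \in L2pred).
Proof. exact: asboolP. Qed.

Lemma nnsum_nrm_lin (a : R) f g :
  (forall e, l2 (len e) (f e)) -> (forall e, l2 (len e) (g e)) ->
  (nnsum (fun e => nrm (len e) (f e)) < +oo)%E ->
  (nnsum (fun e => nrm (len e) (g e)) < +oo)%E ->
  (nnsum (fun e => nrm (len e) ((a *: f + g)%R e)) < +oo)%E.
Proof.
move=> lf lg ff fg; pose c := 2 * a ^+ 2 + 2.
have c0 : 0 <= c by rewrite /c; have := sqr_ge0 a; lra.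
have n0 e (h : tfun) : 0 <= nrm (len e) (h e) by exact: nrm_ge0.
apply: (@le_lt_trans _ _
  (nnsum (fun e => c * (nrm (len e) (f e) + nrm (len e) (g e))))).
  apply: le_nnsum => e; rewrite (nrm_lin a (lf e) (lg e)) /c.
  have := nrm_lin (- a) (lf e) (lg e).
  have := nrm_ge0 (len e) (fun x => - a *: f e x + g e x).
  have := n0 e f; have := n0 e g; have := sqr_ge0 a.
  move: (nrm _ (f e)) (nrm _ (g e)) (dot _ _ _) => p q r a2 q0 p0 s0 e1; rewrite e1 in s0.
  have := mulr_ge0 a2 q0; lra.
have P0 e : 0 <= nrm (len e) (f e) + nrm (len e) (g e) by rewrite addr_ge0.
have S : (nnsum (fun e => nrm (len e) (f e) + nrm (len e) (g e))%R < +oo)%E.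
  by rewrite nnsumD// lte_add_pinfty.
by rewrite nnsumZ// lte_mul_pinfty// nnsum_ge0.
Qed.

Lemma L2pred_submod : submod_closed L2pred.
Proof.
split.
  apply/L2predP/L2P; split; first by move=> e; exact: l2_const0.
  by rewrite [nnsum _]esum1// => e _; congr (_%:E); exact: nrm0.
move=> a f g /L2predP/L2P[lf sf] /L2predP/L2P[lg sg]; apply/L2predP/L2P; split.
  by move=> e; exact: l2_lin.
exact: nnsum_nrm_lin.
Qed.

HB.instance Definition _ := GRing.isSubmodClosed.Build R tfun L2pred L2pred_submod.

Definition L2space := {f : tfun | f \in L2pred}.

HB.instance Definition _ := SubChoice.on L2space.
HB.instance Definition _ := [SubChoice_isSubLmodule of L2space by <:].

Implicit Types x y z : L2space.

Lemma L2space_l2 x e : l2 (len e) (val x e).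
Proof. by have /L2predP/L2P[] := valP x. Qed.

Lemma L2space_sum x : (nnsum (fun e => nrm (len e) (val x e)) < +oo)%E.
Proof. by have /L2predP/L2P[] := valP x. Qed.

Definition ip0 x y : R := rsum (fun e => dot (len e) (val x e) (val y e)).

Lemma ip_summ x y : summ (fun e => dot (len e) (val x e) (val y e)).
Proof.
apply: (@le_lt_trans _ _ (nnsum (fun e => (nrm (len e) (val x e) + nrm (len e) (val y e))%R))).
  apply: le_nnsum => e; have := dot_le (L2space_l2 x e) (L2space_l2 y e).
  by have : 0 <= `|dot (len e) (val x e) (val y e)| by []; lra.
by rewrite nnsumD ?lte_add_pinfty ?L2space_sum// => e; exact: nrm_ge0.
Qed.

Lemma ip0C x y : ip0 x y = ip0 y x.
Proof. by congr rsum; apply/funext => e; exact: dotC. Qed.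

Lemma ip0_lin a x y z : ip0 (a *: x + y) z = a * ip0 x z + ip0 y z.
Proof.
rewrite /ip0 -rsum_lin; [|exact: ip_summ|exact: ip_summ].
congr rsum; apply/funext => e.
by rewrite -dot_lin; [|exact: L2space_l2..].
Qed.

Lemma ip0_self x : ip0 x x = fine (nnsum (fun e => nrm (len e) (val x e))).
Proof. by rewrite /ip0 rsum_nonneg// => e; exact: nrm_ge0. Qed.

Lemma ip0_ge0 x : 0 <= ip0 x x.
Proof. by rewrite ip0_self fine_ge0// nnsum_ge0// => e; exact: nrm_ge0. Qed.

Definition ip : psd_form L2space := PsdForm ip0C ip0_lin ip0_ge0.

Lemma sqnormE x : sqnorm (val x : tree_fun T) = (ip x x)%:E.
Proof.
rewrite [ip x x]ip0_self fineK; last first.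
  rewrite ge0_fin_numE ?L2space_sum// nnsum_ge0// => e; exact: nrm_ge0.
by apply: eq_esum => e _; rewrite sqnorm_itvE//; exact: L2space_l2.
Qed.

Definition mul_i_fun f : tfun := fun e t => mul_i (f e t).

Lemma mul_i_fun_L2 f : L2 (f : tree_fun T) -> L2 (mul_i_fun f : tree_fun T).
Proof.
move=> /L2P[lf sf]; apply/L2P; split; first by move=> e; exact: l2_mul_i.
rewrite (_ : (fun e => _) = fun e => nrm (len e) (f e))//.
apply/funext => e; rewrite !nrmE addrC; congr (_ + _); apply: eq_Rintegral => x _.
  by rewrite /impart Im_mul_i.
by rewrite /repart Re_mul_i sqrrN.
Qed.

Lemma imul_subproof x : mul_i_fun (val x) \in L2pred.
Proof. by apply/L2predP/mul_i_fun_L2/L2predP/valP. Qed.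

Definition imul x : L2space := exist _ (mul_i_fun (val x)) (imul_subproof x).

Lemma innerE x y : inner (val x : tree_fun T) (val y) = ip x y +i* ip x (imul y).
Proof.
rewrite /inner /csum; congr (_ +i* _); congr rsum; apply/funext => e.
  by rewrite Re_cintE//; exact: L2space_l2.
by rewrite Im_cintE//; exact: L2space_l2.
Qed.

End L2Space.

(** * Combinatorics of the tree *)

Section Tree.
Variable T : rooted_tree.
Implicit Types (u v w : vertex T) (e : edge T).
Local Notation r := (Defs.root T).
Local Notation d := (Defs.dist r).

Lemma dist_walk u v : walk u v (Defs.dist u v).
Proof. by rewrite /Defs.dist; case: ex_minnP => m /asboolP. Qed.

Lemma dist_le u v n : walk u v n -> (Defs.dist u v <= n)%N.
Proof. by move=> w; rewrite /Defs.dist; case: ex_minnP => m _; apply; apply/asboolP. Qed.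

Lemma dist_root : d r = 0%N.
Proof. by apply/eqP; rewrite -leqn0; apply: dist_le; exists [::]. Qed.

Lemma dist_eq0 v : d v = 0%N -> v = r.
Proof. by move=> v0; have := dist_walk r v; rewrite v0 => -[[|? ?] [_ /= <-]]. Qed.

Lemma dist_parent v n : d v = n.+1 -> exists2 u, adj u v & d u = n.
Proof.
move=> vn; have := dist_walk r v; rewrite vn => -[p [pp lp sp]].
case: (lastP p) pp lp sp => [//|q w].
rewrite rcons_path last_rcons size_rcons => /andP[pq aw] wv [sq].
rewrite wv in aw; exists (last r q) => //; apply/eqP; rewrite eqn_leq.
apply/andP; split; first by apply: dist_le; exists q.
have [q' [pq' lq' sq']] := dist_walk r (last r q).
rewrite -ltnS -vn; apply: dist_le; exists (rcons q' v).
by rewrite rcons_path last_rcons size_rcons pq' lq' sq'.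
Qed.

Lemma path_to_root n u : d u = n -> exists p,
  [/\ path (@adj T) u p, last u p = r & all (fun w => d w <= n)%N (u :: p)].
Proof.
elim: n u => [|n IH] u un.
  by exists [::]; rewrite /= un (dist_eq0 un).
have [w wu wn] := dist_parent un; have [p [pp lp ap]] := IH w wn.
exists (w :: p); split => //=; first by rewrite adj_sym wu.
rewrite un leqnn /=; change (all (fun w => d w <= n.+1)%N (w :: p)).
apply/allP => z /(allP ap) zn.
exact: leq_trans zn (leqnSn n).
Qed.

(** Two such neighbours are joined through the root by a path of vertices closer to the root than v.
    Shortened to a simple path and closed up by v it is a cycle, and cycles have at most two
    vertices. *)
Lemma parent_unique u1 u2 v : adj u1 v -> adj u2 v -> (d u1 < d v)%N ->
  (d u2 < d v)%N -> u1 = u2.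
Proof.
move=> a1 a2 d1 d2.
have [p1 [pp1 lp1 ap1]] := path_to_root (erefl (d u1)).
have [p2 [pp2 lp2 ap2]] := path_to_root (erefl (d u2)).
pose p := p1 ++ rev (belast u2 p2).
have pp : path (@adj T) u1 p.
  rewrite cat_path pp1/= lp1 -lp2 rev_path.
  by rewrite (eq_path (e' := @adj T))// => x y; rewrite adj_sym.
have lp : last u1 p = u2.
  rewrite last_cat lp1; case: (p2) lp2 => [/= <-//|x q _].
  by rewrite /= rev_cons last_rcons.
have ap : all (fun w => d w < d v)%N (u1 :: p).
  apply/allP => w; rewrite inE mem_cat => /or3P[/eqP ->//|wp|].
    by move/allP : ap1 => /(_ w); rewrite inE wp orbT => /(_ isT) /leq_ltn_trans; apply.
  rewrite mem_rev => /mem_belast wp.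
  by move/allP : ap2 => /(_ w wp) /leq_ltn_trans; apply.
case/shortenP: pp lp => p' pp' up' sub lp'.
have vn : v \notin u1 :: p'.
  apply/negP => vp; move/allP : ap => /(_ v).
  suff -> : v \in u1 :: p by move=> /(_ isT); rewrite ltnn.
  by move: vp; rewrite !inE => /orP[->//|/sub ->]; rewrite orbT.
have := @tree_acyclic T [:: v, u1 & p'].
rewrite /= rcons_path adj_sym a1 pp' lp' a2 => /(_ isT).
move: up' => /= up'; rewrite -/(v \notin u1 :: p') vn up' => /(_ isT).
(* The cycle v, u1, p' has size at most 2, so p' is empty and its last vertex u2 is u1. *)
by case: p' lp' {pp' up' sub vn} => //= ->.
Qed.

Lemma edge_adj e : adj (init e) (term e).
Proof. by have /andP[] := valP e. Qed.

Lemma edge_dist e : (d (init e) < d (term e))%N.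
Proof. by have /andP[] := valP e. Qed.

Lemma edge_ext e e' : init e = init e' -> term e = term e' -> e = e'.
Proof.
move=> h1 h2; apply: val_inj; move: h1 h2; rewrite /init /term.
by case: (val e) => a b; case: (val e') => a' b' /= -> ->.
Qed.

Lemma in_edge_unique e e' : term e = term e' -> e = e'.
Proof.
move=> ee'; apply: edge_ext => //; apply: (@parent_unique _ _ (term e)).
- exact: edge_adj.
- by rewrite ee'; exact: edge_adj.
- exact: edge_dist.
- by rewrite ee'; exact: edge_dist.
Qed.

Lemma in_edge_exists v : v != r -> exists e, term e = v.
Proof.
move=> vr; case vn : (d v) => [|n]; first by rewrite (dist_eq0 vn) eqxx in vr.
have [u uv un] := dist_parent vn.
have H : adj u v && (d u < d v)%N by rewrite uv un vn leqnn.
by exists (exist _ (u, v) H).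
Qed.

Lemma finite_out_edges v : finite_set (out_edges v).
Proof.
have [[e0 _]|none] := pselect (exists e, out_edges v e); last first.
  rewrite (_ : out_edges v = set0)// -subset0 => e ve.
  by apply: none; exists e.
have := finite_image (fun w => insubd e0 (v, w)) (tree_locally_finite v).
apply: sub_finite_set => e ve; exists (term e) => /=.
  by rewrite -[v]ve; exact: edge_adj.
rewrite -[v]ve; apply: val_inj; rewrite val_insubd.
have -> : (init e, term e) = val e by rewrite /init /term; case: (val e).
by rewrite (valP e).
Qed.

Lemma in_edgesE e : in_edges (term e) = [set e].
Proof.
by apply/seteqP; split => [e' /in_edge_unique //|_ ->].
Qed.

Lemma finite_in_edges v : finite_set (in_edges v).
Proof.
have [[e ve]|none] := pselect (exists e, in_edges v e); last first.
  rewrite (_ : in_edges v = set0)// -subset0 => e ve.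
  by apply: none; exists e.
by rewrite -[v]ve in_edgesE; exact: finite_set1.
Qed.

Definition nin v := #|` fset_set (in_edges v)|.
Definition nout v := #|` fset_set (out_edges v)|.

Lemma nin_le1 v : (nin v <= 1)%N.
Proof.
rewrite /nin; have [[e ve]|none] := pselect (exists e, in_edges v e); last first.
  rewrite (_ : in_edges v = set0) ?fset_set0 ?cardfs0// -subset0 => e ve.
  by apply: none; exists e.
by rewrite -[v]ve in_edgesE fset_set1 cardfs1.
Qed.

Lemma nin_gt0 v : v != r -> (0 < nin v)%N.
Proof.
move=> /in_edge_exists[e <-]; by rewrite /nin in_edgesE fset_set1 cardfs1.
Qed.

Lemma nin_root : nin r = 0%N.
Proof.
rewrite /nin (_ : in_edges r = set0) ?fset_set0 ?cardfs0// -subset0 => e er.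
by have := edge_dist e; rewrite [term e]er dist_root.
Qed.

Lemma degE v : deg v = (nin v + nout v)%N.
Proof.
have fo := finite_out_edges v; have fi := finite_in_edges v.
rewrite /deg /edges_at fset_setU// cardfsU.
rewrite (_ : _ `&` _ = fset0)%fset ?cardfs0 ?subn0 1?addnC//.
apply/fsetP => e; rewrite !inE !in_fset_set//.
apply/negbTE/negP => /andP[]; rewrite !inE => ie te.
by have := edge_dist e; rewrite [init e]ie [term e]te ltnn.
Qed.

Lemma exists_nonroot : exists v, v != r.
Proof.
apply: contrapT => none; apply: (@tree_infinite T).
apply: (@sub_finite_set _ _ [set r]); last exact: finite_set1.
move=> v _ /=; apply: contrapT => vr; apply: none; exists v; exact/eqP.
Qed.

Lemma nout_root_gt0 : (0 < nout r)%N.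
Proof.
have [v vr] := exists_nonroot.
have [e er] : exists e : edge T, init e = r.
  case vn : (d v) => [|n]; first by rewrite (dist_eq0 vn) eqxx in vr.
  elim: n v vn {vr} => [|n IH] v vn; have [u uv un] := dist_parent vn.
    have H : adj u v && (d u < d v)%N by rewrite uv un vn.
    by exists (exist _ (u, v) H); exact: dist_eq0.
  exact: IH un.
rewrite /nout cardfs_gt0; apply/fset0Pn; exists e.
by rewrite in_fset_set ?inE//; exact: finite_out_edges.
Qed.

Lemma edges_infinite : infinite_set [set: edge T].
Proof.
move=> fe; apply: (@tree_infinite T).
apply: (@sub_finite_set _ _ ([set r] `|` (@term T) @` [set: edge T])).
  move=> v _; have [->|/in_edge_exists[e ev]] := eqVneq v r; first by left.
  by right; exists e.
by rewrite finite_setU; split; [exact: finite_set1|exact: finite_image].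
Qed.

Section NoLeaf.
Hypothesis deg_neq2 : forall v : vertex T, deg v <> 2%N.
Hypothesis no_loose_ends : forall v : vertex T, deg v <> 1%N.

(** The root has no incoming edge and positive degree, every other vertex has exactly one incoming
    edge; excluding degrees 1 and 2 leaves at least two outgoing edges. *)
Lemma nout_ge2 v : (2 <= nout v)%N.
Proof.
have := @no_loose_ends v; have := @deg_neq2 v; rewrite degE.
have [->|vr] := eqVneq v r.
  by rewrite nin_root add0n; have := nout_root_gt0; case: (nout r) => [|[|[|]]].
have := nin_gt0 vr; have := nin_le1 v.
by case: (nin v) => [|[|]]//; case: (nout v) => [|[|]].
Qed.

End NoLeaf.
End Tree.

Section Curvature.
Variables (R : realType) (T : metric_tree R).
Hypothesis deg_neq2 : forall v : vertex T, deg v <> 2%N.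
Hypothesis no_loose_ends : forall v : vertex T, deg v <> 1%N.

(** This is 1 - [Kcomb], the value of the linear weight at the initial end of an outgoing edge. *)
Definition inratio (v : vertex T) : R := (nin v)%:R / (nout v)%:R.

Lemma inratio_bound v : 0 <= inratio v <= 2^-1.
Proof.
have h := nout_ge2 deg_neq2 no_loose_ends v.
have n0 : 0 < (nout v)%:R :> R by rewrite ltr0n (leq_trans _ h).
rewrite /inratio divr_ge0//= ler_pdivrMr//.
apply: (@le_trans _ _ 1); first by rewrite (ler_nat _ _ 1) nin_le1.
by rewrite mulrC ler_pdivlMr// mul1r ler_nat.
Qed.

Lemma KcombE (v : vertex T) : @Kcomb R T v = 1 - inratio v.
Proof. by []. Qed.

Lemma Kcomb_bound (v : vertex T) : 2^-1 <= @Kcomb R T v <= 1.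
Proof. by rewrite KcombE; have /andP[h1 h2] := inratio_bound v; apply/andP; lra. Qed.

End Curvature.

(** * The domain of the minimal operator *)

Section H2Interval.
Variable R : realType.
Notation mu := (@lebesgue_measure R).
Local Notation TR := (measurableTypeR R).
Local Notation C := (Rcomplex R).
Implicit Types (f g h df dg : R -> C) (l : R).

Definition H2_data l f df d2 :=
  [/\ l2 l d2, primitive l (repart df) (repart d2) /\
    primitive l (impart df) (impart d2) &
    primitive l (repart f) (repart df) /\ primitive l (impart f) (impart df)].

Lemma complex_primitiveP l f df :
  (forall x : R, 0 <= x <= l -> (f x : R[i]) = f 0 + cint 0 x (df : R -> R[i])) <->
  primitive l (repart f) (repart df) /\ primitive l (impart f) (impart df).
Proof.
split=> [H|[hr hi] x xl].
  by split=> x xl; rewrite /repart /impart (H x xl) ?ReD ?ImD.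
apply/eqP; rewrite eq_complex; apply/andP; split; apply/eqP.
  by rewrite ReD; exact: hr.
by rewrite ImD; exact: hi.
Qed.

Lemma H2P l f df : H2 l (f : R -> R[i]) df <-> exists d2, H2_data l f df d2.
Proof.
split=> [[d2 [m2 n2 h1 h2]]|[d2 [l2d h1 h2]]]; exists d2.
  by split; [exact/l2P|exact/complex_primitiveP|exact/complex_primitiveP].
have [m2 n2] := (l2P l d2).2 l2d.
by split => //; exact/complex_primitiveP.
Qed.

Lemma primitive_lin l (a : R) p w q v : mu.-integrable `[0, l] (EFin \o w) ->
  mu.-integrable `[0, l] (EFin \o v) -> primitive l p w -> primitive l q v ->
  primitive l (fun x => a * p x + q x) (fun x => a * w x + v x).
Proof.
move=> iw iv pw qv x /[dup] xl /andP[x0 xle].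
have sub := itv_sub (lexx 0) xle.
have mI : measurable (`[0, x]%classic : set TR) by exact: measurable_itv.
have iwx : mu.-integrable `[0, x] (EFin \o w) by exact: integrableS iw.
have ivx : mu.-integrable `[0, x] (EFin \o v) by exact: integrableS iv.
by rewrite Rintegral_lin// (pw x xl) (qv x xl); ring.
Qed.

Lemma H2_data_l2 l f df d2 : H2_data l f df d2 -> l2 l f /\ l2 l df.
Proof.
move=> [[sr si] [dr di] [fr fi]].
have hr := primitive_sqint sr dr; have hi := primitive_sqint si di.
by split; split=> //; [exact: primitive_sqint hr fr|exact: primitive_sqint hi fi].
Qed.

Lemma H2_data_lin l (a : R) f df d2 g dg e2 : H2_data l f df d2 ->
  H2_data l g dg e2 ->
  H2_data l (fun x => a *: f x + g x) (fun x => a *: df x + dg x)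
    (fun x => a *: d2 x + e2 x).
Proof.
move=> hf hg; have [_ [dfr dfi]] := H2_data_l2 hf.
have [_ [dgr dgi]] := H2_data_l2 hg.
case: hf hg => [[sr si] [dr di] [fr fi]] [[sr' si'] [dr' di'] [fr' fi']].
have re (u v : R -> C) :
    repart (fun x => a *: u x + v x) = fun x => a * repart u x + repart v x.
  by apply/funext => x; rewrite /repart ReD ReZ.
have im (u v : R -> C) :
    impart (fun x => a *: u x + v x) = fun x => a * impart u x + impart v x.
  by apply/funext => x; rewrite /impart ImD ImZ.
split; first exact: l2_lin.
- by rewrite !re !im; split; apply: primitive_lin => //; exact: sqint_integrable.
- by rewrite !re !im; split; apply: primitive_lin => //; exact: sqint_integrable.
Qed.

Lemma H2_data_mul_i l f df d2 : H2_data l f df d2 ->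
  H2_data l (fun x => mul_i (f x)) (fun x => mul_i (df x)) (fun x => mul_i (d2 x)).
Proof.
move=> h; have [_ [dfr dfi]] := H2_data_l2 h.
case: h => [s [dr di] [fr fi]].
have re (u : R -> C) : repart (fun x => mul_i (u x)) = fun x => -1 * impart u x + cst 0 x.
  by apply/funext => x; rewrite /repart Re_mul_i addr0 mulN1r.
have im (u : R -> C) : impart (fun x => mul_i (u x)) = repart u.
  by apply/funext => x; rewrite /impart Im_mul_i.
have z : primitive l (cst (0:R)) (cst 0).
  by move=> x _; rewrite /= /Rintegral integral0 addr0.
have iz : mu.-integrable `[0, l] (EFin \o (cst (0:R) : R -> R)).
  exact: sqint_integrable (sqint_cst _ _ _).
split; first exact: l2_mul_i.
- rewrite !re !im; split => //; apply: primitive_lin => //.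
  by apply: sqint_integrable; case: s.
- by rewrite !re !im; split => //; apply: primitive_lin => //; exact: sqint_integrable.
Qed.

(** The zero function is as small as desired, so its derivative w is weakly null; testing w against
    itself gives norm 0. *)
Lemma primitive_null l p w d : 0 < l -> sqint `[0, l] d -> primitive l w d ->
  primitive l p w -> (forall x, 0 <= x <= l -> p x = 0) ->
  \int[mu]_(x in `[0, l]) (w x ^+ 2) = 0.
Proof.
move=> l0 sd wd pw p0; have sw := primitive_sqint sd wd.
have w0 : 0 <= \int[mu]_(x in `[0, l]) (w x ^+ 2).
  by apply: Rintegral_ge0 => x _; exact: sqr_ge0.
apply/eqP; rewrite eq_le w0 andbT; apply: (@le0_small _ _ 1) => // e e0.
have [del del0 H] := primitive_weak_null l0 e0 w0 sd wd.
rewrite mul1r; apply: le_trans (ler_norm _) _.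
by apply: (H p w) => // t tl; rewrite (p0 t tl) normr0 ltW.
Qed.

Lemma H2_data_null l f df d2 : 0 < l -> H2_data l f df d2 ->
  (forall x, 0 <= x <= l -> f x = 0) -> nrm l f = 0 /\ nrm l df = 0.
Proof.
move=> l0 [[sr si] [dr di] [fr fi]] f0; split.
  have z (u : R -> R) : (forall x, 0 <= x <= l -> u x = 0) ->
      \int[mu]_(x in `[0, l]) (u x ^+ 2) = 0.
    move=> u0; transitivity (\int[mu]_(x in `[0, l]) (cst (0:R) x)).
      by apply: eq_Rintegral => x; rewrite inE/= in_itv/= => /u0 ->; rewrite expr0n.
    by rewrite /= /Rintegral integral0.
  by rewrite nrmE !z ?addr0// => x xl; rewrite /repart /impart f0.
rewrite nrmE (primitive_null l0 sr dr fr) ?(primitive_null l0 si di fi) ?addr0//.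
  by move=> x xl; rewrite /impart f0.
by move=> x xl; rewrite /repart f0.
Qed.

(** A large [th] makes the coefficient of the derivative small. Closability needs this trade-off,
    since there the functions tend to 0 while the derivatives are merely bounded. *)
Lemma primitive_sup_interp l p w th x : 0 < th -> {within `[0, l], continuous w} ->
  primitive l p w -> 0 <= x <= l ->
  l * p x ^+ 2 <= (1 + th * l) * \int[mu]_(t in `[0, l]) (p t ^+ 2) +
                  th^-1 * l * \int[mu]_(t in `[0, l]) (w t ^+ 2).
Proof.
move=> th0 cw pw xl; have l0 : 0 <= l by case/andP: xl => /le_trans; apply.
have sw := within_sqint cw; have sp := primitive_sqint sw pw.
set P := \int[mu]_(t in `[0, l]) (p t ^+ 2).
set W := \int[mu]_(t in `[0, l]) (w t ^+ 2).
have osc y z : 0 <= y -> y <= z -> z <= l -> `|p z ^+ 2 - p y ^+ 2| <= th * P + th^-1 * W.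
  move=> y0 yz zl; rewrite (primitive_sqB y0 yz zl cw pw).
  apply: le_trans (sqint_am_gm th0 (sqint_sub y0 zl sp) (sqint_sub y0 zl sw)) _.
  have thw := ltW th0.
  by apply: lerD; apply: ler_wpM2l; rewrite ?invr_ge0//; exact: Rintegral_sq_mono.
have key t : 0 <= t <= l -> p x ^+ 2 <= 1 * p t ^+ 2 + (th * P + th^-1 * W).
  case/andP: xl => x0 xl /andP[t0 tl]; rewrite mul1r -lerBlDl.
  have [xt|/ltW tx] := leP x t.
    by apply: le_trans (osc x t x0 xt tl); rewrite distrC ler_norm.
  by apply: le_trans (osc t x t0 tx xl); rewrite ler_norm.
have := Rintegral_avg_ge l0 sp.2 key; rewrite -/P subr0; lra.
Qed.

End H2Interval.

Section Core.
Variables (R : realType) (T : metric_tree R).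
Local Notation C := (Rcomplex R).
Local Notation tfun := (tfun T).
Implicit Types f g : tfun.

(** The derivative travels with the function: off the edges it is not determined by it, and as a
    second component it makes [core_der] linear by construction. *)
Definition tfun_pair := (tfun * tfun)%type.
HB.instance Definition _ := GRing.Lmodule.on tfun_pair.

Definition core_pred : {pred tfun_pair} :=
  fun p => `[< dom_H0 (p.1 : tree_fun T) (p.2 : tree_fun T) >].

Lemma edges_at_finite (v : vertex T) : finite_set (edges_at v).
Proof. by rewrite finite_setU; split; [exact: finite_out_edges|exact: finite_in_edges]. Qed.

Lemma value_at_lin (a : R) f g e v :
  value_at (a *: f + g : tree_fun T) e v =
  (a *: (value_at (f : tree_fun T) e v : C) + value_at (g : tree_fun T) e v).
Proof. by rewrite /value_at; case: ifP. Qed.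

Lemma inward_deriv_lin (a : R) f g e v :
  inward_deriv (a *: f + g : tree_fun T) e v =
  (a *: (inward_deriv (f : tree_fun T) e v : C) + inward_deriv (g : tree_fun T) e v).
Proof.
rewrite /inward_deriv; case: ifP => // _.
rewrite tfun_linE; case: (f e _) => a1 a2; case: (g e _) => b1 b2.
by congr (_ +i* _) => /=; ring.
Qed.

Lemma core_submod : submod_closed core_pred.
Proof.
split.
  apply/asboolP; split => /=.
  - move=> e; apply/H2P; exists (fun=> 0).
    have z : primitive (len e) (fun=> 0 : R) (fun=> 0).
      by move=> x _; rewrite /Rintegral integral0 addr0.
    by split; [exact: l2_const0|split|split].
  - rewrite (_ : [set e | _] = set0); first exact: finite_set0.
    by rewrite -subset0 => e [x [_ /eqP]].
  - by move=> v e e' _ _; rewrite /value_at; do 2 case: ifP.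
  - move=> v; rewrite fsbig1// => e _; rewrite /inward_deriv.
    by case: ifP => // _; rewrite oppr0.
move=> a [f df] [g dg] /asboolP[/= h1 h2 h3 h4] /asboolP[/= k1 k2 k3 k4].
apply/asboolP; split => /=.
- move=> e; have /H2P[d2 hf] := h1 e; have /H2P[e2 hg] := k1 e.
  by apply/H2P; eexists; exact: (H2_data_lin a hf hg).
- apply: (@sub_finite_set _ _ ([set e | exists x : R, 0 <= x <= len e /\ (f e x : R[i]) != 0] `|`
     [set e | exists x : R, 0 <= x <= len e /\ (g e x : R[i]) != 0])).
    move=> e [x [xl fgx]]; apply: contrapT => /not_orP[nf ng].
    have f0 : f e x = 0.
      by apply: contrapT => /eqP fx; apply: nf; exists x.
    have g0 : g e x = 0.
      by apply: contrapT => /eqP gx; apply: ng; exists x.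
    by move/negP: fgx; apply; rewrite tfun_linE f0 g0 scaler0 addr0.
  by rewrite finite_setU.
- move=> v e e' ve ve'; rewrite !value_at_lin.
  by rewrite (h3 v e e')// (k3 v e e').
- move=> v; have fv := edges_at_finite v.
  have := h4 v; have := k4 v; rewrite !fsbig_finite//= => kv hv.
  under eq_bigr do rewrite inward_deriv_lin.
  have -> : \sum_(e <- fset_set (edges_at v))
      ((a *: (inward_deriv (df : tree_fun T) e v : C) +
       inward_deriv (dg : tree_fun T) e v) : C) = 0 :> C.
    rewrite big_split -scaler_sumr/=.
    by rewrite [X in a *: X](_ : _ = 0) ?scaler0 ?add0r.
  by [].
Qed.

HB.instance Definition _ := GRing.isSubmodClosed.Build R tfun_pair
  core_pred core_submod.

Definition core := {p : tfun_pair | p \in core_pred}.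

HB.instance Definition _ := SubChoice.on core.
HB.instance Definition _ := [SubChoice_isSubLmodule of core by <:].

Lemma coreP (c : core) : dom_H0 ((val c).1 : tree_fun T) (val c).2.
Proof. exact/asboolP/(valP c). Qed.

Lemma core_H2 (c : core) e :
  exists d2, H2_data (len e) ((val c).1 e) ((val c).2 e) d2.
Proof. by have [h _ _ _] := coreP c; apply/H2P; exact: h. Qed.

Definition core_supp (c : core) : {fset edge T} :=
  fset_set [set e | exists x : R, 0 <= x <= len e /\ ((val c).1 e x : R[i]) != 0].

Lemma core_suppP (c : core) e x : 0 <= x <= len e -> e \notin core_supp c ->
  (val c).1 e x = 0.
Proof.
have [_ fc _ _] := coreP c.
move=> xl; rewrite in_fset_set// notin_setE => /= H; apply: contrapT => /eqP cx.
by apply: H; exists x.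
Qed.

Lemma core_supp_nrm (c : core) e : e \notin core_supp c ->
  nrm (len e) ((val c).1 e) = 0 /\ nrm (len e) ((val c).2 e) = 0.
Proof.
move=> es; have [d2 h] := core_H2 c e.
by apply: (H2_data_null (len_gt0 e) h) => x xl; exact: core_suppP.
Qed.

Lemma core_L2 (c : core) : (val c).1 \in @L2pred R T /\ (val c).2 \in @L2pred R T.
Proof.
split; apply/L2predP/L2P; split.
- by move=> e; have [d2 /H2_data_l2[]] := core_H2 c e.
- rewrite (nnsum_finsupp (A := core_supp c)) ?ltry// => e; first exact: nrm_ge0.
  by move=> /core_supp_nrm[].
- by move=> e; have [d2 /H2_data_l2[]] := core_H2 c e.
- rewrite (nnsum_finsupp (A := core_supp c)) ?ltry// => e; first exact: nrm_ge0.
  by move=> /core_supp_nrm[].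
Qed.

Definition core_fun (c : core) : L2space T := exist _ (val c).1 (core_L2 c).1.
Definition core_der (c : core) : L2space T := exist _ (val c).2 (core_L2 c).2.

Lemma core_fun_linear : linear core_fun.
Proof. by move=> a c c'; apply: val_inj. Qed.
Lemma core_der_linear : linear core_der.
Proof. by move=> a c c'; apply: val_inj. Qed.

HB.instance Definition _ := GRing.isLinear.Build R core (L2space T) _ core_fun
  core_fun_linear.
HB.instance Definition _ := GRing.isLinear.Build R core (L2space T) _ core_der
  core_der_linear.

Lemma nrm_le_ip (x : L2space T) e : nrm (len e) (val x e) <= ip T x x.
Proof.
have n0 e' : 0 <= nrm (len e') (val x e') by exact: nrm_ge0.
rewrite [ip T x x]ip0_self -lee_fin fineK; last first.
  by rewrite ge0_fin_numE ?L2space_sum// nnsum_ge0.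
by have := fsum_le_nnsum (fun e => nrm (len e) (val x e)) [fset e]%fset;
  rewrite big_seq_fset1.
Qed.

(** Off the support of the second argument its function and its derivative have norm 0 on the edge,
    so the sum over all edges is a finite one. *)
Lemma ip_core (c c' : core) (A : {fset edge T}) : (core_supp c' `<=` A)%fset ->
  ip T (core_fun c) (core_fun c') =
    \sum_(e <- A) dot (len e) ((val c).1 e) ((val c').1 e) /\
  ip T (core_der c) (core_der c') =
    \sum_(e <- A) dot (len e) ((val c).2 e) ((val c').2 e).
Proof.
move=> sA.
have z (x y : L2space T) e : nrm (len e) (val y e) = 0 ->
    dot (len e) (val x e) (val y e) = 0.
  move=> y0; have lx := L2space_l2 x e; have ly := L2space_l2 y e.
  have := discriminant_le (a := nrm (len e) (val x e))
    (b := dot (len e) (val x e) (val y e)) (lexx 0).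
  rewrite mulr0 => H; apply/eqP; rewrite -sqrf_eq0 eq_le sqr_ge0 andbT; apply: H.
  move=> t; have := nrm_lin t ly lx; rewrite y0 (dotC _ _ (val x e)) => h.
  by have := nrm_ge0 (len e) (fun s => t *: val y e s + val x e s); rewrite h; lra.
have nA e : e \notin A -> e \notin core_supp c'.
  by apply: contra; move/fsubsetP : sA; apply.
split; apply: rsum_finsupp => e /nA /core_supp_nrm[h1 h2].
  exact: (z (core_fun c) (core_fun c')).
exact: (z (core_der c) (core_der c')).
Qed.

Lemma core_parts (c : core) e : exists d2 : R -> C,
  [/\ sqint `[0, len e] (repart d2), sqint `[0, len e] (impart d2),
   primitive (len e) (repart ((val c).2 e)) (repart d2) /\
   primitive (len e) (impart ((val c).2 e)) (impart d2) &
   primitive (len e) (repart ((val c).1 e)) (repart ((val c).2 e)) /\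
   primitive (len e) (impart ((val c).1 e)) (impart ((val c).2 e))].
Proof. by have [d2 [[? ?] ? ?]] := core_H2 c e; exists d2. Qed.

End Core.

Section UniformLimit.
Variable R : realType.
Implicit Types (u : nat -> R -> R) (l : R).

Definition unif_cauchy l u := forall e : R, 0 < e -> exists N, forall m n x,
  (N <= m)%N -> (N <= n)%N -> 0 <= x <= l -> `|u m x - u n x| <= e.

Lemma unif_cauchy_cvg l u x : unif_cauchy l u -> 0 <= x <= l ->
  cvgn (fun n => u n x).
Proof.
move=> uC xl; apply: cauchy_cvg; apply: cauchy_exP => e e0.
have [N NP] := uC (e / 2) ltac:(by rewrite divr_gt0).
exists (u N x); exists N => // n /= Nn; rewrite /ball/=.
apply: (@le_lt_trans _ _ (e / 2)); last by rewrite ltr_pdivrMr// ltr_pMr// ltr1n.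
exact: NP.
Qed.

Lemma unif_cauchy_lim l u e : unif_cauchy l u -> 0 < e ->
  exists N, forall n x, (N <= n)%N -> 0 <= x <= l ->
    `|limn (fun n => u n x) - u n x| <= e.
Proof.
move=> uC e0; have [N NP] := uC e e0; exists N => n x Nn xl.
have cx := unif_cauchy_cvg uC xl.
have c2 : (fun m => `|u m x - u n x|) @ \oo --> `|limn (fun n => u n x) - u n x|.
  by apply: cvg_norm; apply: cvgB => //; exact: cvg_cst.
rewrite -(cvg_lim (@Rhausdorff R) c2).
apply: limr_le; first exact: cvgP c2.
by exists N => // m /= Nm; exact: NP.
Qed.

Lemma unif_cauchy_measurable l u : unif_cauchy l u ->
  (forall n, measurable_fun (`[0, l] : set (measurableTypeR R)) (u n : measurableTypeR R -> R)) ->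
  measurable_fun (`[0, l] : set (measurableTypeR R))
    ((fun x => limn (fun n => u n x)) : measurableTypeR R -> R).
Proof.
move=> uC mu_; apply: (measurable_fun_cvg mu_) => x /=; rewrite in_itv/= => xl.
exact: unif_cauchy_cvg uC xl.
Qed.

End UniformLimit.

(** * Closability of the form and completeness of the core *)

Section CoreClosed.
Variables (R : realType) (T : metric_tree R).
Notation mu := (@lebesgue_measure R).
Local Notation C := (Rcomplex R).
Local Notation core := (core T).
Local Notation ip := (ip T).
Local Notation j := (@core_fun R T).
Local Notation d := (@core_der R T).

(** One Boolean selects the real or imaginary part, so that each real estimate is applied once for
    both. *)
Definition parts (b : bool) : (R -> C) -> R -> R := if b then @repart R else @impart R.

Lemma parts_sub b (f g : R -> C) x :
  parts b (fun x => f x - g x) x = parts b f x - parts b g x.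
Proof. by case: b; rewrite /parts /repart /impart ?ReD ?ImD ?ReN ?ImN. Qed.

Lemma parts_nrm_le b l (f : R -> C) :
  \int[mu]_(x in `[0, l]) (parts b f x ^+ 2) <= nrm l f.
Proof.
by rewrite nrmE; case: b; [rewrite lerDl|rewrite lerDr];
  apply: Rintegral_ge0 => x _; exact: sqr_ge0.
Qed.

Lemma core_parts_b (c : core) e b : exists d2 : R -> R,
  [/\ sqint `[0, len e] d2, primitive (len e) (parts b ((val c).2 e)) d2,
    primitive (len e) (parts b ((val c).1 e)) (parts b ((val c).2 e)) &
    {within `[0, len e], continuous (parts b ((val c).2 e))} ].
Proof.
have [d2 [sr si [dr di] [fr fi]]] := core_parts c e.
by case: b; [exists (repart d2)|exists (impart d2)]; split => //;
  [exact: primitive_within dr|exact: primitive_within di].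
Qed.

Lemma L2_val_sub (x y : L2space T) e t : val (x - y) e t = val x e t - val y e t.
Proof. by []. Qed.

(** On each edge the functions tend to 0 uniformly and the derivatives stay bounded, hence the
    derivatives are weakly null against each fixed [d (cs m)], which has finite support and an L^2
    derivative. A Cauchy sequence that is weakly null in this sense tends to 0 in norm. *)
Lemma core_closable cs : form_lim ip (fun n => j (cs n)) 0 ->
  form_cauchy ip (fun n => d (cs n)) -> form_lim ip (fun n => d (cs n)) 0.
Proof.
move=> j0 dC; have [N0 [K K0 KP]] := form_cauchy_bounded dC.
have unif e b (del : R) : 0 < del -> exists N, forall n t, (N <= n)%N ->
    0 <= t <= len e -> `|parts b ((val (cs n)).1 e) t| <= del.
  move=> del0; have l0 := len_gt0 e; set l := len e in l0 *.
  have dl : 0 < del ^+ 2 * l by rewrite mulr_gt0// exprn_gt0.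
  (* With this value the derivative term th^-1 l K is exactly half of l del^2; smallness of the
     functions supplies the other half. *)
  pose th := 2 * K / del ^+ 2.
  have th0 : 0 < th by rewrite divr_gt0 ?mulr_gt0 ?exprn_gt0.
  have thl : 0 < 1 + th * l by rewrite addr_gt0// mulr_gt0.
  have [N NP] := j0 (del ^+ 2 * l / (2 * (1 + th * l))) ltac:(by
    rewrite divr_gt0// mulr_gt0).
  exists (maxn N N0) => n t; rewrite geq_max => /andP[/NP h1 /KP h2] tl.
  rewrite subr0 in h1; apply: sq_le_abs_ge0; first exact: ltW.
  have [d2 [sd dd pp cw]] := core_parts_b (cs n) e b.
  have := primitive_sup_interp th0 cw pp tl; rewrite -/l.
  have := le_trans (parts_nrm_le b l _) (nrm_le_ip (j (cs n)) e).
  have := le_trans (parts_nrm_le b l _) (nrm_le_ip (d (cs n)) e).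
  rewrite /=; move=> k1 k2 k3.
  have {}k1 := le_trans k1 h2; have {}k2 := le_trans k2 h1.
  rewrite -(ler_pM2l l0); apply: le_trans k3 _.
  have -> : l * del ^+ 2 = (1 + th * l) * (del ^+ 2 * l / (2 * (1 + th * l))) +
      th^-1 * l * K.
    have -> : th^-1 * l * K = del ^+ 2 * l / 2.
      by rewrite /th; field; rewrite !gt_eqF.
    by move: thl; set q := 1 + _ => q0; field; rewrite gt_eqF.
  apply: lerD; apply: ler_wpM2l => //; first exact: ltW.
  by apply: mulr_ge0; rewrite ?invr_ge0; exact: ltW.
have dotlim e m (eps : R) : 0 < eps -> exists N, forall n, (N <= n)%N ->
    `|dot (len e) ((val (cs n)).2 e) ((val (cs m)).2 e)| <= eps.
  move=> eps0; have e2 : 0 < eps / 2 by rewrite divr_gt0.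
  have part b : exists N, forall n, (N <= n)%N ->
      `|\int[mu]_(x in `[0, len e]) (parts b ((val (cs n)).2 e) x *
          parts b ((val (cs m)).2 e) x)| <= eps / 2.
    have [d2 [sd dd pp _]] := core_parts_b (cs m) e b.
    have [del del0 H] := primitive_weak_null (len_gt0 e) e2 (ltW K0) sd dd.
    have [N NP] := unif e b _ del0.
    exists (maxn N N0) => n; rewrite geq_max => /andP[Nn N0n].
    have [d2' [sd' dd' pp' _]] := core_parts_b (cs n) e b.
    apply: (H (parts b ((val (cs n)).1 e))) => //.
    - exact: primitive_sqint sd' dd'.
    - apply: le_trans (parts_nrm_le _ _ _) _.
      by apply: le_trans (nrm_le_ip (d (cs n)) e) _; exact: KP.
    - by move=> t tl; exact: NP.
  have [N1 N1P] := part true; have [N2 N2P] := part false.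
  exists (maxn N1 N2) => n; rewrite geq_max => /andP[/N1P h1 /N2P h2].
  apply: le_trans (ler_normD _ _) _; rewrite [leRHS](splitr eps).
  exact: lerD.
have iplim m (eps : R) : 0 < eps -> exists N, forall n, (N <= n)%N ->
    `|ip (d (cs n)) (d (cs m))| <= eps.
  move=> eps0; pose A := core_supp (cs m).
  have key (s : seq (edge T)) (eps' : R) : 0 < eps' ->
      exists N, forall n, (N <= n)%N ->
        `|\sum_(e <- s) dot (len e) ((val (cs n)).2 e) ((val (cs m)).2 e)| <= eps'.
    elim: s eps' => [|e s IH] eps' e'0.
      by exists 0 => n _; rewrite big_nil normr0 ltW.
    have e2 : 0 < eps' / 2 by rewrite divr_gt0.
    have [N1 N1P] := dotlim e m _ e2; have [N2 N2P] := IH _ e2.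
    exists (maxn N1 N2) => n; rewrite geq_max => /andP[/N1P h1 /N2P h2].
    rewrite big_cons; apply: le_trans (ler_normD _ _) _.
    by rewrite [leRHS](splitr eps'); exact: lerD.
  have [N NP] := key A _ eps0.
  exists N => n /NP; have [_ ->//] := ip_core (cs n) (fsubset_refl (core_supp (cs m))).
move=> eps eps0; have e4 : 0 < eps / 4 by rewrite divr_gt0.
have [M MP] := dC _ e4; have [N NP] := iplim M _ e4.
exists (maxn M N) => n; rewrite geq_max => /andP[Mn /NP h1]; rewrite subr0.
have h2 := MP n M Mn (leqnn M).
have h3 := sqformB ip (d (cs n)) (d (cs M)).
have h4 := form_ge0 ip (d (cs M)).
have h5 := ler_norm (ip (d (cs n)) (d (cs M))).
move: h1 h2 h3 h4 h5; lra.
Qed.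

(** The form norm bounds the supremum on each edge, so the functions converge uniformly edge by
    edge. Global L^2 convergence follows from estimates over finite sets of edges that do not depend
    on the set. *)
Lemma core_complete cs : form_cauchy ip (fun n => j (cs n)) ->
  form_cauchy ip (fun n => d (cs n)) -> exists x, form_lim ip (fun n => j (cs n)) x.
Proof.
move=> jC dC.
have subl2 m n e : l2 (len e) (fun t => (val (cs m)).1 e t - (val (cs n)).1 e t).
  exact: (L2space_l2 (j (cs m) - j (cs n)) e).
have uC b e : unif_cauchy (len e) (fun n => parts b ((val (cs n)).1 e)).
  move=> eps eps0; set l := len e; have l0 : 0 < l := len_gt0 e.
  pose eta := eps ^+ 2 * l / (2 + 2 * l ^+ 2).
  have D0 : 0 < 2 + 2 * l ^+ 2 by rewrite addr_gt0// mulr_gt0// exprn_gt0.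
  have eta0 : 0 < eta by rewrite divr_gt0// mulr_gt0// exprn_gt0.
  have [N1 N1P] := jC _ eta0; have [N2 N2P] := dC _ eta0.
  exists (maxn N1 N2) => m n t; rewrite !geq_max => /andP[m1 m2] /andP[n1 n2] tl.
  apply: sq_le_abs_ge0; first exact: ltW.
  have [d2 [sd dd pp cw]] := core_parts_b (cs m - cs n) e b.
  have := primitive_sup (primitive_sqint sd dd) pp tl; rewrite -/l.
  have k1 := le_trans (parts_nrm_le b l _) (nrm_le_ip (j (cs m - cs n)) e).
  have k2 := le_trans (parts_nrm_le b l _) (nrm_le_ip (d (cs m - cs n)) e).
  rewrite linearB in k1; rewrite linearB in k2.
  have {}k1 := le_trans k1 (N1P _ _ m1 n1).
  have {}k2 := le_trans k2 (N2P _ _ m2 n2).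
  move=> k3; rewrite -parts_sub -(ler_pM2l l0); apply: le_trans k3 _.
  have -> : l * eps ^+ 2 = 2 * eta + 2 * l ^+ 2 * eta.
    by rewrite -mulrDl [RHS]mulrC /eta divfK ?gt_eqF// mulrC.
  by apply: lerD; rewrite ler_wpM2l// mulr_ge0// sqr_ge0.
pose F (e : edge T) (t : R) : C :=
  (limn (fun n => parts true ((val (cs n)).1 e) t)) +i*
  (limn (fun n => parts false ((val (cs n)).1 e) t)).
have partF b e t : parts b (F e) t = limn (fun n => parts b ((val (cs n)).1 e) t).
  by case: b.
have sqF b e n : sqint `[0, len e] (fun t => parts b (F e) t - parts b ((val (cs n)).1 e) t).
  have mI : measurable (`[0, len e]%classic : set (measurableTypeR R)).
    exact: measurable_itv.
  have mp k : measurable_fun (`[0, len e] : set (measurableTypeR R))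
      (parts b ((val (cs k)).1 e) : measurableTypeR R -> R).
    by have [sr si] := L2space_l2 (j (cs k)) e; case: (b); [case: sr|case: si].
  have mF : measurable_fun (`[0, len e] : set (measurableTypeR R))
      ((fun t => parts b (F e) t - parts b ((val (cs n)).1 e) t) : measurableTypeR R -> R).
    apply: measurable_funB => //.
    have := unif_cauchy_measurable (uC b e) mp; congr measurable_fun.
    by apply/funext => t; rewrite partF.
  split => //.
  have [N NP] := unif_cauchy_lim (uC b e) ltr01.
  have sN : sqint `[0, len e] (fun t => parts b ((val (cs N)).1 e) t -
       parts b ((val (cs n)).1 e) t).
    have [sr si] := subl2 N n e; case: (b); [move: sr|move: si];
    by congr sqint; apply/funext => t; rewrite /parts /repart /impart ?ReD ?ImD ?ReN ?ImN.
  apply: (@le_integrable _ _ _ mu _ mI _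
    (EFin \o (fun t => 2 * (parts b ((val (cs N)).1 e) t -
       parts b ((val (cs n)).1 e) t) ^+ 2 + cst 2 t))).
  - by apply/measurable_EFinP; exact: measurable_funX.
  - move=> t /=; rewrite in_itv/= => tl; rewrite lee_fin ger0_norm ?sqr_ge0//.
    have := NP N t (leqnn N) tl; rewrite -partF => h.
    have : (parts b (F e) t - parts b ((val (cs N)).1 e) t) ^+ 2 <= 1.
      rewrite -(real_normK (num_real _)) expr2.
      by rewrite mulr_ile1.
    rewrite ger0_norm; last by rewrite addr_ge0// mulr_ge0// sqr_ge0.
    rewrite /=; move: (parts b (F e) t) (parts b ((val (cs N)).1 e) t)
      (parts b ((val (cs n)).1 e) t) => x y z h'.
    have := sqr_ge0 ((x - y) - (y - z)); lra.
  - apply: Rintegrable_lin => //; first exact: sN.2.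
    by apply: sqint_integrable; exact: sqint_cst.
(* The difference from the n-th function is controlled instead of the limit [F]; that [F] is in L^2
   then follows by adding one core function back. *)
pose D n : tfun T := fun e t => F e t - (val (cs n)).1 e t.
have Dl2 n e : l2 (len e) (D n e).
  split; [have := sqF true e n|have := sqF false e n]; congr sqint;
    by apply/funext => t; rewrite -parts_sub.
have Dsmall e (eps : R) : 0 < eps -> exists N, forall n, (N <= n)%N ->
    nrm (len e) (D n e) <= eps.
  move=> eps0; have l0 := len_gt0 e.
  pose a := Num.sqrt (eps / (2 * len e)).
  have a2 : a ^+ 2 = eps / (2 * len e) by rewrite sqr_sqrtr// divr_ge0 ?mulr_ge0// ltW.
  have a0 : 0 < a by rewrite sqrtr_gt0 divr_gt0// mulr_gt0.
  have [N1 N1P] := unif_cauchy_lim (uC true e) a0.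
  have [N2 N2P] := unif_cauchy_lim (uC false e) a0.
  exists (maxn N1 N2) => n; rewrite geq_max => /andP[n1 n2].
  have [dr di] := Dl2 n e.
  have bnd (u : R -> R) : sqint `[0, len e] u ->
      (forall t, 0 <= t <= len e -> `|u t| <= a) ->
      \int[mu]_(t in `[0, len e]) (u t ^+ 2) <= a ^+ 2 * (len e - 0).
    move=> su ua; apply: Rintegral_avg_le; [exact: ltW|exact: su.2|].
    move=> t /ua h; rewrite -(real_normK (num_real (u t))).
    by rewrite ler_pXn2r// nnegrE// ltW.
  rewrite nrmE (_ : eps = a ^+ 2 * (len e - 0) + a ^+ 2 * (len e - 0)); last first.
    by rewrite a2 subr0; field; rewrite gt_eqF.
  apply: lerD; apply: bnd => // t tl.
    by rewrite -[repart _ t]/(parts true (D n e) t) /D parts_sub partF; exact: N1P.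
  by rewrite -[impart _ t]/(parts false (D n e) t) /D parts_sub partF; exact: N2P.
have Dsum (eps : R) : 0 < eps -> exists N, forall n, (N <= n)%N ->
    forall A : {fset edge T}, \sum_(e <- A) nrm (len e) (D n e) <= eps.
  move=> eps0; have e4 : 0 < eps / 4 by rewrite divr_gt0.
  have [N NP] := jC _ e4; exists N => n Nn A.
  have Asmall (s : seq (edge T)) (eps' : R) : 0 < eps' -> exists N', forall m, (N' <= m)%N ->
      \sum_(e <- s) nrm (len e) (D m e) <= eps'.
    elim: s eps' => [|e s IH] eps' e'0.
      by exists 0 => m _; rewrite big_nil ltW.
    have e2 : 0 < eps' / 2 by rewrite divr_gt0.
    have [N1 N1P] := Dsmall e _ e2; have [N2 N2P] := IH _ e2.
    exists (maxn N1 N2) => m; rewrite geq_max => /andP[/N1P h1 /N2P h2].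
    by rewrite big_cons [leRHS](splitr eps'); exact: lerD.
  have [N' N'P] := Asmall A _ e4.
  (* The index m depends on the finite set A, but the resulting bound eps on the sum for D n does
     not. *)
  pose m := maxn N N'.
  have h1 := N'P m (leq_maxr _ _).
  have h2 := NP m n (leq_maxl _ _) Nn.
  have h3 : \sum_(e <- A) nrm (len e) (fun t => (val (cs m)).1 e t - (val (cs n)).1 e t)
      <= ip (j (cs m) - j (cs n)) (j (cs m) - j (cs n)).
    rewrite [ip _ _]ip0_self -lee_fin fineK; last first.
      by rewrite ge0_fin_numE ?L2space_sum// nnsum_ge0// => e; exact: nrm_ge0.
    rewrite -sumEFin.
    exact: (fsum_le_nnsum (fun e => nrm (len e) (val (j (cs m) - j (cs n)) e)) A).
  apply: (@le_trans _ _ (\sum_(e <- A) (2 * nrm (len e) (D m e) + 2 *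
    nrm (len e) (fun t => (val (cs m)).1 e t - (val (cs n)).1 e t)))).
    apply: ler_sum => e _.
    rewrite (_ : D n e = fun t => D m e t +
      ((val (cs m)).1 e t - (val (cs n)).1 e t)); last first.
      by apply/funext => t; rewrite /D addrA subrK.
    exact: nrmD_le.
  rewrite big_split/= -!mulr_sumr; lra.
have DL2 n A : (forall B : {fset edge T}, \sum_(e <- B) nrm (len e) (D n e) <= A) ->
    L2 (D n : tree_fun T).
  move=> H; apply/L2P; split => //; apply: le_lt_trans (nnsum_ub H) _.
  exact: ltry.
have [N0 N0P] := Dsum _ ltr01.
have D0 : D N0 \in @L2pred R T by apply/L2predP; apply: DL2; exact: N0P.
pose x0 : L2space T := exist _ (D N0) D0.
pose x : L2space T := x0 + j (cs N0).
exists x => eps eps0; have [N NP] := Dsum _ eps0.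
exists N => n /NP H; rewrite sqformBC.
rewrite [ip _ _]ip0_self -lee_fin fineK; last first.
  by rewrite ge0_fin_numE ?L2space_sum// nnsum_ge0// => e; exact: nrm_ge0.
rewrite (_ : (fun e => _) = fun e => nrm (len e) (D n e)); first exact: nnsum_ub.
apply/funext => e; congr (nrm _ _); apply/funext => t.
rewrite L2_val_sub [val x e t](_ : _ = D N0 e t + (val (cs N0)).1 e t)//.
by rewrite /D subrK.
Qed.

End CoreClosed.

(** * Cheeger estimates *)

Section Counting.
Variables (R : realType) (I J : choiceType).

Lemma sum_indicator (A B : {fset I}) (P : pred I) :
  (forall i, (i \in B) = (i \in A) && P i) ->
  \sum_(i <- A) (P i)%:R = #|` B|%:R :> R.
Proof.
move=> BP; transitivity (\sum_(i <- B) 1 : R); last first.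
  by rewrite big_const_seq iter_addr addr0 count_predT cardfE.
rewrite (eq_bigr (fun i => if P i then 1 else 0)) => [|i _]; last by case: (P i).
rewrite -big_mkcond -big_filter; apply: perm_big; apply: uniq_perm.
- by rewrite filter_uniq// fset_uniq.
- exact: fset_uniq.
- by move=> i; rewrite mem_filter BP andbC.
Qed.

Lemma sum_fibers (A : {fset I}) (W : {fset J}) (g : I -> J) (G : J -> R) :
  (forall i, i \in A -> g i \in W) ->
  \sum_(i <- A) G (g i) = \sum_(v <- W) G v * \sum_(i <- A) (g i == v)%:R.
Proof.
move=> AW; under [RHS]eq_bigr do rewrite mulr_sumr.
rewrite exchange_big/= !big_seq; apply: eq_bigr => i iA.
rewrite (big_fsetD1 (g i)) ?AW//= eqxx mulr1 big1_fset ?addr0// => v.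
by rewrite !inE => /andP[vi _] _; rewrite eq_sym (negbTE vi) mulr0.
Qed.

End Counting.

Section Flux.
Variables (R : realType) (T : metric_tree R).
Notation mu := (@lebesgue_measure R).
Local Notation C := (Rcomplex R).
Local Notation core := (core T).
Local Notation ip := (ip T).
Local Notation j := (@core_fun R T).
Local Notation d := (@core_der R T).
Hypothesis deg_neq2 : forall v : vertex T, deg v <> 2%N.
Hypothesis no_loose_ends : forall v : vertex T, deg v <> 1%N.

Local Notation a := (@inratio R T).

Definition modsq (z : C) : R := complex.Re z ^+ 2 + complex.Im z ^+ 2.

Lemma modsq_neq0 (z : C) : modsq z != 0 -> z != 0.
Proof. by apply: contra => /eqP ->; rewrite /modsq /= expr0n addr0. Qed.

Lemma edge_flux (c : core) e th : 0 < th ->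
  Kcomb (init e) / len e * nrm (len e) ((val c).1 e) <=
  modsq ((val c).1 e (len e)) - a (init e) * modsq ((val c).1 e 0) +
  th * nrm (len e) ((val c).1 e) + th^-1 * nrm (len e) ((val c).2 e).
Proof.
move=> th0; have l0 := len_gt0 e; rewrite -[Kcomb _]/(1 - a (init e)).
have /andP[a0 a2] := inratio_bound (R := R) deg_neq2 no_loose_ends (init e).
have a01 : 0 <= a (init e) <= 1 by rewrite a0; lra.
have flux b : (1 - a (init e)) / len e *
      \int[mu]_(t in `[0, len e]) (parts b ((val c).1 e) t ^+ 2) <=
    parts b ((val c).1 e) (len e) ^+ 2 - a (init e) * parts b ((val c).1 e) 0 ^+ 2 +
    th * \int[mu]_(t in `[0, len e]) (parts b ((val c).1 e) t ^+ 2) +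
    th^-1 * \int[mu]_(t in `[0, len e]) (parts b ((val c).2 e) t ^+ 2).
  by have [d2 [_ _ pp cw]] := core_parts_b c e b; exact: primitive_flux.
have := lerD (flux true) (flux false).
rewrite -mulrDr -[X in _ / _ * X]nrmE /modsq !nrmE /parts /repart /impart.
by move=> h; apply: le_trans h _; rewrite le_eqVlt; apply/orP; left; apply/eqP; ring.
Qed.

Lemma out_edge_exists v : exists e : edge T, init e = v.
Proof.
have := nout_ge2 deg_neq2 no_loose_ends v; rewrite /nout => h.
have /fset0Pn[e] : fset_set (out_edges v) != fset0.
  by rewrite -cardfs_gt0 (leq_trans _ h).
by rewrite in_fset_set ?inE//; [exists e|exact: finite_out_edges].
Qed.

Lemma init_neq_term (e : edge T) : init e != term e.
Proof. by apply/eqP => h; have := edge_dist e; rewrite h ltnn. Qed.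

(* The choice of the linear weight on each edge, with slope [Kcomb (init e)]
   and value 1 at the terminal vertex, makes the flux through each vertex vanish. *)
Lemma vertex_flux (c : core) :
  \sum_(e <- core_supp c) (modsq ((val c).1 e (len e)) -
     a (init e) * modsq ((val c).1 e 0)) = 0.
Proof.
have [_ _ cont _] := coreP c.
have /choice[ev evP] := out_edge_exists.
pose f : tree_fun T := (val c).1.
(* The squared modulus at v, read on a chosen outgoing edge; continuity makes it the same on all
   edges at v. *)
pose U v := modsq (value_at f (ev v) v).
have at_ev v : edges_at v (ev v) by left; exact: evP.
have U0 e : modsq ((val c).1 e 0) = U (init e).
  rewrite /U (cont _ (ev (init e)) e)//; last by left.
  by rewrite /value_at eqxx.
have Ul e : modsq ((val c).1 e (len e)) = U (term e).
  rewrite /U (cont _ (ev (term e)) e)//; last by right.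
  by rewrite /value_at (negbTE (init_neq_term e)).
(* Where U does not vanish, all edges at v lie in the support, so the counts below are the full
   numbers [nin v] and [nout v]. *)
have suppU v e : edges_at v e -> U v != 0 -> e \in core_supp c.
  move=> ve; rewrite /U (cont v (ev v) e)// => /modsq_neq0 ne.
  apply: contraNT ne => es; rewrite /value_at /f.
  by case: ifP => _; rewrite (core_suppP _ es) ?lexx ?ltW ?len_gt0.
set A := core_supp c.
pose W := ([fset init e | e in A] `|` [fset term e | e in A])%fset.
have initW e : e \in A -> init e \in W by move=> eA; rewrite inE in_imfset.
have termW e : e \in A -> term e \in W by move=> eA; rewrite inE in_imfset ?orbT.
rewrite sumrB.
under eq_bigr do rewrite Ul.
under [X in _ - X]eq_bigr do rewrite U0.
rewrite (sum_fibers (g := @term T) U termW).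
rewrite (sum_fibers (g := @init T) (fun v => a v * U v) initW).
rewrite -sumrB big1// => v _.
have [->|Uv] := eqVneq (U v) 0; first by rewrite mulr0 !mul0r subrr.
have -> : \sum_(e <- A) (term e == v)%:R = (nin v)%:R :> R.
  apply: sum_indicator => e; rewrite in_fset_set; last exact: finite_in_edges.
  apply/idP/idP => [|/andP[_ /eqP h]]; rewrite inE//.
  move=> ve; apply/andP; split; last exact/eqP.
  by apply: suppU Uv; right.
have -> : \sum_(e <- A) (init e == v)%:R = (nout v)%:R :> R.
  apply: sum_indicator => e; rewrite in_fset_set; last exact: finite_out_edges.
  apply/idP/idP => [|/andP[_ /eqP h]]; rewrite inE//.
  move=> ve; apply/andP; split; last exact/eqP.
  by apply: suppU Uv; left.
rewrite mulrAC /inratio divfK; first by rewrite mulrC subrr.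
rewrite pnatr_eq0 -lt0n; apply: leq_trans (nout_ge2 deg_neq2 no_loose_ends v).
by [].
Qed.

Lemma core_flux (c : core) th : 0 < th ->
  \sum_(e <- core_supp c) Kcomb (init e) / len e * nrm (len e) ((val c).1 e) <=
  th * ip (j c) (j c) + th^-1 * ip (d c) (d c).
Proof.
move=> th0; have [-> ->] := ip_core c (fsubset_refl (core_supp c)).
apply: (@le_trans _ _ (\sum_(e <- core_supp c)
    (modsq ((val c).1 e (len e)) - a (init e) * modsq ((val c).1 e 0) +
     (th * nrm (len e) ((val c).1 e) + th^-1 * nrm (len e) ((val c).2 e))))).
  by apply: ler_sum => e _; rewrite addrA; exact: edge_flux.
by rewrite big_split/= vertex_flux add0r big_split/= -!mulr_sumr.
Qed.

(** The lower bound on the curvature rate fails on [X0] only, and there the missing mass is added to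
    the right-hand side. *)
Lemma core_flux_off (c : core) th k (X0 : {fset edge T}) : 0 < th -> 0 < k ->
  (forall e, e \notin X0 -> k <= Kcomb (init e) / len e) ->
  k * ip (j c) (j c) <= th * ip (j c) (j c) + th^-1 * ip (d c) (d c) +
    k * \sum_(e <- X0) nrm (len e) ((val c).1 e).
Proof.
move=> th0 k0 kX; apply: le_trans (lerD (core_flux c th0) (lexx _)).
have [-> _] := ip_core c (fsubset_refl (core_supp c)).
have n0 e : 0 <= nrm (len e) ((val c).1 e) by exact: nrm_ge0.
have w0 (e : edge T) : 0 <= @Kcomb R T (init e) / len e.
  have /andP[h _] := Kcomb_bound (R := R) deg_neq2 no_loose_ends (init e).
  by rewrite divr_ge0 ?(ltW (len_gt0 e))//; lra.
rewrite -lerBlDr -mulrBr -[X in k * X](@addrK _ (\sum_(e <- core_supp c | e \in X0) nrm (len e) ((val c).1 e))).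
have hX : \sum_(e <- core_supp c | e \in X0) nrm (len e) ((val c).1 e) <=
    \sum_(e <- X0) nrm (len e) ((val c).1 e).
  rewrite -big_filter [leRHS](bigID (mem (core_supp c)))/= -[X in X <= _]addr0 lerD//.
    rewrite -[leRHS]big_filter.
    rewrite (perm_big [seq i <- X0 | i \in core_supp c])//.
    apply: uniq_perm; rewrite ?filter_uniq ?fset_uniq// => i.
    by rewrite !mem_filter andbC.
  exact: sumr_ge0.
apply: (@le_trans _ _ (k * \sum_(e <- core_supp c | e \notin X0) nrm (len e) ((val c).1 e))).
  rewrite ler_pM2l// addrK [X in X - _ <= _](bigID (mem X0))/= /nrm -!/(nrm _ _).
  by move: hX; rewrite /nrm; lra.
rewrite mulr_sumr [leRHS](bigID (mem X0))/= -[X in X <= _]add0r lerD//.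
  by apply: sumr_ge0 => e _; exact: mulr_ge0.
by apply: ler_sum => e eX; rewrite ler_wpM2r// kX.
Qed.

(** The parameter k/2 maximises th(k - th), with maximum k^2/4. *)
Lemma core_cheeger (c : core) k : 0 < k ->
  (forall e : edge T, k <= Kcomb (init e) / len e) ->
  k ^+ 2 / 4 * ip (j c) (j c) <= ip (d c) (d c).
Proof.
move=> k0 kX; have k2 : 0 < k / 2 by rewrite divr_gt0.
have := @core_flux_off c (k / 2) k fset0 k2 k0 (fun e _ => kX e).
rewrite big_nil mulr0 addr0 => h.
have : k / 2 * (k * ip (j c) (j c)) <=
   k / 2 * (k / 2 * ip (j c) (j c) + (k / 2)^-1 * ip (d c) (d c)).
  by rewrite ler_pM2l.
have -> : k / 2 * (k / 2 * ip (j c) (j c) + (k / 2)^-1 * ip (d c) (d c)) =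
    k ^+ 2 / 4 * ip (j c) (j c) + ip (d c) (d c) by field; rewrite gt_eqF.
lra.
Qed.

End Flux.

(** * Finitely many functionals controlling exceptional edges *)

Section Functionals.
Variables (R : realType) (T : metric_tree R).
Notation mu := (@lebesgue_measure R).
Local Notation TR := (measurableTypeR R).
Local Notation core := (core T).
Local Notation ip := (ip T).
Local Notation j := (@core_fun R T).
Local Notation d := (@core_der R T).

(** The indicator of [x, y] on [e0], multiplied by 1 or by i: its inner product with u is the
    integral of the real or imaginary part of u. *)
Definition bump_fun (b : bool) (e0 : edge T) (x y : R) : tfun T := fun e t =>
  if (e == e0) && (x <= t <= y) then (if b then 1 +i* 0 else 0 +i* 1) else 0.

Lemma bump_fun_parts b b' e0 x y t : parts b' (bump_fun b e0 x y e0) t =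
  if b == b' then \1_(`[x, y]) t else 0.
Proof.
rewrite /parts /bump_fun eqxx /repart /impart indicE mem_setE in_itv/=.
by case: b' b => -[] /=; case: (x <= t <= y).
Qed.

Lemma bump_fun_L2 b e0 x y : L2 (bump_fun b e0 x y : tree_fun T).
Proof.
have off e : e != e0 -> bump_fun b e0 x y e = fun=> 0.
  by move=> ee; apply/funext => t; rewrite /bump_fun (negbTE ee).
have sq : sqint `[0, len e0] (\1_(`[x, y]) : R -> R).
  have m : measurable_fun (`[0, len e0] : set TR) (\1_(`[x, y]%classic) : TR -> R).
    exact: measurable_indic.
  split => //; have := sqint_integrable (sqint_cst 0 (len e0) (1:R)) => i1.
  apply: le_integrable i1 => //.
    by apply/measurable_EFinP; exact: measurable_funX.
  by move=> t _ /=; rewrite lee_fin indicE; case: (_ \in _); rewrite ?expr1n ?expr0n ?normr0 ?normr1.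
have z : sqint `[0, len e0] (fun=> 0 : R) by exact: sqint_cst.
apply/L2P; split.
  move=> e; have [->|ee] := eqVneq e e0; last by rewrite off//; exact: l2_const0.
  have P b' : sqint `[0, len e0] (parts b' (bump_fun b e0 x y e0)).
    rewrite (_ : parts _ _ = fun t => if b == b' then \1_(`[x, y]) t else 0).
      by case: (b == b').
    by apply/funext => t; rewrite bump_fun_parts.
  by split; [exact: (P true)|exact: (P false)].
rewrite (nnsum_finsupp (A := [fset e0]%fset)) ?ltry// => e; first exact: nrm_ge0.
by rewrite inE => /off ->; exact: nrm0.
Qed.

Definition bump b e0 x y : L2space T :=
  exist _ (bump_fun b e0 x y) (introT (L2predP _) (bump_fun_L2 b e0 x y)).

Lemma ip_bump b e0 x y (u : L2space T) : 0 <= x -> y <= len e0 ->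
  ip u (bump b e0 x y) = \int[mu]_(t in `[x, y]) parts b (val u e0) t.
Proof.
move=> x0 yl; rewrite [LHS](rsum_finsupp (A := [fset e0]%fset)); last first.
  move=> e; rewrite inE => ee; rewrite /dot.
  have z (v w : R -> R) : (forall t, w t = 0) ->
      \int[mu]_(t in `[0, len e]) (v t * w t) = 0.
    move=> w0; rewrite /Rintegral (_ : (fun _ => _) = cst 0%E) ?integral0//.
    by apply/funext => t; rewrite w0 mulr0.
  by rewrite !z ?addr0// => t; rewrite /repart /impart /= /bump_fun (negbTE ee).
rewrite big_seq_fset1 /dot.
have part b' : \int[mu]_(t in `[0, len e0])
     (parts b' (val u e0) t * parts b' (bump_fun b e0 x y e0) t) =
   if b == b' then \int[mu]_(t in `[x, y]) parts b' (val u e0) t else 0.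
  case: ifP => bb.
    have -> : \int[mu]_(t in `[x, y]) parts b' (val u e0) t =
        \int[mu]_(t in `[0, len e0] `&` `[x, y]) parts b' (val u e0) t.
      by rewrite setIidr//; exact: itv_sub.
    rewrite Rintegral_mkcondr; apply: eq_Rintegral => t _.
    rewrite bump_fun_parts bb patchE indicE.
    by case: (t \in _); rewrite ?mulr1 ?mulr0.
  rewrite /Rintegral (_ : (fun _ => _) = cst 0%E) ?integral0//.
  by apply/funext => t; rewrite bump_fun_parts bb mulr0.
by have := part true; have := part false; rewrite /parts /= => -> ->; case: b part;
  rewrite ?addr0 ?add0r.
Qed.

Lemma edge_poincare e (eps : R) : 0 < eps -> exists (s : seq (L2space T)),
  exists2 M, 0 <= M & forall c : core,
    nrm (len e) ((val c).1 e) <= eps * nrm (len e) ((val c).2 e) +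
      M * \sum_(phi <- s) ip (j c) phi ^+ 2.
Proof.
move=> eps0; have l0 := len_gt0 e.
(* The mesh h = len/N satisfies 2 h^2 <= eps, because N >= 2 len^2/eps and N^2 >= N; 2 h^2 is the
   constant of [primitive_poincare] on one piece. *)
pose N := (Num.truncn (2 * (len e) ^+ 2 / eps)).+1.
have N0 : 0 < N%:R :> R by rewrite ltr0n.
have N1 : 1 <= N%:R :> R by rewrite (ler_nat _ 1).
pose h := len e / N%:R.
have h0 : 0 < h by rewrite divr_gt0.
have lN : N%:R * h = len e by rewrite mulrC divfK// gt_eqF.
have heps : 2 * h ^+ 2 <= eps.
  have : 2 * (len e) ^+ 2 / eps <= N%:R by apply: ltW; exact: truncnS_gt.
  rewrite ler_pdivrMr// => H.
  rewrite /h expr_div_n mulrA ler_pdivrMr ?exprn_gt0//.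
  apply: le_trans H _; rewrite mulrC ler_wpM2l ?(ltW eps0)//.
  by rewrite expr2 ler_peMl// ltW.
pose s b := [seq bump b e (k%:R * h) (k.+1%:R * h) | k <- iota 0 N].
exists (s true ++ s false), (2 / h); first by rewrite divr_ge0// ltW.
move=> c.
have piece (k : 'I_N) : [/\ 0 <= k%:R * h :> R, k%:R * h < k.+1%:R * h,
    k.+1%:R * h <= len e & k.+1%:R * h - k%:R * h = h].
  split; first by rewrite mulr_ge0// ltW.
  - by rewrite ltr_pM2r// ltr_nat.
  - by rewrite -lN ler_wpM2r ?ler_nat// ltW.
  - by rewrite -mulrBl -natrB// subSnn mul1r.
have part b : \int[mu]_(t in `[0, len e]) (parts b ((val c).1 e) t ^+ 2) <=
    eps * \int[mu]_(t in `[0, len e]) (parts b ((val c).2 e) t ^+ 2) +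
    2 / h * \sum_(phi <- s b) ip (j c) phi ^+ 2.
  have [d2 [sd dd pp _]] := core_parts_b c e b.
  have sw := primitive_sqint sd dd; have sp := primitive_sqint sw pp.
  have split_int (u : R -> R) : sqint `[0, len e] u ->
      \int[mu]_(t in `[0, len e]) (u t ^+ 2) =
      \sum_(k < N) \int[mu]_(t in `[k%:R * h, k.+1%:R * h]) (u t ^+ 2).
    move=> su; rewrite -[in LHS]lN Rintegral_split//; first exact: ltW.
    by rewrite lN; exact: su.2.
  rewrite !split_int// big_map (_ : iota 0 N = index_iota 0 N); last first.
    by rewrite /index_iota subn0.
  rewrite big_mkord !mulr_sumr -big_split/=; apply: ler_sum => k _.
  have [k0 k1 k2 kh] := piece k.
  apply: le_trans (primitive_poincare sw pp k0 k1 k2) _; rewrite kh.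
  rewrite [leRHS]addrC -[ip0 _ _]/(ip _ _) ip_bump//; apply: lerD => //.
  by rewrite ler_wpM2r//; apply: Rintegral_ge0 => t _; exact: sqr_ge0.
rewrite !nrmE big_cat/=.
have := lerD (part true) (part false); rewrite /parts /=.
by move=> H; apply: le_trans H _; rewrite le_eqVlt; apply/orP; left; apply/eqP; ring.
Qed.

Lemma edges_poincare (X : seq (edge T)) (eps : R) : 0 < eps ->
  exists (s : seq (L2space T)), exists2 M, 0 <= M & forall c : core,
    \sum_(e <- X) nrm (len e) ((val c).1 e) <=
      eps * \sum_(e <- X) nrm (len e) ((val c).2 e) +
      M * \sum_(phi <- s) ip (j c) phi ^+ 2.
Proof.
move=> eps0; elim: X => [|e X [s [M M0 H]]].
  by exists [::], 0 => // c; rewrite !big_nil !mulr0 addr0.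
have [s' [M' M'0 H']] := edge_poincare e eps0.
exists (s' ++ s), (M' + M); first exact: addr_ge0.
move=> c; rewrite !big_cons big_cat/=; have := H c; have := H' c.
have s0 (r : seq (L2space T)) : 0 <= \sum_(phi <- r) ip (j c) phi ^+ 2.
  by apply: sumr_ge0 => phi _; exact: sqr_ge0.
have := mulr_ge0 M'0 (s0 s); have := mulr_ge0 M0 (s0 s').
set S := \sum_(phi <- s) _; set S' := \sum_(phi <- s') _; lra.
Qed.

Hypothesis deg_neq2 : forall v : vertex T, deg v <> 2%N.
Hypothesis no_loose_ends : forall v : vertex T, deg v <> 1%N.

Lemma core_cheeger_off (X0 : {fset edge T}) k c0 : 0 < k -> c0 < k ^+ 2 / 4 ->
  (forall e, e \notin X0 -> k <= Kcomb (init e) / len e) ->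
  exists (s : seq (L2space T)), exists2 M, 0 <= M & forall c : core,
    c0 * ip (j c) (j c) <= ip (d c) (d c) + M * \sum_(phi <- s) ip (j c) phi ^+ 2.
Proof.
move=> k0 c0k kX; have [c00|c0p] := leP c0 0.
  exists [::], 0 => // c; rewrite mul0r addr0.
  apply: (@le_trans _ _ 0); last exact: form_ge0.
  by rewrite mulr_le0_ge0// form_ge0.
have k2 : 0 < k / 2 by rewrite divr_gt0.
have kk : 0 < k ^+ 2 by rewrite exprn_gt0.
(* Chosen so that the exceptional edges raise the coefficient of |f'|^2 from 1 to exactly k^2/(4
   c0); dividing by it leaves c0 on the left. Nonpositive c0 was treated apart because of this
   division. *)
pose eps := 2 / k ^+ 2 * (k ^+ 2 / 4 / c0 - 1).
have q1 : 1 < k ^+ 2 / 4 / c0 by rewrite ltr_pdivlMr// mul1r.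
have eps0 : 0 < eps by rewrite mulr_gt0 ?divr_gt0// subr_gt0.
have [s [M M0 H]] := edges_poincare X0 eps0.
exists s, (2 * M * c0); first by rewrite !mulr_ge0// ltW.
move=> c; have := core_flux_off deg_neq2 no_loose_ends c k2 k0 kX.
set S := \sum_(phi <- s) _; set J := ip (j c) (j c); set D := ip (d c) (d c).
have nD : \sum_(e <- X0) nrm (len e) ((val c).2 e) <= D.
  rewrite /D [ip _ _]ip0_self -lee_fin fineK; last first.
    by rewrite ge0_fin_numE ?L2space_sum// nnsum_ge0// => e; exact: nrm_ge0.
  rewrite -sumEFin.
  exact: (fsum_le_nnsum (fun e => nrm (len e) (val (d c) e)) X0).
have := H c; rewrite -/S => h1 h2.
have h3 := ler_wpM2l (ltW eps0) nD.
have {h1 h3}h4 : \sum_(e <- X0) nrm (len e) ((val c).1 e) <= eps * D + M * S by lra.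
have h5 : k * J <= k / 2 * J + (k / 2)^-1 * D + k * (eps * D + M * S).
  by apply: le_trans h2 _; rewrite lerD2l ler_pM2l.
have h6 : k ^+ 2 / 4 * J <= k ^+ 2 / 4 / c0 * D + k ^+ 2 / 2 * (M * S).
  have : k / 2 * (k * J) <=
      k / 2 * (k / 2 * J + (k / 2)^-1 * D + k * (eps * D + M * S)) by rewrite ler_pM2l.
  have -> : k / 2 * (k / 2 * J + (k / 2)^-1 * D + k * (eps * D + M * S)) =
      k ^+ 2 / 4 * J + D + (k ^+ 2 / 4 / c0 - 1) * D + k ^+ 2 / 2 * (M * S).
    by rewrite /eps; field; rewrite !gt_eqF.
  lra.
rewrite -(ler_pM2l (x := k ^+ 2 / 4 / c0)); last by rewrite !divr_gt0.
have -> : k ^+ 2 / 4 / c0 * (c0 * J) = k ^+ 2 / 4 * J by field; rewrite gt_eqF.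
apply: le_trans h6 _; rewrite le_eqVlt; apply/orP; left; apply/eqP.
by field; rewrite gt_eqF.
Qed.

End Functionals.

(** * Test functions *)

Section TestPolynomial.
Variable R : realType.
Notation mu := (@lebesgue_measure R).
Implicit Types (l x : R) (p : {poly R}).

Lemma poly_within p a b : {within `[a, b], continuous (horner p)}.
Proof. by apply: continuous_subspaceT => x; exact: continuous_horner. Qed.

Lemma poly_primitive p l : primitive l (horner p) (horner p^`()).
Proof.
move=> x /andP[]; rewrite le_eqVlt => /predU1P[<-|x0] _.
  by rewrite set_itv1 Rintegral_set1 addr0.
have dp : derivable_oo_LRcontinuous (horner p) 0 x.
  split=> [y _||]; first exact: derivable_horner.
  - by apply: cvg_at_right_filter; exact: continuous_horner.
  - by apply: cvg_at_left_filter; exact: continuous_horner.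
have E : {in `]0, x[, derive1 (horner p) =1 horner p^`()}.
  by move=> y _; rewrite derivE.
rewrite /Rintegral (continuous_FTC2 x0 (@poly_within _ _ _) dp E)/=.
by rewrite [RHS]addrC subrK.
Qed.

(** The polynomial t^2 (l - t)^2. Its double zeros make value and derivative vanish at both ends, so
    extension by zero satisfies every vertex condition. *)
Definition testp l : {poly R} := 'X^4 - (2 * l) *: 'X^3 + l ^+ 2 *: 'X^2.

Lemma testpE l x : (testp l).[x] = x ^+ 2 * (l - x) ^+ 2.
Proof.
rewrite /testp !hornerD hornerN !hornerZ !hornerXn; ring.
Qed.

Lemma dtestpE l x : (testp l)^`().[x] = 2 * x * (l - x) * (l - 2 * x).
Proof.
rewrite /testp derivD derivB !derivZ !derivXn /=.
rewrite !hornerD hornerN !hornerZ !hornerMn !hornerXn /=; ring.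
Qed.

(** The derivative is at most l^3/2 in modulus on [0, l], and t(l - t) >= 3 l^2/16 on the middle
    half. The quotient is thus at most (16/3)^4/2 < 405 over l^2, which 21^2 = 441 covers. *)
Lemma testp_ratio l : 0 < l ->
  0 < \int[mu]_(t in `[0, l]) ((testp l).[t] ^+ 2) /\
  \int[mu]_(t in `[0, l]) ((testp l)^`().[t] ^+ 2) <=
  21 ^+ 2 / l ^+ 2 * \int[mu]_(t in `[0, l]) ((testp l).[t] ^+ 2).
Proof.
move=> l0; have l0' := ltW l0.
have sp q : sqint `[0, l] (horner q) by apply: within_sqint; exact: poly_within.
have up : \int[mu]_(t in `[0, l]) ((testp l)^`().[t] ^+ 2) <= l ^+ 6 / 4 * (l - 0).
  apply: Rintegral_avg_le => //; first exact: (sp _).2.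
  move=> t /andP[t0 tl]; rewrite dtestpE.
  have -> : l ^+ 6 / 4 = (l ^+ 3 / 2) ^+ 2 by field.
  rewrite -(real_normK (num_real _)) ler_pXn2r// ?nnegrE//; last first.
    by rewrite divr_ge0// exprn_ge0.
  rewrite normrM (ger0_norm (_ : 0 <= 2 * t * (l - t))); last first.
    by rewrite !mulr_ge0// subr_ge0.
  have -> : l ^+ 3 / 2 = l ^+ 2 / 2 * l by field.
  apply: ler_pM; rewrite ?mulr_ge0 ?subr_ge0//.
    have := sqr_ge0 (l - 2 * t); lra.
  by rewrite ler_norml; apply/andP; split; lra.
have low : 2^-1 * l * ((3 / 16) ^+ 2 * l ^+ 4) ^+ 2 <=
    \int[mu]_(t in `[0, l]) ((testp l).[t] ^+ 2).
  have l4 : 0 <= l / 4 by rewrite divr_ge0.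
  have l3 : 3 / 4 * l <= l by lra.
  apply: le_trans (Rintegral_sq_mono l4 l3 (sp _)).
  have := @Rintegral_avg_ge R (l / 4) (3 / 4 * l) (fun t => (testp l).[t] ^+ 2)
    (((3 / 16) ^+ 2 * l ^+ 4) ^+ 2) 1 0 ltac:(lra) (sqint_sub l4 l3 (sp _)).2.
  rewrite mul0r addr0 [X in _ <= X]mul1r; have -> : 3 / 4 * l - l / 4 = 2^-1 * l by field.
  move=> H; rewrite [leLHS]mulrC; apply: H => t /andP[t0 tl].
  rewrite mul1r addr0 testpE ler_pXn2r ?nnegrE//; last 2 first.
  - by rewrite mulr_ge0 ?exprn_ge0.
  - by rewrite mulr_ge0 ?sqr_ge0.
  have h : 3 / 16 * l ^+ 2 <= t * (l - t).
    have : 0 <= (t - l / 4) * (3 / 4 * l - t) by rewrite mulr_ge0// subr_ge0.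
    lra.
  have h0 : 0 <= 3 / 16 * l ^+ 2 by rewrite mulr_ge0 ?exprn_ge0.
  rewrite -exprMn (_ : (3 / 16) ^+ 2 * l ^+ 4 = (3 / 16 * l ^+ 2) ^+ 2); last by field.
  by rewrite ler_pXn2r ?nnegrE//; exact: le_trans h.
have pos : 0 < 2^-1 * l * ((3 / 16) ^+ 2 * l ^+ 4) ^+ 2.
  by apply: mulr_gt0; [exact: mulr_gt0|rewrite exprn_gt0// mulr_gt0// exprn_gt0].
split; first exact: lt_le_trans low.
apply: le_trans up _.
apply: (@le_trans _ _ (21 ^+ 2 / l ^+ 2 * (2^-1 * l * ((3 / 16) ^+ 2 * l ^+ 4) ^+ 2))).
  have -> : 21 ^+ 2 / l ^+ 2 * (2^-1 * l * ((3 / 16) ^+ 2 * l ^+ 4) ^+ 2) =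
      21 ^+ 2 * (2^-1 * (3 / 16) ^+ 4) * l ^+ 7 by field; rewrite gt_eqF.
  have -> : l ^+ 6 / 4 * (l - 0) = l ^+ 7 / 4 by ring.
  rewrite [leLHS]mulrC; apply: ler_wpM2r; first by rewrite exprn_ge0.
  by lra.
by apply: ler_wpM2l => //; apply: divr_ge0; exact: sqr_ge0.
Qed.

End TestPolynomial.

Section TestFunction.
Variables (R : realType) (T : metric_tree R).
Notation mu := (@lebesgue_measure R).
Local Notation core := (core T).
Local Notation ip := (ip T).
Local Notation j := (@core_fun R T).
Local Notation d := (@core_der R T).

Definition edge_fun (e0 : edge T) (u : R -> R) : tfun T :=
  fun e t => if e == e0 then u t +i* 0 else 0.

Lemma repart_edge_fun e u : repart (edge_fun e u e) = u.
Proof. by apply/funext => t; rewrite /repart /edge_fun eqxx. Qed.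

Lemma impart_edge_fun e u : impart (edge_fun e u e) = fun=> 0.
Proof. by apply/funext => t; rewrite /impart /edge_fun eqxx. Qed.

Lemma edge_fun_off e e0 u : e != e0 -> edge_fun e0 u e = fun=> 0.
Proof. by move=> ee; apply/funext => t; rewrite /edge_fun (negbTE ee). Qed.

Lemma test_dom e0 : dom_H0
  (edge_fun e0 (horner (testp (len e0))) : tree_fun T)
  (edge_fun e0 (horner (testp (len e0))^`())).
Proof.
set l := len e0.
have z m : primitive m (fun=> 0 : R) (fun=> 0).
  by move=> x _; rewrite /Rintegral integral0 addr0.
have p0 : (testp l).[0] = 0 by rewrite testpE expr0n mul0r.
have pl : (testp l).[l] = 0 by rewrite testpE subrr expr0n mulr0.
have dp0 : (testp l)^`().[0] = 0 by rewrite dtestpE mulr0 !mul0r.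
have dpl : (testp l)^`().[l] = 0 by rewrite dtestpE subrr mulr0 mul0r.
have c00 : (0 +i* 0 : R[i]) = 0 by [].
have val0 e v : value_at (edge_fun e0 (horner (testp l)) : tree_fun T) e v = 0.
  rewrite /value_at /edge_fun; have [->|ee] := eqVneq e e0; case: ifP => _ //.
    by rewrite p0.
  by rewrite pl.
split.
- move=> e; apply/H2P; exists (edge_fun e0 (horner (testp l)^`()^`()) e).
  have [->|ee] := eqVneq e e0; last first.
    rewrite !edge_fun_off//; split; first exact: l2_const0.
      by split; exact: z.
    by split; exact: z.
  split; first split.
  + by rewrite repart_edge_fun; apply: within_sqint; exact: poly_within.
  + by rewrite impart_edge_fun; exact: sqint_cst.
  + by rewrite !repart_edge_fun !impart_edge_fun; split; [exact: poly_primitive|exact: z].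
  + by rewrite !repart_edge_fun !impart_edge_fun; split; [exact: poly_primitive|exact: z].
- apply: (@sub_finite_set _ _ [set e0]); last exact: finite_set1.
  move=> e [x [_]]; have [->//|ee] := eqVneq e e0.
  by rewrite edge_fun_off// eqxx.
- by move=> v e e' _ _; rewrite !val0.
- move=> v; rewrite fsbig1// => e _; rewrite /inward_deriv /edge_fun.
  have [->|ee] := eqVneq e e0; case: ifP => _; rewrite ?oppr0//.
    by rewrite dp0.
  by rewrite dpl c00 oppr0.
Qed.

Lemma test_subproof e0 : (edge_fun e0 (horner (testp (len e0))),
  edge_fun e0 (horner (testp (len e0))^`())) \in @core_pred R T.
Proof. by apply/asboolP; exact: test_dom. Qed.

Definition test e0 : core := exist (fun x => x \in core_pred (T:=T)) _ (test_subproof e0).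

Lemma test_supp e0 : (core_supp (test e0) `<=` [fset e0])%fset.
Proof.
apply/fsubsetP => e; apply: contraLR; rewrite inE => ee.
rewrite in_fset_set; last by have [_ ? _ _] := coreP (test e0).
by apply/negP; rewrite inE/= => -[x [_]]; rewrite edge_fun_off// eqxx.
Qed.

Lemma test_orth e e' : e != e' -> ip (j (test e)) (j (test e')) = 0 /\
  ip (d (test e)) (d (test e')) = 0.
Proof.
move=> ee; have [-> ->] := ip_core (test e) (test_supp e').
have z (v w : R -> R) m : (forall t, v t = 0) ->
    \int[mu]_(t in `[0, m]) (v t * w t) = 0.
  move=> v0; rewrite /Rintegral (_ : (fun _ => _) = cst 0%E) ?integral0//.
  by apply/funext => t; rewrite v0 mul0r.
have e'e : e' != e by rewrite eq_sym.
by split; rewrite big_seq_fset1 /dot !z ?addr0// => t;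
  rewrite /repart /impart /= edge_fun_off.
Qed.

Lemma test_bound e : 0 < ip (j (test e)) (j (test e)) /\
  ip (d (test e)) (d (test e)) <= 21 ^+ 2 / len e ^+ 2 * ip (j (test e)) (j (test e)).
Proof.
have [-> ->] := ip_core (test e) (test_supp e).
have [h1 h2] := testp_ratio (len_gt0 e).
have z (u : R -> R) m : (forall t, u t = 0) ->
    \int[mu]_(t in `[0, m]) (u t ^+ 2) = 0.
  move=> u0; rewrite /Rintegral (_ : (fun _ => _) = cst 0%E) ?integral0//.
  by apply/funext => t; rewrite u0 expr0n.
have n (u : R -> R) : nrm (len e) (edge_fun e u e) =
    \int[mu]_(t in `[0, len e]) (u t ^+ 2).
  by rewrite nrmE repart_edge_fun impart_edge_fun [X in _ + X]z ?addr0.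
by rewrite !big_seq_fset1 -!/(nrm _ _) /= !n.
Qed.

End TestFunction.

(** * The Kirchhoff Laplacian *)

Section ImaginaryUnit.
Variables (R : realType) (T : metric_tree R).
Local Notation C := (Rcomplex R).
Local Notation ip := (ip T).
Local Notation core := (core T).
Local Notation j := (@core_fun R T).
Local Notation d := (@core_der R T).
Implicit Types (x y : L2space T) (c : core) (z w : C).

Lemma mul_iK z : mul_i (mul_i z) = - z.
Proof. by case: z => a b; congr (_ +i* _) => /=; ring. Qed.

Lemma mul_i_lin (a : R) z w : mul_i (a *: z + w) = a *: mul_i z + mul_i w.
Proof. by case: z => ? ?; case: w => ? ?; congr (_ +i* _) => /=; ring. Qed.

Lemma mul_i0 : mul_i 0 = 0 :> C.
Proof. by congr (_ +i* _) => /=; ring. Qed.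

Lemma mul_i_sum (I : Type) (r : seq I) (F : I -> C) :
  mul_i (\sum_(k <- r) F k) = \sum_(k <- r) mul_i (F k).
Proof.
elim: r => [|k r IH]; first by rewrite !big_nil mul_i0.
by rewrite !big_cons -IH -[F k]scale1r mul_i_lin !scale1r.
Qed.

Lemma imul_linear : linear (@imul R T).
Proof.
by move=> a x y; apply: val_inj; apply/funext => e; apply/funext => t;
  exact: mul_i_lin.
Qed.
HB.instance Definition _ := GRing.isLinear.Build R (L2space T) (L2space T) _
  (@imul R T) imul_linear.

Lemma imulK x : imul (imul x) = - x.
Proof.
by apply: val_inj; apply/funext => e; apply/funext => t; exact: mul_iK.
Qed.

Lemma ip_imul x y : ip (imul x) (imul y) = ip x y.
Proof.
congr rsum; apply/funext => e; rewrite /dot addrC.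
have re (u : tfun T) : repart (mul_i_fun u e) = fun t => - impart (u e) t.
  by apply/funext => t; rewrite /repart Re_mul_i.
have im (u : tfun T) : impart (mul_i_fun u e) = repart (u e).
  by apply/funext => t; rewrite /impart Im_mul_i.
rewrite !re !im; congr (_ + _).
by apply: eq_Rintegral => t _; rewrite mulrNN.
Qed.

Lemma ip_imulr x y : ip x (imul y) = - ip (imul x) y.
Proof. by rewrite -(ip_imul x) imulK !formE. Qed.

Lemma icore_subproof c :
  (mul_i_fun (val c).1, mul_i_fun (val c).2) \in @core_pred R T.
Proof.
have [h1 h2 h3 h4] := coreP c.
apply/asboolP; split => /=.
- move=> e; have [d2 h] := core_H2 c e.
  by apply/H2P; eexists; exact: H2_data_mul_i h.
- apply: sub_finite_set h2 => e [t [tl ft]]; exists t; split => //.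
  apply: contra_neq ft => ft; rewrite /mul_i_fun.
  by rewrite [X in mul_i X]ft mul_i0.
- move=> v e e' ve ve'; have := h3 v e e' ve ve'.
  rewrite /value_at /mul_i_fun.
  by case: ifP; case: ifP => _ _ ->.
- move=> v; have := h4 v; have fv := edges_at_finite v.
  rewrite !fsbig_finite//= => hv.
  transitivity (mul_i (0 : C)); last exact: mul_i0.
  rewrite -[X in mul_i X]hv mul_i_sum; apply: eq_bigr => e _.
  rewrite /inward_deriv /mul_i_fun; case: ifP => // _.
  by rewrite /mul_i mulrN.
Qed.

Definition icore c : core :=
  exist (fun p => p \in @core_pred R T) _ (icore_subproof c).

Lemma icore_fun c : (j : {linear core -> _}) (icore c) = imul (j c).
Proof. exact: val_inj. Qed.

Lemma icore_der c : (d : {linear core -> _}) (icore c) = imul (d c).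
Proof. exact: val_inj. Qed.

Lemma core_cvg_icore cs x : core_cvg ip j d cs x ->
  core_cvg ip j d (fun n => icore (cs n)) (imul x).
Proof.
move=> [h1 h2]; split=> e e0.
  have [N NP] := h1 e e0; exists N => n /NP.
  by rewrite icore_fun -linearB ip_imul.
have [N NP] := h2 e e0; exists N => m n Nm Nn.
by rewrite !icore_der -linearB ip_imul; exact: NP.
Qed.

End ImaginaryUnit.

Section Transfer.
Variables (R : realType) (T : metric_tree R).
Local Notation ip := (ip T).
Local Notation j := (@core_fun R T).
Local Notation d := (@core_der R T).
Local Notation core_cvg := (core_cvg ip j d).

Definition form_dom_space := form_space ip j d.
HB.instance Definition _ := SubChoice.on form_dom_space.
HB.instance Definition _ := GRing.Lmodule.on form_dom_space.
Local Notation V := form_dom_space.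

Definition energy : psd_form V :=
  closed_form_space (@core_closable R T).
Definition incl : {linear V -> L2space T} := form_incl (ip := ip) (j := j) (d := d).

Local Notation operator := (operator ip energy incl).
Implicit Types (v w : V) (x y g : L2space T).

Lemma iform_subproof v : imul (incl v) \in form_domain ip j d.
Proof.
have [cs h] := form_spaceP v; apply/asboolP; exists (fun n => icore (cs n)).
exact: core_cvg_icore h.
Qed.

Definition iform v : V := exist _ (imul (incl v)) (iform_subproof v).

Lemma incl_inj v w : incl v = incl w -> v = w.
Proof. exact: val_inj. Qed.

Lemma iformK v : iform (iform v) = - v.
Proof. by apply: incl_inj; rewrite linearN; exact: imulK. Qed.

Lemma energy_cvg v w cs cs' : core_cvg cs (incl v) -> core_cvg cs' (incl w) ->
  (fun n => ip (d (cs n)) (d (cs' n))) @ \oo --> energy v w.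
Proof. by move=> h h'; exact: (closed_cvg (@core_closable R T) h h'). Qed.

Lemma energy_iform v w : energy (iform v) (iform w) = energy v w.
Proof.
have [cs h] := form_spaceP v; have [cs' h'] := form_spaceP w.
have h1 := energy_cvg h h'.
have h2 := energy_cvg (core_cvg_icore h : core_cvg _ (incl (iform v)))
  (core_cvg_icore h' : core_cvg _ (incl (iform w))).
apply: (cvg_unique (@Rhausdorff R) h2); apply: (cvg_ext _ h1) => n.
by rewrite !icore_der ip_imul.
Qed.

(** Multiplication by i is an isometry of the energy and of L^2, so it commutes with H; real
    eigenspaces are therefore complex ones. *)
Lemma operator_iform v x : operator v x -> operator (iform v) (imul x).
Proof.
move=> vx h; rewrite -energy_iform iformK formNl vx.
by rewrite [incl _]/(imul (incl h)) ip_imulr opprK.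
Qed.

End Transfer.

(** * The spectrum of the tree operator in terms of real forms *)

Section Translate.
Variables (R : realType) (T : metric_tree R).
Local Notation C := (Rcomplex R).
Local Notation ip := (ip T).
Local Notation core := (core T).
Local Notation j := (@core_fun R T).
Local Notation d := (@core_der R T).
Local Notation core_cvg := (core_cvg ip j d).
Local Notation V := (form_dom_space T).
Local Notation energy := (energy T).
Local Notation incl := (incl T).
Local Notation mass := (form_pullback ip incl).
Local Notation operator := (operator ip energy incl).
Local Notation resolvent := (resolvent ip energy incl).
Local Notation eigenvec := (eigenvec ip energy incl).
Local Notation discrete := (discrete ip energy incl).
Implicit Types (v w : V) (x y g : L2space T) (f h : tree_fun T).

Lemma form_cvgP x fs dfs : form_cvg fs dfs (val x : tree_fun T) <->
  exists2 cs : nat -> core, (forall n, val (cs n) = (fs n, dfs n)) & core_cvg cs x.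
Proof.
have sq (cs : nat -> core) n : sqnorm ((val (cs n)).1 - val x : tree_fun T) =
    (ip (j (cs n) - x) (j (cs n) - x))%:E.
  exact: (sqnormE (j (cs n) - x)).
have sqd (cs : nat -> core) m n :
    sqnorm ((val (cs n)).2 - (val (cs m)).2 : tree_fun T) =
    (ip (d (cs n) - d (cs m)) (d (cs n) - d (cs m)))%:E.
  exact: (sqnormE (d (cs n) - d (cs m))).
split=> [[h1 h2 h3]|[cs csE [h2 h3]]].
  have cP n : (fs n, dfs n) \in @core_pred R T by apply/asboolP; exact: h1.
  pose cs n : core := exist (fun p => p \in @core_pred R T) _ (cP n).
  exists cs => //; split=> e e0.
    have /fine_cvgP[_ /cvgrPdist_le/(_ e e0)[N _ NP]] := h2.
    exists N => n Nn; have := NP n Nn; rewrite sub0r normrN /comp.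
    have -> : sqnorm (fs n - (val x : tree_fun T)) = _ := sq cs n.
    by move=> H; exact: le_trans (ler_norm _) H.
  have [N NP] := h3 e e0; exists N => m n Nm Nn.
  have := NP n m Nn Nm; have -> : sqnorm (dfs m - dfs n) = _ := sqd cs n m.
  by rewrite lee_fin.
have fE n : fs n = (val (cs n)).1 by rewrite csE.
have dE n : dfs n = (val (cs n)).2 by rewrite csE.
split.
- by move=> n; rewrite fE dE; exact: coreP.
- have -> : (fun n => sqnorm (fs n - (val x : tree_fun T))) =
      (fun n => (ip (j (cs n) - x) (j (cs n) - x))%:E).
    by apply/funext => n; rewrite fE sq.
  apply/cvg_EFin; first exact: nearW.
  apply/cvgrPdist_le => e e0; have [N NP] := h2 e e0; exists N => // n Nn.
  rewrite sub0r normrN ger0_norm ?form_ge0//. exact: NP n Nn.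
- move=> e e0; have [N NP] := h3 e e0; exists N => m n Nm Nn.
  by rewrite !dE sqd lee_fin; exact: NP.
Qed.

Lemma form_domP f : form_dom f <-> exists v : V, f = val (incl v).
Proof.
split=> [[L2f [fs [dfs fc]]]|[v ->]].
  pose x : L2space T := exist (fun f => f \in @L2pred R T) _ (introT (L2predP _) L2f).
  have /(form_cvgP x)[cs _ csx] := fc.
  have xD : x \in form_domain ip j d by apply/asboolP; exists cs.
  by exists (exist (fun x => x \in form_domain ip j d) x xD).
split; first exact/L2predP/(valP (incl v)).
have [cs csv] := form_spaceP v.
exists (fun n => (val (cs n)).1), (fun n => (val (cs n)).2); apply/form_cvgP.
by exists cs => // n; rewrite -surjective_pairing.
Qed.

Lemma inner_derE (c c' : core) : inner ((val c).2 : tree_fun T) (val c').2 =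
  ip (d c) (d c') +i* ip (d c) (d (icore c')).
Proof. by rewrite (innerE (d c) (d c')) icore_der. Qed.

Lemma Re_le_normc (z : R[i]) : `|complex.Re z| <= Normc.normc z.
Proof.
by case: z => a b /=; rewrite -sqrtr_sqr ler_wsqrtr// lerDl sqr_ge0.
Qed.

Lemma Im_le_normc (z : R[i]) : `|complex.Im z| <= Normc.normc z.
Proof.
by case: z => a b /=; rewrite -sqrtr_sqr ler_wsqrtr// lerDr sqr_ge0.
Qed.

Lemma normc_le (z : R[i]) : Normc.normc z <= `|complex.Re z| + `|complex.Im z|.
Proof.
rewrite -ler_sqr ?nnegrE ?addr_ge0//; last by case: z => a b; exact: sqrtr_ge0.
rewrite normc_sq sqrrD !real_normK ?num_real//.
have : 0 <= `|complex.Re z| * `|complex.Im z| by exact: mulr_ge0.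
lra.
Qed.

(** The imaginary part of the sesquilinear form at (v, w) is the real form at (v, i w), as for the
    inner product. *)
Lemma closed_formP v w z : closed_form (val (incl v) : tree_fun T) (val (incl w)) z <->
  energy v w = complex.Re z /\ energy v (iform w) = complex.Im z.
Proof.
have lim cs cs' : core_cvg cs (incl v) -> core_cvg cs' (incl w) ->
    (fun n => ip (d (cs n)) (d (cs' n)) - complex.Re z) @ \oo --> energy v w - complex.Re z /\
    (fun n => ip (d (cs n)) (d (icore (cs' n))) - complex.Im z) @ \oo -->
      energy v (iform w) - complex.Im z.
  move=> h h'; have k (a : R) : (fun _ : nat => - a) @ \oo --> - a by exact: cvg_cst.
  split; first exact: cvg_seqD (energy_cvg h h') (k _).
  have h'' : core_cvg _ (incl (iform w)) := core_cvg_icore h'.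
  exact: cvg_seqD (energy_cvg h h'') (k _).
split=> [[fs [dfs [hs [dhs [/form_cvgP[cs csE h] /form_cvgP[cs' csE' h'] c]]]]]|[re im]].
  have [l1 l2] := lim _ _ h h'.
  have E n : inner (dfs n) (dhs n) =
      ip (d (cs n)) (d (cs' n)) +i* ip (d (cs n)) (d (icore (cs' n))).
    have -> : dfs n = (val (cs n)).2 by rewrite csE.
    have -> : dhs n = (val (cs' n)).2 by rewrite csE'.
    exact: inner_derE.
  have null (u : nat -> R) : (forall n, `|u n| <= Normc.normc (inner (dfs n) (dhs n) - z)) ->
      u @ \oo --> (0 : R).
    move=> uc; apply/norm_cvg0P; apply: (squeeze_cvgr _ (cvg_cst (0 : R)) c).
    by apply: nearW => n; rewrite normr_ge0 uc.
  split; apply/eqP; rewrite -subr_eq0; apply/eqP.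
    apply: (cvg_unique (@Rhausdorff R) l1); apply: null => n.
    by apply: le_trans (Re_le_normc _); rewrite E; case: (z).
  apply: (cvg_unique (@Rhausdorff R) l2); apply: null => n.
  by apply: le_trans (Im_le_normc _); rewrite E; case: (z).
have [cs h] := form_spaceP v; have [cs' h'] := form_spaceP w.
have [l1 l2] := lim _ _ h h'; rewrite re subrr in l1; rewrite im subrr in l2.
exists (fun n => (val (cs n)).1), (fun n => (val (cs n)).2).
exists (fun n => (val (cs' n)).1), (fun n => (val (cs' n)).2); split.
- by apply/form_cvgP; exists cs => // n; rewrite -surjective_pairing.
- by apply/form_cvgP; exists cs' => // n; rewrite -surjective_pairing.
have := cvg_seqD (cvg_norm l1) (cvg_norm l2); rewrite !normr0 addr0 => l.
apply: (squeeze_cvgr _ (cvg_cst (0 : R)) (l _ _)); apply: nearW => n.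
apply/andP; split; first by case: (_ - _) => a b; exact: sqrtr_ge0.
by apply: le_trans (normc_le _) _; rewrite inner_derE; case: (z).
Qed.

(** The real identity for all h yields the complex one: its imaginary part is the real identity at i
    h. *)
Lemma kirchhoffP v g : kirchhoff (val (incl v) : tree_fun T) (val g) <-> operator v g.
Proof.
split=> [[_ _ H] h|H].
  have hD : form_dom (val (incl h) : tree_fun T) by apply/form_domP; exists h.
  by have /closed_formP[-> _] := H _ hD; rewrite innerE.
split; first by apply/form_domP; exists v.
  exact/L2predP/(valP g).
move=> h /form_domP[w ->]; apply/closed_formP; rewrite innerE/=.
by split; exact: H.
Qed.

Lemma real_scaleE (l : R) (z : C) : l%:C * (z : R[i]) = l *: z.
Proof. by case: z => a b; congr (_ +i* _) => /=; ring. Qed.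

Lemma scaleE l x : scale l (val x : tree_fun T) = val (l *: x).
Proof.
by apply/funext => e; apply/funext => t; exact: real_scaleE.
Qed.

Lemma eigenfunP l v : eigenfun l (val (incl v) : tree_fun T) <-> eigenvec l v.
Proof. by rewrite /eigenfun scaleE; exact: kirchhoffP. Qed.

Lemma kirchhoff_shift l v g :
  kirchhoff (val (incl v) : tree_fun T) (val g + scale l (val (incl v) : tree_fun T)) <->
  operator v (g + l *: incl v).
Proof. by rewrite scaleE; exact: (kirchhoffP v (g + l *: incl v)). Qed.

Lemma L2_lift f : L2 f -> exists x, f = val x.
Proof. by move=> /L2predP f2; exists (exist (fun f => f \in @L2pred R T) _ f2). Qed.

Lemma resolvent_setP l : resolvent_set T l <-> resolvent l.
Proof.
split=> [[H1 [C CP]]|[H1 [C CP]]]; split.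
- move=> g; have /H1[f fg] : L2 (val g : tree_fun T) by exact/L2predP/(valP g).
  have [/form_domP[v fE] _ _] := fg; rewrite fE in fg.
  by exists v; exact/kirchhoff_shift.
- exists C => v g /kirchhoff_shift/CP.
  by rewrite !sqnormE -EFinM lee_fin.
- move=> f /L2_lift[g ->]; have [v vg] := H1 g.
  by exists (val (incl v)); exact/kirchhoff_shift.
(* g is not assumed to be in L^2; it is the difference of g + l f and l f, which both are. *)
- exists C => f g fg; have [/form_domP[v fE] gL2 _] := fg.
  have [g' gE] : exists g' : L2space T, g = val g'.
    have [y yE] := L2_lift gL2; exists (y - l *: incl v).
    rewrite fE scaleE in yE.
    apply/funext => e; apply/funext => t.
    have E : g e t + val (l *: incl v) e t = val y e t.
      exact: (congr1 (fun u : tree_fun T => u e t) yE).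
    exact: (canRL (addrK _) E).
  rewrite {}gE {}fE in fg gL2 *; have := CP v g' ((kirchhoff_shift _ _ _).1 fg).
  by rewrite !sqnormE -EFinM lee_fin.
Qed.

Lemma isolatedP l : isolated_in (spectrum T) l <-> isolated ip energy incl l.
Proof.
split=> -[e e0 H]; exists e => // mu nmu.
  by apply: H => /resolvent_setP.
by apply: H => /resolvent_setP.
Qed.

Lemma eigenvalueP l : Defs.eigenvalue T l <-> exists2 v, eigenvec l v & mass v v != 0.
Proof.
split=> [[f [ef fn]]|[v ev vn]]; last first.
  exists (val (incl v)); split; first exact/eigenfunP.
  by rewrite sqnormE; apply: contra_neq vn => -[].
have [/form_domP[v fE] _ _] := ef; rewrite {}fE in ef fn.
exists v; first exact/eigenfunP.
by apply: contra_neq fn => m0; rewrite sqnormE; congr (_%:E).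
Qed.

Lemma Rcomplex_mulE (c z : C) : (c : R[i]) * z =
  complex.Re c *: z + complex.Im c *: mul_i z.
Proof.
by case: c => a b; case: z => p q; congr (_ +i* _) => /=; ring.
Qed.

Lemma val_incl_sum n (c : 'I_n -> R) (b : 'I_n -> V) e t :
  val (incl (\sum_k c k *: b k)) e t = \sum_k c k *: val (incl (b k)) e t.
Proof.
elim/big_rec2: _ => [|k y u _ <-]; first by rewrite linear0.
by rewrite linearP.
Qed.

(* A complex span of eigenfunctions b_k is the real span of the b_k and i b_k. *)
Lemma finite_multiplicityP l : finite_multiplicity T l <->
  exists n (b : 'I_n -> V), (forall k, eigenvec l (b k)) /\
    forall v, eigenvec l v -> exists c : 'I_n -> R,
      mass (v - \sum_k c k *: b k) (v - \sum_k c k *: b k) = 0.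
Proof.
split=> [[n [b [eb H]]]|[n [b [eb H]]]]; last first.
  exists n, (fun k => val (incl (b k))); split; first by move=> k; exact/eigenfunP.
  move=> f ef; have [/form_domP[v fE] _ _] := ef; rewrite {}fE in ef *.
  have /eigenfunP/H[c cP] := ef.
  exists (fun k => (c k)%:C); rewrite -[0%E]/(0%:E) -[0 in RHS]cP -[mass _ _]/(ip _ _) -sqnormE.
  congr sqnorm; apply/funext => e; apply/funext => t.
  rewrite linearB -[RHS]/(val (incl v) e t - val (incl (\sum_k c k *: b k)) e t).
  rewrite val_incl_sum; congr (_ - _); apply: eq_bigr => k _.
  by rewrite Rcomplex_mulE /= scale0r addr0.
have /choice[w wE] k : exists w : V, b k = val (incl w).
  by have [/form_domP] := eb k.
pose b' (k : 'I_(n + n)) := match fintype.split k with inl i => w i | inr i => iform (w i) end.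
have ew k : eigenvec l (w k) by apply/eigenfunP; rewrite -wE.
exists (n + n)%N, b'; split.
  move=> k; rewrite /b'; case: (fintype.split k) => i; first exact: ew.
  by have := operator_iform (ew i); rewrite linearZ.
move=> v /eigenfunP/H[c cP].
exists (fun k => match fintype.split k with
  | inl i => complex.Re (c i) | inr i => complex.Im (c i) end).
apply: EFin_inj; rewrite -[mass _ _]/(ip _ _) -sqnormE -[RHS]cP.
congr sqnorm; apply/funext => e; apply/funext => t.
rewrite linearB -[LHS]/(val (incl v) e t - val (incl _) e t).
have -> : \sum_(i < n) c i * b i e t =
    \sum_(i < n) (complex.Re (c i) *: (val (incl (w i)) e t : C) +
      complex.Im (c i) *: mul_i (val (incl (w i)) e t)) :> C.
  by apply: eq_bigr => i _; rewrite wE Rcomplex_mulE.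
rewrite val_incl_sum big_split_ord big_split; congr (_ - (_ + _)).
  apply: eq_bigr => k _; rewrite /b'.
  rewrite -[fintype.split (lshift n k)]/(fintype.split (unsplit (inl k))).
  by rewrite unsplitK.
apply: eq_bigr => k _; rewrite /b'.
rewrite -[fintype.split (rshift n k)]/(fintype.split (unsplit (inr k))).
by rewrite unsplitK.
Qed.

Lemma discrete_spectrumP l :
  discrete_spectrum T l <-> ~ resolvent l /\ discrete l.
Proof.
split=> [[nres /isolatedP h1 /eigenvalueP h2 /finite_multiplicityP h3]|].
  by split; [move/resolvent_setP/nres|split].
move=> [nres [/isolatedP h1 /eigenvalueP h2 /finite_multiplicityP h3]].
by split => // /resolvent_setP.
Qed.

Lemma ess_spectrumP l : ess_spectrum T l <-> ~ (resolvent l \/ discrete l).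
Proof.
split=> [[/= nr nd] [/resolvent_setP//|dl]|nrd].
  by apply: nd; apply/discrete_spectrumP; split => // /resolvent_setP.
split; first by move=> /resolvent_setP rl; apply: nrd; left.
by move=> /discrete_spectrumP[_ dl]; apply: nrd; right.
Qed.

End Translate.

Section Rate.
Variable R : realType.
Implicit Types (K L : \bar R) (l k r : R).

Lemma rate_fin k r : 0 < r ->
  (k%:E ^+ 2 / (4%:E * r%:E ^+ 2) = (k ^+ 2 / (4 * r ^+ 2))%:E)%E.
Proof.
move=> r0; rewrite -!EFin_expe -EFinM inver mulf_eq0 sqrf_eq0 (gt_eqF r0).
by rewrite pnatr_eq0/= EFinM.
Qed.

Lemma rate_zero k : 0 < k -> (k%:E ^+ 2 / (4%:E * 0%:E ^+ 2) = +oo :> \bar R)%E.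
Proof.
move=> k0; rewrite -!EFin_expe -EFinM expr0n mulr0 inve0 gt0_muley//.
by rewrite lte_fin exprn_gt0.
Qed.

Lemma rate_infty K : ((K ^+ 2 / (4%:E * +oo ^+ 2)) = 0 :> \bar R)%E.
Proof.
have -> : (+oo ^+ 2 = +oo :> \bar R)%E by rewrite expe2 mulyy.
by rewrite gt0_muley ?lte_fin// invey mule0.
Qed.

(** Below the extended rate there is room for real numbers a < K and b > L; these survive the
    passage to an infimum or supremum that is not attained, and cover L = 0. *)
Lemma rate_approx K L l : (2^-1%:E <= K <= 1%:E)%E -> (0 <= L)%E -> 0 <= l ->
  (l%:E < K ^+ 2 / (4%:E * L ^+ 2))%E ->
  exists a b : R, [/\ 0 < a, 0 < b, (a%:E < K)%E, (L < b%:E)%E & l < (a / b) ^+ 2 / 4].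
Proof.
case: K => [k| |] // /andP[k1 k2]; last by move: k2; rewrite leNgt ltry.
have k0 : 0 < k by move: k1; rewrite lee_fin; apply: lt_le_trans; rewrite invr_gt0.
case: L => [r| |] // r0 l0; last by rewrite rate_infty lte_fin ltNge l0.
move: r0; rewrite lee_fin le_eqVlt => /predU1P[<- _|r0].
  (* For L = 0 the rate is infinite; b is taken so that a/b = 4l + 1, whose square over 4 exceeds
     l. *)
  exists (k / 2), (k / 2 / (4 * l + 1)).
  have l4 : 0 < 4 * l + 1 by lra.
  split; rewrite ?lte_fin ?divr_gt0 ?ltr_pdivrMr//; first by lra.
  have -> : k / 2 / (k / 2 / (4 * l + 1)) = 4 * l + 1.
    by field; rewrite !gt_eqF.
  rewrite ltr_pdivlMr//; have := sqr_ge0 l; lra.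
rewrite rate_fin// lte_fin => lq.
have [q qE] : exists q, q = k ^+ 2 / (4 * r ^+ 2) by eexists.
rewrite -qE in lq.
have q0 : 0 < q by exact: le_lt_trans lq.
(* Moving both numbers by a factor 1 - s multiplies the rate q by (1 - s)^4 >= 1 - 4s, and 4 s q is
   half of q - l. *)
pose s := (q - l) / (8 * q).
have s0 : 0 < s by apply: divr_gt0; [rewrite subr_gt0|exact: mulr_gt0].
have s1 : s <= 8^-1.
  by rewrite ler_pdivrMr ?mulr_gt0// mulrA mulVf ?mul1r// gerBl.
have sq : 8 * q * s = q - l by rewrite mulrC divfK// gt_eqF// mulr_gt0.
have t0 : 0 < 1 - s by lra.
exists ((1 - s) * k), (r / (1 - s)); split.
- exact: mulr_gt0.
- exact: divr_gt0.
- by rewrite lte_fin gtr_pMl//; lra.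
- by rewrite lte_fin ltr_pdivlMr// gtr_pMr//; lra.
have -> : ((1 - s) * k / (r / (1 - s))) ^+ 2 / 4 = (1 - s) ^+ 4 * q.
  by rewrite qE; field; rewrite !gt_eqF.
have h4 : 1 - 4 * s <= (1 - s) ^+ 4.
  have : 0 <= (1 - 2 * s) by lra.
  have := sqr_ge0 s; nra.
have : (1 - 4 * s) * q <= (1 - s) ^+ 4 * q by rewrite ler_wpM2r// ltW.
lra.
Qed.

End Rate.

(** * Lower bounds and the two characterisations *)

Section Conclusion.
Variables (R : realType) (T : metric_tree R).
Hypothesis deg_neq2 : forall v : vertex T, deg v <> 2%N.
Hypothesis no_loose_ends : forall v : vertex T, deg v <> 1%N.
Local Notation ip := (ip T).
Local Notation j := (@core_fun R T).
Local Notation d := (@core_der R T).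
Local Notation V := (form_dom_space T).
Local Notation energy := (energy T).
Local Notation incl := (incl T).
Local Notation mass := (form_pullback ip incl).
Local Notation resolvent := (resolvent ip energy incl).
Local Notation discrete := (discrete ip energy incl).

Lemma energy_complete : form_complete (form_add energy mass).
Proof. exact: (closed_complete (@core_complete R T)). Qed.

Lemma energy_bound n (phi : 'I_n -> L2space T) (K c : R) :
  (forall u : core T, c * ip (j u) (j u) <=
     ip (d u) (d u) + K * \sum_k ip (j u) (phi k) ^+ 2) ->
  forall v, c * mass v v <= energy v v + K * \sum_k ip (incl v) (phi k) ^+ 2.
Proof. exact: (closed_bound (@core_closable R T)). Qed.

Lemma inf_Kcomb_bound : (2^-1%:E <= inf_Kcomb T <= 1%:E)%E.
Proof.
apply/andP; split.
  apply: le_ereal_inf_tmp => _ [v _ <-]; rewrite lee_fin.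
  by have /andP[] := Kcomb_bound deg_neq2 no_loose_ends v.
apply: (@le_trans _ _ (Kcomb (Defs.root T))%:E).
  by apply: ereal_inf_lbound; exists (Defs.root T).
by rewrite lee_fin; have /andP[] := Kcomb_bound deg_neq2 no_loose_ends (Defs.root T).
Qed.

Lemma infinite_setC (U : Type) (X : set U) : infinite_set [set: U] ->
  finite_set X -> exists u, ~ X u.
Proof.
move=> infU fX; apply: contrapT => /forallNP all; apply: infU.
by apply: sub_finite_set fX => u _; apply: contrapT => /all.
Qed.

Lemma ess_Kcomb_bound : (2^-1%:E <= ess_Kcomb T <= 1%:E)%E.
Proof.
apply/andP; split.
  apply: (@le_trans _ _ (ereal_inf [set (Kcomb v)%:E | v in ~` (set0 : set (vertex T))])).
    apply: le_ereal_inf_tmp => _ [v _ <-]; rewrite lee_fin.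
    by have /andP[] := Kcomb_bound deg_neq2 no_loose_ends v.
  by apply: ereal_sup_ubound; exists set0 => //; exact: finite_set0.
apply: ge_ereal_sup => _ [X fX <-].
have [v vX] := infinite_setC (@tree_infinite T) fX.
apply: (@le_trans _ _ (Kcomb v)%:E); first by apply: ereal_inf_lbound; exists v.
by rewrite lee_fin; have /andP[] := Kcomb_bound deg_neq2 no_loose_ends v.
Qed.

Lemma max_length_gt0 : (0 < max_length T)%E.
Proof.
have [e _] := infinite_setC (@edges_infinite T) (finite_set0 _).
apply: (@lt_le_trans _ _ (len e)%:E); first by rewrite lte_fin len_gt0.
by apply: ereal_sup_ubound; exists e.
Qed.

Lemma ess_max_length_ge0 : (0 <= ess_max_length T)%E.
Proof.
apply: le_ereal_inf_tmp => _ [X fX <-].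
have [e eX] := infinite_setC (@edges_infinite T) fX.
apply: (@le_trans _ _ (len e)%:E); first by rewrite lee_fin ltW// len_gt0.
by apply: ereal_sup_ubound; exists e.
Qed.

Lemma resolvent_lt0 l : l < 0 -> resolvent l.
Proof.
apply: (resolvent_below energy_complete) => v.
by rewrite mul0r form_ge0.
Qed.

Lemma ratio_le (a b k r : R) : 0 < a -> 0 < r -> a <= k -> r <= b ->
  a / b <= k / r.
Proof.
move=> a0 r0 ak rb; have b0 := lt_le_trans r0 rb.
apply: ler_pM => //; rewrite ?invr_ge0 ?(ltW a0) ?(ltW b0)//.
by rewrite lef_pV2.
Qed.

Lemma resolvent_below_rate l :
  (l%:E < inf_Kcomb T ^+ 2 / (4%:E * max_length T ^+ 2))%E -> resolvent l.
Proof.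
move=> lB; have [/resolvent_lt0//|l0] := ltP l 0.
have [a [b [a0 b0 aK Lb lab]]] :=
  rate_approx inf_Kcomb_bound (ltW max_length_gt0) l0 lB.
have H (e : edge T) : a / b <= Kcomb (init e) / len e.
  apply: ratio_le => //; first exact: len_gt0.
    rewrite -lee_fin; apply: le_trans (ltW aK) _.
    by apply: ereal_inf_lbound; exists (init e).
  rewrite -lee_fin; apply: le_trans _ (ltW Lb).
  by apply: ereal_sup_ubound; exists e.
apply: (resolvent_below energy_complete) lab => v.
have bound (u : core T) : (a / b) ^+ 2 / 4 * ip (j u) (j u) <=
    ip (d u) (d u) + 0 * \sum_(k < 0) ip (j u) 0 ^+ 2.
  rewrite mul0r addr0; apply: core_cheeger => //; exact: divr_gt0.
by have := energy_bound bound v; rewrite mul0r addr0.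
Qed.

Lemma discrete_below_rate l :
  (l%:E < ess_Kcomb T ^+ 2 / (4%:E * ess_max_length T ^+ 2))%E ->
  resolvent l \/ discrete l.
Proof.
move=> lB; have [/resolvent_lt0|l0] := ltP l 0; first by left.
have [a [b [a0 b0 aK Lb lab]]] := rate_approx ess_Kcomb_bound ess_max_length_ge0 l0 lB.
have [_ [Y fY <-] aY] := ereal_sup_gt aK.
have [_ [X fX <-] Xb] := ereal_inf_lt Lb.
(* Exceptional edges: those too long, and those starting at a vertex of exceptional curvature,
   finitely many by local finiteness. *)
pose Z := X `|` \bigcup_(v in Y) out_edges v.
have fZ : finite_set Z.
  rewrite finite_setU; split => //; apply: bigcup_finite => // v _.
  exact: finite_out_edges.
(* Both inequalities must be strict: the first gives coercivity at l, the second leaves room to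
   absorb the exceptional edges. *)
have [c0 lc0 c0ab] : exists2 c0, l < c0 & c0 < (a / b) ^+ 2 / 4.
  by exists ((l + (a / b) ^+ 2 / 4) / 2); lra.
have H (e : edge T) : e \notin fset_set Z -> a / b <= Kcomb (init e) / len e.
  rewrite in_fset_set// notin_setE => /not_orP[nX nY].
  apply: ratio_le => //; first exact: len_gt0.
    rewrite -lee_fin; apply: le_trans (ltW aY) _.
    by apply: ereal_inf_lbound; exists (init e) => // Ye; apply: nY; exists (init e).
  rewrite -lee_fin; apply: le_trans _ (ltW Xb).
  by apply: ereal_sup_ubound; exists e.
have [s [M M0 sP]] :=
  core_cheeger_off deg_neq2 no_loose_ends (divr_gt0 a0 b0) c0ab H.
have bound (u : core T) : c0 * ip (j u) (j u) <= ip (d u) (d u) +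
    M * \sum_(k < size s) ip (j u) (nth 0 s k) ^+ 2.
  by have := sP u; rewrite (big_nth 0) big_mkord.
exact: (resolvent_or_discrete energy_complete M0 (energy_bound bound) lc0).
Qed.

Definition test_vec e : V := core_embed ip j d (test e).

Lemma test_vec_energy e e' :
  energy (test_vec e) (test_vec e') = ip (d (test e)) (d (test e')).
Proof. exact: (closed_core (@core_closable R T)). Qed.

(** A positive bottom of the spectrum puts a neighbourhood of 0 in the resolvent set, so the lower
    bound 0 of the form improves to some d0 > 0; testing on a single edge gives d0 <= 441/len^2. *)
Lemma max_length_bounded : (0 < lambda0 T)%E -> (max_length T < +oo)%E.
Proof.
move=> lam0.
have [eta eta0 etaP] : exists2 eta : R, 0 < eta & (eta%:E <= lambda0 T)%E.
  move: lam0; case: (lambda0 T) => [r r0|_|//]; first by exists r.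
  (* The infimum is +oo when the spectrum is empty; any positive eta will do. *)
  by exists 1 => //; rewrite leey.
have res mu : mu < eta -> resolvent mu.
  move=> mue; apply: contrapT => nres.
  have : (lambda0 T <= mu%:E)%E.
    by apply: ereal_inf_lbound; exists mu => // /resolvent_setP.
  by move=> /(le_trans etaP); rewrite lee_fin leNgt mue.
have [|||||d0 d00 d0P] := @spectral_bottom_gap _ _ _ _ _ _ energy_complete [::] 0 eta.
- by [].
- by move=> u _; rewrite mul0r form_ge0.
- exact: eta0.
- move=> mu _; rewrite subr0 => h; apply: res; exact: le_lt_trans (ler_norm _) h.
- by move=> f ef _; apply: resolvent_eigenvec ef; exact: res.
apply: (@le_lt_trans _ _ (1 + 21 ^+ 2 / d0)%:E); last exact: ltry.
apply: ge_ereal_sup => _ [e _ <-]; rewrite lee_fin.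
have [m0 mE] := test_bound e.
have l2 : 0 < len e ^+ 2 by rewrite exprn_gt0// len_gt0.
have /d0P : perp ip incl [::] (test_vec e) by [].
rewrite add0r test_vec_energy => /le_trans/(_ mE).
rewrite (ler_pM2r m0) ler_pdivlMr// mulrC -ler_pdivlMr// => h.
have key (l p : R) : l ^+ 2 <= p -> l <= 1 + p.
  by clear; have := sqr_ge0 (l - 1); have := sqr_ge0 l; lra.
exact: key.
Qed.

(** Otherwise infinitely many edges are longer than some r > 0, and their test functions form an
    orthogonal family with Rayleigh quotients at most 441/r^2. *)
Lemma ess_max_length_eq0 :
  (forall l, resolvent l \/ discrete l) -> ess_max_length T = 0%E.
Proof.
move=> all; apply/eqP; rewrite eq_le ess_max_length_ge0 andbT leNgt.
apply/negP => L0.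
have [r r0 rL] : exists2 r : R, 0 < r & (r%:E < ess_max_length T)%E.
  move: L0; case: (ess_max_length T) => [r r0|_|//].
    by exists (r / 2); rewrite ?lte_fin ?divr_gt0//; move: r0; rewrite lte_fin; lra.
  by exists 1 => //; rewrite ltry.
have : infinite_set [set e : edge T | r <= len e].
  move=> fX; move: rL; rewrite ltNge => /negP; apply.
  apply: (@le_trans _ _ (ereal_sup [set (len e)%:E | e in ~` [set e : edge T | r <= len e]])).
    by apply: ereal_inf_lbound; exists [set e : edge T | r <= len e].
  apply: ge_ereal_sup => _ [e /= /negP er <-].
  by rewrite lee_fin ltW// ltNge.
move=> /infiniteP/card_leP/unsquash F.
pose f k : edge T := val (F (exist _ k (mem_set I))).
have fr k : r <= len (f k) by exact/set_mem/(valP (F _)).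
have finj k l : k != l -> f k != f l.
  by apply: contra_neq => /val_inj/(inj (mem_set I) (mem_set I))/(congr1 val).
apply: (exists_not_discrete (M := 21 ^+ 2 / r ^+ 2) (c := fun k => test_vec (f k))
  energy_complete) all.
- by move=> k; exact: (test_bound (f k)).1.
- move=> k; rewrite test_vec_energy; have [m0 mE] := test_bound (f k).
  apply: le_trans mE _; apply: ler_wpM2r; first exact: ltW.
  apply: ler_wpM2l; first exact: sqr_ge0.
  have l0 := len_gt0 (f k).
  rewrite lef_pV2 ?posrE ?exprn_gt0//.
  by rewrite ler_pXn2r// nnegrE ltW.
- by move=> k l kl; exact: (test_orth (finj _ _ kl)).1.
- by move=> k l kl; rewrite test_vec_energy; exact: (test_orth (finj _ _ kl)).2.
Qed.

End Conclusion.

Local Close Scope complex_scope.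
Local Close Scope ring_scope.
Local Open Scope ereal_scope.

Theorem lemma8p1 (R : realType) (T : metric_tree R)
    (deg_neq2 : forall v : vertex T, deg v <> 2%N)
    (no_loose_ends : forall v : vertex T, deg v <> 1%N) :
  inf_Kcomb T ^+ 2 / (4%:E * max_length T ^+ 2) <= lambda0 T /\
  ess_Kcomb T ^+ 2 / (4%:E * ess_max_length T ^+ 2) <= lambda0_ess T /\
  (0 < lambda0 T <-> max_length T < +oo) /\
  (ess_spectrum T = set0 <-> ess_max_length T = 0).
Proof.
have bound : inf_Kcomb T ^+ 2 / (4%:E * max_length T ^+ 2) <= lambda0 T.
  apply: le_ereal_inf_tmp => _ [l nl <-]; rewrite leNgt; apply/negP => lB.
  exact/nl/resolvent_setP/resolvent_below_rate.
split=> //; split.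
  apply: le_ereal_inf_tmp => _ [l /ess_spectrumP nl <-]; rewrite leNgt.
  by apply/negP => lB; exact/nl/discrete_below_rate.
split; split.
- exact: max_length_bounded.
(* With curvature at least 1/2 and a finite positive maximal length, the lower bound just proved is
   strictly positive. *)
- move=> fin; apply: lt_le_trans bound.
  have := inf_Kcomb_bound deg_neq2 no_loose_ends.
  have := max_length_gt0 T; move: fin.
  case: (max_length T) => [r| |]// _; rewrite lte_fin => r0.
  case: (inf_Kcomb T) => [k| |]//; last by rewrite [X in _ && X]leNgt ltry andbF.
  rewrite !lee_fin => /andP[k0 _]; rewrite rate_fin// lte_fin.
  have k1 : (0 < k)%R by apply: lt_le_trans k0; rewrite invr_gt0.
  by rewrite divr_gt0 ?mulr_gt0 ?exprn_gt0.
- move=> ess0; apply: ess_max_length_eq0 => l; apply: contrapT => /ess_spectrumP.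
  by rewrite ess0.
(* For essential length 0 the rate is +oo, so every real l lies below it and is a resolvent or
   discrete point. *)
- move=> L0; rewrite -subset0 => l /ess_spectrumP; apply.
  apply: discrete_below_rate => //; rewrite L0.
  have := ess_Kcomb_bound deg_neq2 no_loose_ends.
  case: (ess_Kcomb T) => [k| |]//; last by rewrite [X in _ && X]leNgt ltry andbF.
  rewrite !lee_fin => /andP[k0 _]; rewrite rate_zero ?ltry//.
  by apply: lt_le_trans k0; rewrite invr_gt0.
Qed.
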